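(* Let $\mathbb{K}$, $\mathcal{S}$, ${\rm mult}(\mathscr{B}(\mathcal{S}))$ and $J_1^L,J_2^L$ be as in the context. Then: (1) ${\rm mult}(\mathscr{B}(\mathcal{S}))=\deg(\mathcal{S})^2-\mathrm{degMap}(\mathcal{S})$. (2) There exists a non-empty Zariski open subset $\Omega'_{\mathcal{S}}$ of the group of projective transformations of $\mathbb{P}^2(\mathbb{K})$ such that for every $L\in\Omega'_{\mathcal{S}}$, $$\deg_{\overline t}\Big({\rm Primpart}_{\overline x}\big({\rm Res}_{t_3}(J_1^L,J_2^L)\big)\Big)=\mathrm{degMap}(\mathcal{S}).$$
   Context: $\mathbb{K}$ is an algebraically closed field of characteristic zero. $\mathcal{S}=(s_1:s_2:s_3):\mathbb{P}^2(\mathbb{K})\dashrightarrow\mathbb{P}^2(\mathbb{K})$ is a dominant rational map with $s_i\in\mathbb{K}[t_1,t_2,t_3]$ homogeneous of the same degree $\deg(\mathcal{S})$, $\gcd(s_1,s_2,s_3)=1$, and $s_i(0,0,1)\ne0$ for all $i$. $\mathrm{degMap}(\mathcal{S})$ is the cardinality of the generic fiber of $\mathcal{S}$. $\mathscr{B}(\mathcal{S})$ is the set of common zeros of the $s_i$ in $\mathbb{P}^2(\mathbb{K})$. With indeterminates $\overline x=(x_1,x_2,x_3)$, $\overline y=(y_1,y_2,y_3)$ and $\mathbb{F}$ the algebraic closure of $\mathbb{K}(\overline x,\overline y)$, $V_1=\sum x_is_i$, $V_2=\sum y_is_i$ and ${\rm mult}(\mathscr{B}(\mathcal{S}))=\sum_{A\in\mathscr{B}(\mathcal{S})}{\rm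 mult}_A(\mathscr{C}(V_1),\mathscr{C}(V_2))$ (intersection multiplicities in $\mathbb{P}^2(\mathbb{F})$). For a projective transformation $L=(L_1:L_2:L_3)$ of $\mathbb{P}^2(\mathbb{K})$, $J_1^L=x_3L_1(s_1,s_2,s_3)-x_1L_3(s_1,s_2,s_3)$, $J_2^L=x_3L_2(s_1,s_2,s_3)-x_2L_3(s_1,s_2,s_3)$. ${\rm Res}_{t_3}$ is the resultant w.r.t. $t_3$; ${\rm Primpart}_{\overline x}(R)=R/{\rm Content}_{\overline x}(R)$, where ${\rm Content}_{\overline x}(R)$ is the gcd in $\mathbb{K}[t_1,t_2]$ of the coefficients of $R$ as a polynomial in $\overline x$; $\deg_{\overline t}$ is the degree in $t_1,t_2$. *)

(* Defs.v *)
From HB Require Import structures.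
From mathcomp Require Import all_boot all_order all_algebra.
From mathcomp Require Import mpoly.

Set Implicit Arguments.
Unset Strict Implicit.
Unset Printing Implicit Defensive.

Import Order.TTheory GRing.Theory Num.Theory.
Local Open Scope ring_scope.

Section Projective.
Variable K : fieldType.

Definition nonzero3 (u : 'I_3 -> K) : Prop := exists i, u i != 0.

(* u and v represent the same projective point (u = c v, c <> 0) *)
Definition prop_eq (u v : 'I_3 -> K) : Prop :=
  exists c : K, c != 0 /\ forall i, u i = c * v i.

Definition homog_poly (P : {mpoly K[3]}) : Prop := exists e, P \is e.-homog.

Definition e001 : 'I_3 -> K := fun i => if val i == 2%N then 1 else 0.

Variable s : 'I_3 -> {mpoly K[3]}.

Definition evalS (t : 'I_3 -> K) : 'I_3 -> K := fun i => (s i).@[t].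

Definition base_pt (t : 'I_3 -> K) : Prop :=
  nonzero3 t /\ forall i, (s i).@[t] = 0.

Definition gcd_one : Prop :=
  forall q : {mpoly K[3]}, (forall i, exists r, s i = q * r) ->
    exists c : K, c != 0 /\ q = c%:MP.

(* S is dominant: its image S(P^2 \ B(S)) is Zariski dense in P^2, i.e.
   it is contained in no proper closed subset V(P), P homogeneous nonzero *)
Definition dominant : Prop :=
  forall P : {mpoly K[3]}, homog_poly P ->
    (forall t, nonzero3 t -> ~ base_pt t -> P.@[evalS t] = 0) -> P = 0.

(* non-empty Zariski open subsets of P^2(K) (as cones of nonzero vectors) *)
Definition zopen_P2 (U : ('I_3 -> K) -> Prop) : Prop :=
  exists I : {mpoly K[3]} -> Prop, (forall f, I f -> homog_poly f) /\
    forall p, U p <-> (nonzero3 p /\ exists f, I f /\ f.@[p] != 0).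

Definition in_fiber (p t : 'I_3 -> K) : Prop :=
  nonzero3 t /\ ~ base_pt t /\ prop_eq (evalS t) p.

Definition in_image (p : 'I_3 -> K) : Prop := exists t, in_fiber p t.

Definition fiber_card (p : 'I_3 -> K) (n : nat) : Prop :=
  exists ts : 'I_n -> ('I_3 -> K),
    (forall k, in_fiber p (ts k)) /\
    (forall k l, prop_eq (ts k) (ts l) -> k = l) /\
    (forall t, in_fiber p t -> exists k, prop_eq t (ts k)).

Definition is_degMap (n : nat) : Prop :=
  exists U, zopen_P2 U /\ (exists p, U p) /\
    forall p, U p -> in_image p -> fiber_card p n.

End Projective.

(* ---------- intersection multiplicity (Fulton's definition) ---------- *)
Section IntersectionMultiplicity.
Variable F : fieldType.

(* f lies in the ideal (g,h) O_P of the local ring O_P of A^2 at P *)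
Definition local_ideal_mem (g h f : {mpoly F[2]}) (P : 'I_2 -> F) : Prop :=
  exists b a c : {mpoly F[2]}, b.@[P] != 0 /\ b * f = a * g + c * h.

(* the classes of fs in O_P/(g,h)O_P are F-linearly independent *)
Definition local_indep (g h : {mpoly F[2]}) (P : 'I_2 -> F) (m : nat)
    (fs : 'I_m -> {mpoly F[2]}) : Prop :=
  forall c : 'I_m -> F, local_ideal_mem g h (\sum_k c k *: fs k) P ->
    forall k, c k = 0.

(* I_P(g,h) = dim_F O_P/(g,h)O_P = m *)
Definition local_imult (g h : {mpoly F[2]}) (P : 'I_2 -> F) (m : nat) : Prop :=
  (exists fs : 'I_m -> {mpoly F[2]}, local_indep g h P fs) /\
  ~ (exists fs : 'I_m.+1 -> {mpoly F[2]}, local_indep g h P fs).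

Definition chart_idx (a : 'I_3 -> F) : 'I_3 :=
  if a ord_max != 0 then ord_max
  else if a (inord 1) != 0 then inord 1 else ord0.

Definition chart_sub (i : 'I_3) (j : 'I_3) : {mpoly F[2]} :=
  match unlift i j with Some k => 'X_k | None => 1 end.

Definition dehom (i : 'I_3) (G : {mpoly F[3]}) : {mpoly F[2]} :=
  mmap (fun c => c%:MP) (chart_sub i) G.

Definition chart_pt (i : 'I_3) (a : 'I_3 -> F) : 'I_2 -> F :=
  fun k => a (lift i k) / a i.

Definition imult_proj (G H : {mpoly F[3]}) (a : 'I_3 -> F) (m : nat) : Prop :=
  local_imult (dehom (chart_idx a) G) (dehom (chart_idx a) H)
    (chart_pt (chart_idx a) a) m.

End IntersectionMultiplicity.

Section Closure.
Variables (K : fieldType) (F : closedFieldType) (phi : {rmorphism K -> F}).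
Variable z : 'I_6 -> F.  (* z = (x1,x2,x3,y1,y2,y3) *)

Definition alg_indep : Prop :=
  forall p : {mpoly K[6]}, (map_mpoly phi p).@[z] = 0 -> p = 0.

(* w is algebraic over K(z) *)
Definition alg_over (w : F) : Prop :=
  exists P : {poly {mpoly K[6]}}, P != 0 /\
    (map_poly (fun c => (map_mpoly phi c).@[z]) P).[w] = 0.

(* (F, phi, z) is an algebraic closure of the field K(x,y) of rational
   functions in six indeterminates *)
Definition is_closure_Kxy : Prop := alg_indep /\ forall w, alg_over w.

Definition xs : 'I_3 -> F := fun i => z (lshift 3 i).
Definition ys : 'I_3 -> F := fun i => z (rshift 3 i).

Variable s : 'I_3 -> {mpoly K[3]}.

Definition Vlin (c : 'I_3 -> F) : {mpoly F[3]} :=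
  \sum_(i < 3) c i *: map_mpoly phi (s i).

Definition mult_base (m : nat) : Prop :=
  exists nb (bs : 'I_nb -> ('I_3 -> K)) (ms : 'I_nb -> nat),
    (forall k, base_pt s (bs k)) /\
    (forall k l, prop_eq (bs k) (bs l) -> k = l) /\
    (forall t, base_pt s t -> exists k, prop_eq t (bs k)) /\
    (forall k, imult_proj (Vlin xs) (Vlin ys) (fun i => phi (bs k i)) (ms k)) /\
    m = (\sum_k ms k)%N.

End Closure.

Section Resultants.
Variable K : fieldType.

(* A = K[t1,t2][x1,x2,x3]; {poly A} = A[t3] *)
Local Notation A := {mpoly {mpoly K[2]}[3]}.

Definition tvar (j : 'I_3) : {poly A} :=
  match val j with
  | 0 => ((('X_(inord 0) : {mpoly K[2]})%:MP : A)%:P)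
  | 1 => ((('X_(inord 1) : {mpoly K[2]})%:MP : A)%:P)
  | _ => 'X
  end.

Definition cst (c : K) : {poly A} := (((c%:MP : {mpoly K[2]})%:MP : A)%:P).

Definition embT (p : {mpoly K[3]}) : {poly A} := mmap cst tvar p.

Definition xvar (i : 'I_3) : {poly A} := (('X_i : A)%:P).

Variable s : 'I_3 -> {mpoly K[3]}.

Definition Lsum (L : 'M[K]_3) (k : 'I_3) : {poly A} :=
  \sum_(j < 3) cst (L k j) * embT (s j).

Definition J1 (L : 'M[K]_3) : {poly A} :=
  xvar (inord 2) * Lsum L (inord 0) - xvar (inord 0) * Lsum L (inord 2).
Definition J2 (L : 'M[K]_3) : {poly A} :=
  xvar (inord 2) * Lsum L (inord 1) - xvar (inord 1) * Lsum L (inord 2).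

Definition ResJ (L : 'M[K]_3) : A := resultant (J1 L) (J2 L).

Definition is_content (R : A) (C : {mpoly K[2]}) : Prop :=
  (forall m, exists r, R@_m = C * r) /\
  (forall D : {mpoly K[2]}, (forall m, exists r, R@_m = D * r) ->
     exists r, C = D * r).

Definition deg_t (P : A) : nat := (\max_(m <- msupp P) (msize (P@_m)).-1)%N.

Definition primpart_deg_eq (L : 'M[K]_3) (n : nat) : Prop :=
  (exists C P, is_content (ResJ L) C /\ ResJ L = C%:MP * P) /\
  (forall C P, is_content (ResJ L) C -> ResJ L = C%:MP * P -> deg_t P = n).

(* Omega is a Zariski open subset of the group PGL_3(K) of projective
   transformations, represented by its (scaling invariant) preimage in GL_3 *)
Definition zopen_PGL3 (Om : 'M[K]_3 -> Prop) : Prop :=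
  (forall L c, c != 0 -> Om L -> Om (c *: L)) /\
  exists I : {mpoly K[3 * 3]} -> Prop, forall L,
    Om L <-> (L \in unitmx /\ exists f, I f /\ f.@[fun k => mxvec L 0 k] != 0).

End Resultants.

(* Main.v *)
Require Import Defs.
From HB Require Import structures.
From mathcomp Require Import all_boot all_order all_algebra.
From mathcomp Require Import perm mpoly.
From mathcomp Require Import ring.
From Stdlib Require Import Classical ClassicalEpsilon FunctionalExtensionality.
Import Order.TTheory GRing.Theory Num.Theory.
Local Open Scope ring_scope.
Set Implicit Arguments.
Unset Strict Implicit.
Unset Printing Implicit Defensive.

(** The resultant R in t3 of V_1 = sum x_i s_i and V_2 = sum y_i s_i is a form of degree d^2 in t1, t2,
    and its order at a point of the line at infinity equals the sum of the intersection multiplicities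
    of the two curves over the corresponding line through (0:0:1): the local ring quotient is the
    cokernel of the Sylvester matrix over a discrete valuation ring, whose length is the order of
    the determinant. The common zeros of V_1 and V_2 are the base points together with the fibre of
    S over p = x * y (cross product).

    There is a nonzero polynomial W such that W(x, y) <> 0 forces the fibre points to be transversal
    intersections (the Jacobian of S is nonzero in characteristic zero, and the image of its zero
    curve is contained in a curve avoiding p), not to lie on a line joining (0:0:1) to a base point a,
    and R to have a constant order o_a along each such line. Hence the fibre has
    n = d^2 - sum o_a points, while the multiplicities of the base points add up to sum o_a.

    At a point x, J_1^L and J_2^L are two such curves, with p proportional to L^-1 x. So the content
    of their resultant is the product of the powers o_a of the linear forms of the lines of the base
    points: it divides all coefficients by the constancy of o_a, and any other common linear factor
    would give a line through (0:0:1) meeting, for general x, a point of the fibre over L^-1 x,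
    whereas the image of this line is contained in a fixed curve. *)

(** * Multivariate polynomials *)

(** The claims live over different fields: the multiplicities over the closure of K(x, y), the
    fibres and the content over K. A single [W] with coefficients in K serves all of them, because
    its nonvanishing gives [good] over every algebraically closed field E with a map from K: at the
    generic point it follows from algebraic independence, over K it cuts out the open sets. This is
    why the same d^2 - sum o_a occurs in each claim. The condition s_i(0,0,1) != 0 makes the leading
    coefficients in t3 constants that are nonzero for general coefficients. Hence resultants commute
    with specialization, and no common zero hides at the centre of projection. The local analysis
    wants charts in which a line through (0:0:1) is X = 0, whereas Fulton's definition sets a
    coordinate to 1. The two are compared through [hmult], a multiplicity defined by forms and free
    of charts. The gcd condition yields R != 0: by Gauss's lemma some pair of curves of the net has
    no common component. Dominance is used as algebraic independence of the s_i, which gives a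
    nonzero Jacobian. *)

Section MpolyTools.
Variables (n : nat) (R : comNzRingType).

Lemma mpoly_ring_ind (P : {mpoly R[n]} -> Prop) :
    (forall c, P c%:MP) -> (forall i, P 'X_i) ->
    (forall p q, P p -> P q -> P (p + q)) ->
    (forall p q, P p -> P q -> P (p * q)) ->
  forall p, P p.
Proof.
move=> PC PX PD PM; elim/mpolyind => [|c m p _ _ IH]; first by rewrite -mpolyC0.
apply: (PD) => //; rewrite -mul_mpolyC; apply: (PM) => //.
rewrite mpolyXE_id; apply: (big_ind P) => [||i _]; rewrite -?mpolyC1 //.
by elim: (m i) => [|k IHk]; rewrite ?expr0 -?mpolyC1 // exprS; apply: (PM).
Qed.

Lemma mpoly_rmorph_ext (S : nzRingType) (f g : {rmorphism {mpoly R[n]} -> S}) :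
  (forall c, f c%:MP = g c%:MP) -> (forall i, f 'X_i = g 'X_i) -> f =1 g.
Proof.
move=> hC hX; elim/mpoly_ring_ind => // p q hp hq.
  by rewrite !rmorphD hp hq.
by rewrite !rmorphM hp hq.
Qed.

Lemma mmapXU (S : comNzRingType) (h : 'I_n -> S) (f : {rmorphism R -> S}) i :
  mmap f h 'X_i = h i.
Proof. by rewrite mmapX mmap1U. Qed.

Lemma map_mpolyXU (S : comNzRingType) (f : {rmorphism R -> S}) i :
  map_mpoly f ('X_i : {mpoly R[n]}) = 'X_i.
Proof. exact: map_mpolyX. Qed.

Lemma meval_map_mpoly (S : comNzRingType) (f : {rmorphism R -> S}) (p : {mpoly R[n]}) v :
  (map_mpoly f p).@[f \o v] = f p.@[v].
Proof.
pose F : {rmorphism {mpoly R[n]} -> S} := meval (f \o v) \o map_mpoly f.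
pose G : {rmorphism {mpoly R[n]} -> S} := f \o meval v.
apply: (mpoly_rmorph_ext (f := F) (g := G)) => [c|i] /=.
  by rewrite map_mpolyC !mevalC.
by rewrite map_mpolyXU !mevalXU.
Qed.

End MpolyTools.

Section LastVar.
Variables (n : nat) (R : comNzRingType).

Definition lastvar_gen (i : 'I_n.+1) : {poly {mpoly R[n]}} :=
  if unlift ord_max i is Some j then ('X_j)%:P else 'X.
Definition lastvar : {mpoly R[n.+1]} -> {poly {mpoly R[n]}} :=
  mmap (polyC \o @mpolyC n R) lastvar_gen.
HB.instance Definition _ := GRing.RMorphism.copy lastvar lastvar.

Lemma lastvar_eval p (v : 'I_n -> R) x :
  (map_poly (meval v) (lastvar p)).[x] =
  p.@[fun i => if unlift ord_max i is Some j then v j else x].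
Proof.
set w := fun _ => _.
pose F : {rmorphism {mpoly R[n.+1]} -> R} :=
  horner_eval x \o map_poly (meval v) \o lastvar.
apply: (mpoly_rmorph_ext (f := F) (g := meval w)) => [c|i] /=.
  by rewrite /lastvar mmapC /= map_polyC /= /horner_eval hornerC !mevalC.
rewrite /lastvar mmapXU mevalXU /w /lastvar_gen /horner_eval.
by case: unliftP => [j _|_]; rewrite ?map_polyC ?map_polyX ?hornerC ?hornerX //= mevalXU.
Qed.

Lemma lastvar_inj p : lastvar p = 0 -> p = 0.
Proof.
pose lft : {rmorphism {mpoly R[n]} -> {mpoly R[n.+1]}} :=
  mmap (@mpolyC n.+1 R) (fun j => 'X_(lift ord_max j)).
pose F : {rmorphism {mpoly R[n.+1]} -> {mpoly R[n.+1]}} :=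
  horner_eval 'X_ord_max \o map_poly lft \o lastvar.
have FE : F =1 (idfun : {rmorphism _ -> _}).
  apply: mpoly_rmorph_ext => [c|i] /=.
    by rewrite /lastvar mmapC /= map_polyC /= /horner_eval hornerC /lft /= mmapC.
  rewrite /lastvar mmapXU /lastvar_gen /horner_eval.
  case: unliftP => [j ->|->]; rewrite ?map_polyC ?map_polyX ?hornerC ?hornerX //=.
  by rewrite mmapXU.
by move=> p0; have := FE p; rewrite /= p0 rmorph0 /horner_eval horner0 => <-.
Qed.

End LastVar.

Lemma mpoly_nonroot (E : closedFieldType) n (f : {mpoly E[n]}) :
  f != 0 -> exists v, f.@[v] != 0.
Proof.
elim: n f => [|n IH] f nzf.
  exists (fun _ => 0); rewrite (nvar0_mpolyC f) mevalC.
  by apply: contraNneq nzf => f0; rewrite (nvar0_mpolyC f) f0 mpolyC0.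
have nzl : lastvar f != 0 by apply: contraNneq nzf => /lastvar_inj ->.
have [v hv] := IH (lead_coef (lastvar f)) (etrans (congr1 negb (lead_coef_eq0 _)) nzl).
have /closed_nonrootP[x hx] : map_poly (meval v) (lastvar f) != 0.
  by rewrite -lead_coef_eq0 lead_coef_map_id0 ?meval0.
by exists (fun i => if unlift ord_max i is Some j then v j else x); rewrite -lastvar_eval.
Qed.

(** * Local intersection multiplicities along a line *)

Section QuotientDim.
Variables (E : fieldType) (D : nzRingType) (io : {rmorphism E -> D}) (V : lmodType D).
Implicit Types (W : V -> Prop).

(* V carries the E-vector space structure induced by io; subspaces are predicates, and [qdim W m]
   says that V / W has dimension m. *)
Definition subsp W :=
  [/\ W 0, forall x y, W x -> W y -> W (x + y) & forall c x, W x -> W (io c *: x)].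
Definition lcomb m (c : 'I_m -> E) (f : 'I_m -> V) : V := \sum_k io (c k) *: f k.
Definition qindep W m (f : 'I_m -> V) := forall c, W (lcomb c f) -> forall k, c k = 0.
Definition qspans W m (f : 'I_m -> V) := forall v, exists c, W (v - lcomb c f).
Definition qdim W m := exists2 f : 'I_m -> V, qindep W f & qspans W f.

Lemma subspN W x : subsp W -> W x -> W (- x).
Proof. by case=> _ _ WZ /(WZ (-1)); rewrite rmorphN rmorph1 scaleN1r. Qed.

Lemma subspB W x y : subsp W -> W x -> W y -> W (x - y).
Proof. by move=> sW Wx Wy; case: (sW) => _ WD _; apply: WD => //; apply: subspN. Qed.

Lemma subsp_lcomb W m (c : 'I_m -> E) f : subsp W -> (forall k, W (f k)) -> W (lcomb c f).
Proof. by case=> W0 WD WZ Wf; apply: (big_ind W) => // k _; apply: WZ. Qed.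

Lemma lcombZ m a (c : 'I_m -> E) f : lcomb (fun k => a * c k) f = io a *: lcomb c f.
Proof. by rewrite /lcomb scaler_sumr; apply: eq_bigr => k _; rewrite rmorphM scalerA. Qed.

(** Exchange argument: the coordinates of [g] with respect to [f] modulo [W] form an m' by m matrix,
    and if m < m' a nonzero vector of its left kernel is a relation between the [g k]. *)
Lemma qindep_leq W m m' (f : 'I_m -> V) (g : 'I_m' -> V) :
  subsp W -> qspans W f -> qindep W g -> (m' <= m)%N.
Proof.
move=> sW spf ing; rewrite leqNgt; apply/negP => lt_mm'.
pose cf k := proj1_sig (constructive_indefinite_description _ (spf (g k))).
have cfP k : W (g k - lcomb (cf k) f).
  by rewrite /cf; case: (constructive_indefinite_description _ _).
pose C : 'M[E]_(m', m) := \matrix_(k, j) cf k j.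
have nzk : kermx C != 0.
  by rewrite kermx_eq0 /row_free neq_ltn (leq_ltn_trans (rank_leq_col _)).
case/rowV0Pn: nzk => u /sub_kermxP uC nzu.
case/rV0Pn: nzu => k0; case/negP; apply/eqP.
apply: (ing (fun k => u 0 k)).
suff -> : lcomb (fun k => u 0 k) g = lcomb (fun k => u 0 k) (fun k => g k - lcomb (cf k) f).
  exact: subsp_lcomb.
rewrite [RHS](eq_bigr (fun k => io (u 0 k) *: g k - io (u 0 k) *: lcomb (cf k) f)); last first.
  by move=> k _; rewrite scalerBr.
rewrite sumrB -[LHS]subr0; congr (_ - _); symmetry.
rewrite /lcomb (eq_bigr (fun k => \sum_j io (u 0 k * cf k j) *: f j)); last first.
  by move=> k _; rewrite scaler_sumr; apply: eq_bigr => j _; rewrite scalerA rmorphM.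
rewrite exchange_big big1 //= => j _; rewrite -scaler_suml -rmorph_sum.
have := congr1 (fun M : 'rV_m => M 0 j) uC; rewrite !mxE.
by under eq_bigr do rewrite mxE; move=> ->; rewrite rmorph0 scale0r.
Qed.

Lemma qspans_maximal W m (f : 'I_m -> V) : subsp W -> qindep W f ->
  ~ (exists g : 'I_m.+1 -> V, qindep W g) -> qspans W f.
Proof.
move=> sW inf nog v.
pose g (k : 'I_m.+1) := if unlift ord_max k is Some j then f j else v.
have gsum c : lcomb c g = lcomb (fun j => c (lift ord_max j)) f + io (c ord_max) *: v.
  rewrite /lcomb (bigD1_ord ord_max) //= addrC /g unlift_none; congr (_ + _).
  by apply: eq_bigr => j _; rewrite liftK.
have [c Wc [k nzc]] : exists2 c : 'I_m.+1 -> E, W (lcomb c g) & exists k, c k != 0.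
  apply: NNPP => h; apply: nog; exists g => c Wc k; apply/eqP; apply: contra_notT h => nz.
  by exists c => //; exists k.
have nzm : c ord_max != 0.
  apply: contraNneq nzc => c0; move: Wc; rewrite gsum c0 rmorph0 scale0r addr0 => /inf cl.
  by case: (unliftP ord_max k) => [j ->|->]; rewrite ?cl ?c0.
exists (fun j => (- (c ord_max)^-1) * c (lift ord_max j)); rewrite lcombZ rmorphN scaleNr opprK.
case: (sW) => _ _ WZ; have := WZ (c ord_max)^-1 _ Wc.
by rewrite gsum scalerDr scalerA -rmorphM mulVf // rmorph1 scale1r addrC.
Qed.

Lemma qdim_exists W b : subsp W ->
  (forall m (f : 'I_m -> V), qindep W f -> (m <= b)%N) -> exists m, qdim W m.
Proof.
move=> sW hb.
suff [m [[f inf] nog]] : exists m, (exists f : 'I_m -> V, qindep W f) /\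
    ~ (exists f : 'I_m.+1 -> V, qindep W f).
  by exists m, f => //; apply: qspans_maximal.
apply: NNPP => h.
have all m : exists f : 'I_m -> V, qindep W f.
  elim: m => [|m IH]; first by exists (fun _ => 0) => c _ [].
  by apply: NNPP => no; apply: h; exists m.
by have [f /hb] := all b.+1; rewrite ltnn.
Qed.

Lemma qdim_uniq W m m' : subsp W -> qdim W m -> qdim W m' -> m = m'.
Proof.
move=> sW [f i1 s1] [g i2 s2]; apply/eqP; rewrite eqn_leq.
by rewrite (qindep_leq sW s1 i2) (qindep_leq sW s2 i1).
Qed.

Lemma qdim_indep W m : subsp W -> qdim W m ->
  (exists f : 'I_m -> V, qindep W f) /\ ~ (exists f : 'I_m.+1 -> V, qindep W f).
Proof.
move=> sW [f i1 s1]; split; first by exists f.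
by case=> g /(qindep_leq sW s1); rewrite ltnn.
Qed.

Lemma eq_qdim W W' m : (forall v, W v <-> W' v) -> qdim W m -> qdim W' m.
Proof.
move=> h [f i s]; exists f => [c /h|v]; first exact: i.
by have [c /h] := s v; exists c.
Qed.

Lemma qdim_sup W W' m : subsp W -> subsp W' -> (forall v, W v -> W' v) ->
  qdim W m -> exists m', qdim W' m'.
Proof.
move=> sW sW' le [f i s]; apply: (@qdim_exists _ m) => // m' g ing.
by apply: (qindep_leq sW s) => c /le; apply: ing.
Qed.

Lemma qbasis_shift W m (f f' : 'I_m -> V) : subsp W -> (forall k, W (f k - f' k)) ->
  qindep W f -> qspans W f -> qindep W f' /\ qspans W f'.
Proof.
move=> sW Wff i1 s1.
have Wc c : W (lcomb c f - lcomb c f').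
  rewrite /lcomb -sumrB (eq_bigr (fun k => io (c k) *: (f k - f' k))).
    exact: subsp_lcomb.
  by move=> k _; rewrite scalerBr.
case: (sW) => _ WD _; split=> [c Wc'|v].
  by apply: i1; rewrite -(subrK (lcomb c f') (lcomb c f)); apply: WD.
have [c Wv] := s1 v; exists c.
by rewrite -(subrK (lcomb c f) v) -addrA; apply: WD.
Qed.

(** Dimension form of the Chinese remainder theorem. Comaximality moves a basis modulo [W1] into
    [W2] and a basis modulo [W2] into [W1]; the two families together are then a basis modulo the
    intersection. *)
Lemma qdim_cap W1 W2 m1 m2 : subsp W1 -> subsp W2 ->
  (forall v, exists2 w, W1 w & W2 (v - w)) ->
  qdim W1 m1 -> qdim W2 m2 -> qdim (fun v => W1 v /\ W2 v) (m1 + m2).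
Proof.
move=> sW1 sW2 comax [f0 if0 sf0] [g0 ig0 sg0].
have [wf wf1 wf2] := fin_all_exists2 (fun k => comax (f0 k)).
have [wg wg1 wg2] := fin_all_exists2 (fun k => comax (g0 k)).
pose f k := f0 k - wf k.
have [ig sg] := qbasis_shift sW2 wg2 ig0 sg0.
have [|if1 sf] := @qbasis_shift W1 _ f0 f sW1 _ if0 sf0.
  by move=> k; rewrite /f opprB addrC subrK.
pose h (k : 'I_(m1 + m2)) := match split k with inl j => f j | inr j => wg j end.
have hE c : lcomb c h = lcomb (fun j => c (lshift m2 j)) f + lcomb (fun j => c (rshift m1 j)) wg.
  rewrite /lcomb big_split_ord /=; congr (_ + _); apply: eq_bigr => j _; rewrite /h.
    by have -> : split (lshift m2 j) = inl j := unsplitK (inl j).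
  by have -> : split (rshift m1 j) = inr j := unsplitK (inr j).
have fW2 c : W2 (lcomb c f) by apply: subsp_lcomb.
have gW1 c : W1 (lcomb c wg) by apply: subsp_lcomb.
exists h => [c [W1c W2c] k|v].
  move: W1c W2c; rewrite hE => W1c W2c.
  have c1 : forall j, c (lshift m2 j) = 0.
    by apply: if1; rewrite -[lcomb _ f](addrK (lcomb (fun j => c (rshift m1 j)) wg)); apply: subspB.
  have c2 : forall j, c (rshift m1 j) = 0.
    apply: ig; rewrite -[lcomb _ wg](addKr (lcomb (fun j => c (lshift m2 j)) f)) addrC.
    exact: subspB.
  by rewrite -(splitK k); case: (split k) => j /=.
have [a Wa] := sf v; have [b Wb] := sg v.
exists (fun k => match split k with inl j => a j | inr j => b j end).
rewrite hE.
have -> : lcomb (fun j => match split (lshift m2 j) with inl j => a j | inr j => b j end) f = lcomb a f.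
  by apply: eq_bigr => j _; have -> : split (lshift m2 j) = inl j := unsplitK (inl j).
have -> : lcomb (fun j => match split (rshift m1 j) with inl j => a j | inr j => b j end) wg = lcomb b wg.
  by apply: eq_bigr => j _; have -> : split (rshift m1 j) = inr j := unsplitK (inr j).
by split; [rewrite opprD addrA | rewrite [X in _ - X]addrC opprD addrA]; apply: subspB.
Qed.

End QuotientDim.

(** * Length of the cokernel of a square matrix over E[X] localized at 0 *)

Section LocalCokernel.
Variable E : fieldType.
Local Notation D := {poly E}.
Local Notation pc := (polyC : {rmorphism E -> D}).

Lemma root0_mulX (p : D) : p.[0] = 0 -> exists r, p = 'X * r.
Proof.
move=> p0; have /factor_theorem[r ->] : root p 0 by apply/rootP.
by exists r; rewrite subr0 mulrC.
Qed.

Lemma polyX_neq0 : 'X != 0 :> D. Proof. by rewrite polyX_eq0. Qed.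

(* The row span of M over the localization of E[X] at 0. *)
Definition loc_rows n (M : 'M[D]_n) (v : 'rV[D]_n) : Prop :=
  exists s z, s.[0] != 0 /\ s *: v = z *m M.

Lemma loc_rows_subsp n (M : 'M[D]_n) : subsp pc (loc_rows M).
Proof.
split=> [|x y [s [z [s0 sz]]] [t [w [t0 tw]]]|c x [s [z [s0 sz]]]].
- by exists 1, 0; rewrite hornerC oner_neq0 scaler0 mul0mx.
- exists (s * t), (t *: z + s *: w); rewrite hornerM mulf_neq0 //; split => //.
  by rewrite mulmxDl -!scalemxAl -sz -tw !scalerA [t * s]mulrC scalerDr.
- exists s, (c%:P *: z); split=> //.
  by rewrite -scalemxAl -sz !scalerA mulrC.
Qed.

(** The rows of M(0) are dependent over E, so a row operation with constant coefficients produces a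
    row that vanishes at 0, from which a factor ['X] is extracted. *)
Lemma elim_row n (M : 'M[D]_n) : (\det M).[0] = 0 ->
  exists i0 (A : 'M[D]_n) (M' : 'M[D]_n) a, [/\ a != 0, \det A = a%:P &
    A *m M = diag_mx (\row_j if j == i0 then 'X else 1) *m M'].
Proof.
move=> detM0; pose M0 := map_mx (horner_eval 0) M.
have /eqP/det0P[u nzu uM0] : \det M0 = 0 by rewrite det_map_mx.
case/rV0Pn: nzu => i0 nzi0.
(* The identity with row [i0] replaced by the relation [u]; it is invertible because the entry
   [u 0 i0] is nonzero. *)
pose A0 : 'M[E]_n := \matrix_(i, j) if i == i0 then u 0 j else (i == j)%:R.
have nzA : \det A0 != 0.
  apply/det0P => -[v /rV0Pn[k0 nzv] vA].
  have vE j : (v *m A0) 0 j = v 0 i0 * u 0 j + (if j == i0 then 0 else v 0 j).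
    rewrite mxE (bigD1 i0) //= mxE eqxx; congr (_ + _).
    rewrite (eq_bigr (fun i => if i == j then v 0 i else 0)); last first.
      by move=> i /negbTE ne; rewrite mxE ne; case: eqP; rewrite ?mulr1 ?mulr0.
    rewrite -big_mkcondr /=; case: (eqVneq j i0) => [->|ne].
      by rewrite big_pred0 // => i; case: eqP.
    by rewrite (big_pred1 j) // => i /=; case: (eqVneq i j) => [->|]; rewrite ?ne ?andbF.
  have vj j : v 0 i0 * u 0 j + (if j == i0 then 0 else v 0 j) = 0.
    by rewrite -vE vA mxE.
  have v0 : v 0 i0 = 0.
    by have /eqP := vj i0; rewrite eqxx addr0 mulf_eq0 (negbTE nzi0) orbF => /eqP.
  by case/negP: nzv; have := vj k0; rewrite v0 mul0r add0r; case: eqP => [->|_ ->]; rewrite ?v0.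
pose A := map_mx polyC A0.
have rowA j : ((A *m M) i0 j).[0] = 0.
  transitivity ((u *m M0) 0 j); last by rewrite uM0 mxE.
  rewrite !mxE horner_sum; apply: eq_bigr => i _.
  by rewrite !mxE eqxx hornerM hornerC.
have [w wE] := fin_all_exists (fun j => root0_mulX (rowA j)).
exists i0, A, (\matrix_(i, j) if i == i0 then w j else (A *m M) i j), (\det A0).
split=> //; first by rewrite det_map_mx.
apply/matrixP => i j; move: (A *m M) wE => B wE; rewrite mul_diag_mx !mxE.
by case: eqP => [->|_]; rewrite ?mul1r -?wE.
Qed.

(** Induction on the order of the determinant, in place of a Smith normal form. Each elimination
    removes one ['X] from the determinant and embeds the row span of [M] in that of [M'] with
    codimension one, row [i0] of [M'] spanning the quotient. *)
Lemma loc_rows_qdim n m (M : 'M[D]_n) (q : D) :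
  \det M = 'X^m * q -> q.[0] != 0 -> qdim pc (loc_rows M) m.
Proof.
elim: m M q => [|m IH] M q detM q0.
  exists (fun _ => 0) => [c _ []//|v].
  exists (fun _ => 0), (\det M), (v *m \adj M).
  rewrite detM mul1r; split=> //.
  by rewrite -mulmxA mul_adj_mx detM mul1r mul_mx_scalar /lcomb big_ord0 subr0.
have detM0 : (\det M).[0] = 0 by rewrite detM hornerM hornerXn expr0n mul0r.
have [i0 [A [M' [a [nza detA AM]]]]] := elim_row detM0.
set Dg := diag_mx _ in AM.
have detDg : \det Dg = 'X.
  rewrite det_diag (bigD1 i0) //= mxE eqxx big1 ?mulr1 // => j /negbTE ne.
  by rewrite mxE ne.
have detM' : \det M' = 'X^m * (a%:P * q).
  have := congr1 determinant AM; rewrite !det_mulmx detA detM detDg exprS.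
  rewrite mulrCA -!mulrA => /(mulfI polyX_neq0) <-.
  by rewrite mulrCA.
have aq0 : (a%:P * q).[0] != 0 by rewrite hornerM hornerC mulf_neq0.
have [f fi fs] := IH M' _ detM' aq0.
have nzM' : \det M' != 0.
  by rewrite detM' mulf_neq0 ?expf_neq0 ?polyX_neq0 //; apply: contraNneq aq0 => ->; rewrite horner0.
have uA : A \in unitmx by rewrite unitmxE detA rmorph_unit // unitfE.
have M'I z z' : z *m M' = z' *m M' -> z = z' :> 'rV_n.
  move=> /(congr1 (fun x => x *m \adj M')); rewrite -!mulmxA mul_mx_adj !mul_mx_scalar.
  by move=> e; apply/rowP => j; move/rowP/(_ j): e; rewrite !mxE => /(mulfI nzM').
have DgE (z : 'rV_n) : z *m Dg = \row_j (if j == i0 then z 0 j * 'X else z 0 j).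
  by rewrite mul_mx_diag; apply/rowP => j; rewrite !mxE; case: eqP; rewrite ?mulr1.
have subM v : loc_rows M v -> loc_rows M' v.
  case=> s [z [s0 sz]]; exists s, (z *m invmx A *m Dg); split=> //.
  by rewrite -mulmxA -AM mulmxA mulmxKV.
(* The only obstruction to returning from the span of [M'] to that of [M] is the value at 0 of the
   coordinate [i0]; this scalar is the coefficient of the new basis vector [w]. *)
have supM s v z : s.[0] != 0 -> s *: v = z *m M' -> (z 0 i0).[0] = 0 -> loc_rows M v.
  move=> s0 sz /root0_mulX[r zr].
  exists s, ((\row_j (if j == i0 then r else z 0 j)) *m A); split=> //.
  rewrite -mulmxA AM mulmxA DgE sz; congr (_ *m _); apply/rowP => j.
  by rewrite !mxE; case: eqP => // ->; rewrite zr mulrC.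
pose w : 'rV[D]_n := delta_mx 0 i0 *m M'.
pose h (k : 'I_m.+1) := if unlift ord0 k is Some j then f j else w.
have hE c : lcomb pc c h = (c ord0)%:P *: w + lcomb pc (fun j => c (lift ord0 j)) f.
  rewrite /lcomb big_ord_recl /h unlift_none; congr (_ + _).
  by apply: eq_bigr => j _; rewrite liftK.
have wM' : loc_rows M' w by exists 1, (delta_mx 0 i0); rewrite hornerC oner_neq0 scale1r.
have sM' := loc_rows_subsp M'; have sM := loc_rows_subsp M.
exists h => [c cM|v].
  have cl : forall j, c (lift ord0 j) = 0.
    apply: fi; have := subM _ cM; rewrite hE => hM.
    rewrite -(addKr ((c ord0)%:P *: w) (lcomb _ _ _)) addrC; apply: (subspB sM') => //.
    by case: sM' => _ _ /(_ (c ord0) w wM').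
  suff c0 : c ord0 = 0 by move=> k; case: (unliftP ord0 k) => [j ->|->].
  apply/eqP; apply/negPn/negP => nzc; move: cM; rewrite hE.
  rewrite [X in _ + X]big1 ?addr0 => [|j _]; last by rewrite cl rmorph0 scale0r.
  case=> s [z [s0]]; rewrite /w.
  have -> : z *m M = (z *m invmx A *m Dg) *m M' by rewrite -mulmxA -AM mulmxA mulmxKV.
  rewrite !scalemxAl => /M'I /rowP/(_ i0); rewrite DgE !mxE !eqxx mulr1 => e.
  have := congr1 (horner_eval 0) e; rewrite /horner_eval !hornerM hornerC hornerX mulr0.
  by move/eqP; rewrite mulf_eq0 (negbTE s0) (negbTE nzc).
have [c [s [z [s0 sz]]]] := fs v.
pose c0 := (z 0 i0).[0] / s.[0].
exists (fun k => if unlift ord0 k is Some j then c j else c0).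
rewrite hE unlift_none /=.
rewrite [lcomb _ (fun j => _) f](_ : _ = lcomb pc c f); last first.
  by apply: eq_bigr => j _; rewrite liftK.
apply: (supM s _ (z - (s * c0%:P) *: delta_mx 0 i0)) => //.
  by rewrite mulmxBl -sz -scalemxAl -scalerA opprD addrCA addrC scalerDr scalerN.
by rewrite !mxE !eqxx mulr1 hornerD hornerN hornerM hornerC /c0 mulrCA divff // mulr1 subrr.
Qed.

End LocalCokernel.

(** * Two plane curves along the line X = 0 *)

Section PlaneCurves.
Variable E : closedFieldType.
Local Notation D := {poly E}.
Local Notation V := {poly {poly E}}.
Local Notation pc := (polyC : {rmorphism E -> D}).

(** The outer variable of [V] plays the role of t3. A constant leading coefficient allows division
    by [g] without denominators and preserves the degree on restriction to X = 0. *)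
Definition const_lead (g : V) := exists2 c : E, c != 0 & lead_coef g = c%:P.

Lemma const_lead_div (g f : V) : const_lead g ->
  exists q r, f = q * g + r /\ (size r < size g)%N.
Proof.
case=> c nzc lg; exists (f %/ g), (f %% g); split.
  by apply: Pdiv.IdomainUnit.divp_eq; rewrite lg rmorph_unit ?unitfE.
by rewrite ltn_modp -lead_coef_eq0 lg polyC_eq0.
Qed.

Definition red0 : V -> {poly E} := map_poly (horner_eval 0).
HB.instance Definition _ := GRing.RMorphism.copy red0 (map_poly (horner_eval (0 : E))).

Lemma const_lead_red0 g : const_lead g -> size (red0 g) = size g.
Proof.
case=> c nzc lg; rewrite /red0 size_map_poly_id0 // lg /horner_eval hornerC //.
Qed.

Definition ev0 (b : E) : V -> E := horner_eval b \o red0.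
HB.instance Definition _ b := GRing.RMorphism.copy (ev0 b) (horner_eval b \o red0).

Lemma ev0E b f : ev0 b f = (red0 f).[b]. Proof. by []. Qed.

Lemma ev0_polyC b (s : D) : ev0 b s%:P = s.[0].
Proof. by rewrite ev0E /red0 map_polyC hornerC. Qed.

Definition liftp : {poly E} -> V := map_poly pc.
HB.instance Definition _ := GRing.RMorphism.copy liftp (map_poly pc).

Lemma liftpK p : red0 (liftp p) = p.
Proof. by rewrite /red0 -map_poly_comp map_poly_id // => x _; rewrite /= /horner_eval hornerC. Qed.

Section Ideal.
Variables g h : V.

Definition inI (f : V) : Prop := exists a c, f = a * g + c * h.
(** Denominators in X alone localize along the whole line X = 0, and this is what the Sylvester
    matrix sees; [loc_pt b] localizes at the single point (0, b). *)
Definition loc_line (f : V) : Prop := exists2 s : D, s.[0] != 0 & inI (s%:P * f).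
Definition loc_pt b (f : V) : Prop := exists2 B : V, ev0 b B != 0 & inI (B * f).

Lemma inI0 : inI 0. Proof. by exists 0, 0; rewrite !mul0r addr0. Qed.

Lemma inID x y : inI x -> inI y -> inI (x + y).
Proof.
by case=> a [c ->] [a' [c' ->]]; exists (a + a'), (c + c'); rewrite !mulrDl addrACA.
Qed.

Lemma inIM x y : inI y -> inI (x * y).
Proof. by case=> a [c ->]; exists (x * a), (x * c); rewrite mulrDr !mulrA. Qed.

Lemma inIg : inI g. Proof. by exists 1, 0; rewrite mul1r mul0r addr0. Qed.
Lemma inIh : inI h. Proof. by exists 0, 1; rewrite mul1r mul0r add0r. Qed.

Lemma loc_pt_subsp b : subsp pc (loc_pt b).
Proof.
split=> [|x y [s s0 sx] [t t0 ty]|c x [s s0 sx]].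
- by exists 1; rewrite ?rmorph1 ?oner_neq0 // mulr0; apply: inI0.
- exists (s * t); first by rewrite rmorphM mulf_neq0.
  by rewrite mulrDr -mulrA mulrCA -[s * t * y]mulrA; apply: inID; apply: inIM.
- by exists s => //; rewrite -mul_polyC mulrCA; apply: inIM.
Qed.

Lemma loc_line_subsp : subsp pc loc_line.
Proof.
split=> [|x y [s s0 sx] [t t0 ty]|c x [s s0 sx]].
- by exists 1; rewrite ?hornerC ?oner_neq0 // mulr0; apply: inI0.
- exists (s * t); first by rewrite hornerM mulf_neq0.
  by rewrite rmorphM mulrDr -mulrA mulrCA -[_ * _ * y]mulrA; apply: inID; apply: inIM.
- by exists s => //; rewrite -mul_polyC mulrCA; apply: inIM.
Qed.

Lemma loc_line_pt b f : loc_line f -> loc_pt b f.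
Proof. by case=> s s0 sI; exists s%:P; rewrite ?ev0_polyC. Qed.

Lemma loc_ptM b x y : loc_pt b y -> loc_pt b (x * y).
Proof. by case=> B B0 BI; exists B => //; rewrite mulrCA; apply: inIM. Qed.

Lemma loc_pt_unit b e f : ev0 b e != 0 -> loc_pt b (e * f) -> loc_pt b f.
Proof.
by move=> e0 [B B0 BI]; exists (B * e); rewrite ?rmorphM ?mulf_neq0 //= -mulrA.
Qed.

Hypotheses (gl : const_lead g) (hl : const_lead h) (sg : (1 < size g)%N)
  (sh : (1 < size h)%N).

Lemma Sylvester_rows (z : 'rV[D]_((size h).-1 + (size g).-1)) :
  z *m Sylvester_mx g h = poly_rV (rVpoly (lsubmx z) * g + rVpoly (rsubmx z) * h).
Proof.
by rewrite -{1}[z]hsubmxK mul_row_col !mul_rV_lin1 /= -raddfD.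
Qed.

Lemma loc_rows_Sylvester (f : V) : (size f <= (size h).-1 + (size g).-1)%N ->
  (loc_rows (Sylvester_mx g h) (poly_rV f) <-> loc_line f).
Proof.
move=> szf; have szM (u r : V) m : (size u <= m)%N -> (0 < size r)%N -> (size (u * r)%R <= m + (size r).-1)%N.
  move=> su sr; apply: leq_trans (size_polyMleq _ _) _.
  by rewrite -subn1 leq_subLR addnCA add1n prednK // leq_add2r.
split=> [[s [z [s0 sz]]]|[s s0 [a [c sI]]]].
  exists s => //; exists (rVpoly (lsubmx z)), (rVpoly (rsubmx z)).
  have := congr1 rVpoly sz; rewrite Sylvester_rows linearZ /= !poly_rV_K //.
    by rewrite mul_polyC.
  apply: leq_trans (size_polyD _ _) _; rewrite geq_max; apply/andP; split.
    by apply: szM; rewrite ?size_poly // ltnW.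
  by rewrite addnC; apply: szM; rewrite ?size_poly // ltnW.
(* Reducing the cofactor of [h] modulo [g] bounds its degree. The cofactor of [g] is then bounded as
   well, since the leading coefficient of [g] cannot cancel, so the pair is a vector for the
   Sylvester matrix. *)
have [q [c' [cE sc']]] := const_lead_div c gl.
have {sc'} sc' : (size c' <= (size g).-1)%N by rewrite -ltnS prednK // ltnW.
have sE : s%:P * f = (a + q * h) * g + c' * h by rewrite sI cE; ring.
set a' := a + q * h in sE.
have sa' : (size a' <= (size h).-1)%N.
  have [c0 nzc0 lg] := gl.
  have nzg : g != 0 by rewrite -size_poly_gt0 ltnW.
  have [->|nza] := eqVneq a' 0; first by rewrite size_poly0.
  have : (size (a' * g)%R <= (size h).-1 + (size g).-1)%N.
    rewrite -(addrK (c' * h) (a' * g)) -sE.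
    apply: leq_trans (size_polyD _ _) _; rewrite geq_max; apply/andP; split.
      by rewrite mul_polyC; apply: leq_trans (size_scale_leq _ _) _.
    by rewrite size_polyN addnC; apply: szM => //; rewrite ltnW.
  rewrite size_mul // -(prednK (ltnW sg)) addnS /= leq_add2r => //.
exists s, (row_mx (poly_rV a') (poly_rV c')); split=> //.
by rewrite Sylvester_rows row_mxKl row_mxKr !poly_rV_K // -sE mul_polyC linearZ.
Qed.

(** Division by [g] gives every class a representative of small degree, so the quotient by the
    localized ideal is the cokernel of the Sylvester matrix. *)
Lemma loc_line_qdim o (q : D) : resultant g h = 'X^o * q -> q.[0] != 0 ->
  qdim pc loc_line o.
Proof.
move=> rE q0; have [f fi fs] := loc_rows_qdim rE q0.
have sz k : (size (rVpoly (f k)) <= (size h).-1 + (size g).-1)%N by apply: size_poly.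
have lc c : lcomb pc c (fun k => rVpoly (f k)) = rVpoly (lcomb pc c f).
  by rewrite /lcomb raddf_sum; apply: eq_bigr => k _ /=; rewrite linearZ.
exists (fun k => rVpoly (f k)) => [c|v].
  rewrite lc => /loc_rows_Sylvester-/(_ (size_poly _ _)); rewrite rVpolyK; exact: fi.
have [a [r [vE sr]]] := const_lead_div v gl.
have sr' : (size r <= (size h).-1 + (size g).-1)%N.
  by apply: leq_trans (leq_addl _ _); rewrite -ltnS prednK // ltnW.
have [c hc] := fs (poly_rV r); exists c.
have : loc_line (r - rVpoly (lcomb pc c f)).
  apply/loc_rows_Sylvester; last by rewrite linearB /= rVpolyK.
  by apply: leq_trans (size_polyD _ _) _; rewrite geq_max size_polyN sr' size_poly.
rewrite lc vE -addrA => hr; case: (loc_line_subsp) => _ + _; apply => //.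
exists 1; first by rewrite hornerC oner_neq0.
by rewrite mul1r; apply: inIM; apply: inIg.
Qed.

(** The ideal [J] has no common zero on the line. Starting from [g], the restriction to the line is
    replaced by its gcd with an element of [J] that does not vanish at one of its roots, until it
    becomes constant. *)
Lemma line_nullstellensatz (J : V -> Prop) :
    (forall x y, J x -> J y -> J (x + y)) -> (forall x y, J y -> J (x * y)) -> J g ->
    (forall b, (red0 g).[b] = 0 -> exists2 c, J c & ev0 b c != 0) ->
  exists2 c, J c & red0 c = 1.
Proof.
move=> JD JM Jg; have : red0 g != 0 by rewrite -size_poly_eq0 const_lead_red0 // -lt0n ltnW.
move: (leqnn (size (red0 g))) Jg; move: {2}(size _) => n.
move: g n; clear -JD JM => k n; elim: n k => [|n IH] k szk Jk nzk hk.
  by rewrite leqn0 size_poly_eq0 (negbTE nzk) in szk.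
have [/size_poly1P[c nzc kc]|/closed_rootP[b /rootP kb]] := boolP (size (red0 k) == 1%N).
  exists (c^-1%:P%:P * k); first exact: JM.
  by rewrite rmorphM /= kc /red0 map_polyC /= /horner_eval hornerC -polyCM mulVf.
have [c Jc cb] := hk b kb.
have [[u v] /= uvE] := Bezoutp (red0 k) (red0 c).
(* An element of [J] restricting to the gcd of the two restrictions; its degree is smaller because
   [c] does not vanish at the root [b] of [k]. *)
pose w := liftp u * k + liftp v * c.
have wE : red0 w %= gcdp (red0 k) (red0 c) by rewrite rmorphD !rmorphM /= !liftpK.
have nzw : red0 w != 0 by rewrite -size_poly_eq0 (eqp_size wE) size_poly_eq0 gcdp_eq0 (negbTE nzk).
have wk : red0 w %| red0 k by rewrite (eqp_dvdl _ wE) dvdp_gcdl.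
apply: (IH w) => //; [|by apply: JD; apply: JM|].
  rewrite -ltnS; apply: leq_trans szk; rewrite ltn_neqAle dvdp_leq // andbT.
  apply: contraNneq cb => sw; rewrite ev0E; apply/eqP/rootP.
  rewrite -dvdp_XsubCl; apply: dvdp_trans (dvdp_gcdr (red0 k) _).
  rewrite -(eqp_dvdr _ wE); have : red0 w %= red0 k by rewrite -dvdp_size_eqp // sw.
  by move/eqp_dvdr->; rewrite dvdp_XsubCl; apply/rootP.
move=> b' /rootP wb'; apply: hk; apply/rootP.
by rewrite -dvdp_XsubCl; apply: dvdp_trans wk; rewrite dvdp_XsubCl.
Qed.

Lemma map_resultant_ring (aR rR : nzRingType) (f : {rmorphism aR -> rR}) (p q : {poly aR}) :
    f (lead_coef p) != 0 -> f (lead_coef q) != 0 ->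
  f (resultant p q) = resultant (map_poly f p) (map_poly f q).
Proof.
move=> nz_fp nz_fq; rewrite /resultant /Sylvester_mx !size_map_poly_id0 //.
rewrite -det_map_mx /= map_col_mx; congr (\det (col_mx _ _));
  by apply: map_lin1_mx => v; rewrite map_poly_rV rmorphM /= map_rVpoly.
Qed.

(** The multipliers of [f] into the ideal have no common zero on the line, so one of them restricts
    to 1. Eliminating the outer variable between it and [g] leaves a multiplier in X alone. *)
Lemma loc_line_cap (f : V) : (forall b, ev0 b g = 0 -> ev0 b h = 0 -> loc_pt b f) -> loc_line f.
Proof.
move=> hf.
have [||||c Jc c1] := @line_nullstellensatz (fun B => inI (B * f)).
- by move=> x y; rewrite mulrDl; apply: inID.
- by move=> x y; rewrite -mulrA; apply: inIM.
- by rewrite mulrC; apply: inIM; apply: inIg.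
- move=> b gb; have [hb|hb] := eqVneq (ev0 b h) 0.
    by have [B B0 BI] := hf b gb hb; exists B.
  by exists h => //; rewrite mulrC; apply: inIM; apply: inIh.
(* A multiple of [g] of degree above that of [c] gives a constant leading coefficient, so the
   resultant with [g] can be specialized at X = 0, where it is nonzero. *)
pose M := size c; pose c' := c + 'X^M * g.
have [c0 nzc0 lg] := gl; have nzg : g != 0 by rewrite -size_poly_gt0 ltnW.
have sM : size ('X^M * g) = (M + size g)%N.
  by rewrite mulrC size_mulXn.
have lc' : lead_coef c' = c0%:P.
  rewrite /c' addrC lead_coefDl ?lead_coefM ?lead_coefXn ?mul1r //.
  by rewrite sM -addn1 leq_add2l ltnW.
have sc' : (1 < size c')%N.
  rewrite /c' addrC size_polyDl sM; first by rewrite (leq_trans sg) // leq_addl.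
  by rewrite -addn1 leq_add2l ltnW.
have Jc' : inI (c' * f).
  by rewrite mulrDl; apply: inID => //; rewrite mulrAC; apply: inIM; apply: inIg.
have [[u v] /= _ rE] := resultant_in_ideal sg sc'.
exists (resultant g c').
  have -> : (resultant g c').[0] = resultant (red0 g) (red0 c').
    by apply: (map_resultant_ring (f := horner_eval 0)); rewrite /= ?lg ?lc' /horner_eval hornerC.
  rewrite resultant_eq0 -leqNgt.
  suff : coprimep (red0 g) (red0 c') by rewrite coprimep_def => /eqP->.
  have -> : red0 c' = 1 + red0 'X^M * red0 g by rewrite -c1 -[in RHS]rmorphM -rmorphD.
  apply/Bezout_coprimepP; exists (- red0 'X^M, 1) => /=; rewrite mul1r mulNr addrCA addNr addr0.
  exact: eqpxx.
rewrite rE mulrDl -!mulrA; apply: inID; last exact: inIM.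
by apply: inIM; rewrite mulrC; apply: inIM; apply: inIg.
Qed.

(** In a quotient of finite dimension the powers of the outer variable are dependent. The relation
    is a power of ['X - b] times a polynomial nonzero at b, which is a unit at the point. *)
Lemma loc_pt_nilp b m : qdim pc (loc_pt b) m -> exists k, loc_pt b (liftp (('X - b%:P) ^+ k)).
Proof.
move=> /(qdim_indep (loc_pt_subsp b))[_ no].
have [c Wc [k0 nzc]] : exists2 c : 'I_m.+1 -> E,
    loc_pt b (lcomb pc c (fun k => 'X^k)) & exists k, c k != 0.
  apply: NNPP => hn; apply: no; exists (fun k => 'X^k) => c Wc k; apply/eqP.
  by apply: contra_notT hn => nz; exists c => //; exists k.
pose P := \poly_(k < m.+1) c (inord k).
have nzP : P != 0.
  by apply: contraNneq nzc => P0; have := coef_poly m.+1 (fun k => c (inord k)) k0;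
    rewrite -/P P0 coef0 ltn_ord inord_val => <-.
have PE : lcomb pc c (fun k => 'X^k) = liftp P.
  rewrite /P poly_def rmorph_sum; apply: eq_bigr => k _ /=.
  by rewrite -mul_polyC rmorphM /= inord_val /liftp map_polyC map_polyXn mul_polyC.
have [i [q]] := multiplicity_XsubC P b; rewrite nzP /= => qb Pq.
exists i; apply: (@loc_pt_unit b (liftp q)); first by rewrite ev0E liftpK.
by move: Wc; rewrite PE Pq rmorphM.
Qed.

(* Chinese remainder theorem along the line x = 0. *)
Lemma loc_pts_qdim (ms : E -> nat) (bs : seq E) : uniq bs ->
  (forall b, b \in bs -> qdim pc (loc_pt b) (ms b)) ->
  qdim pc (fun v => forall b, b \in bs -> loc_pt b v) (\sum_(b <- bs) ms b).
Proof.
elim: bs => [_ _|b bs IH /= /andP[bbs ubs] hms].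
  rewrite big_nil; exists (fun _ => 0) => [c _ []//|v].
  by exists (fun _ => 0).
have hms' b' : b' \in bs -> qdim pc (loc_pt b') (ms b').
  by move=> b'bs; apply: hms; rewrite inE b'bs orbT.
have sbs : subsp pc (fun v => forall b, b \in bs -> loc_pt b v).
  split=> [b' _|x y hx hy b' b'bs|c x hx b' b'bs]; have [h0 hD hZ] := loc_pt_subsp b' => //.
    by apply: hD; [apply: hx | apply: hy].
  by apply: hZ; apply: hx.
rewrite big_cons; apply: (@eq_qdim _ _ _ _ (fun v => loc_pt b v /\ forall b, b \in bs -> loc_pt b v)).
  move=> v; split=> [[h1 h2] b'|hv].
    by rewrite inE => /predU1P[->//|]; apply: h2.
  by split=> [|b' b'bs]; apply: hv; rewrite inE ?eqxx ?b'bs ?orbT.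
apply: (qdim_cap (loc_pt_subsp b) sbs); [|by apply: hms; rewrite inE eqxx|exact: IH].
have [k hk] := loc_pt_nilp (hms b (mem_head _ _)).
(* A product of powers of the linear factors of the other points. It lies in all their local ideals,
   and a Bezout relation with the power of ['X - b] gives comaximality. *)
have [p pb hp] : exists2 p : {poly E}, coprimep ('X - b%:P) p &
    forall b', b' \in bs -> loc_pt b' (liftp p).
  elim: bs bbs {IH ubs hms sbs} hms' => [_ _|b' bs IH]; first by exists 1; rewrite ?coprimep1.
  rewrite inE negb_or => /andP[nbb' bbs] hms'.
  have [|p pb hp] := IH bbs; first by move=> c cbs; apply: hms'; rewrite inE cbs orbT.
  have [k' hk'] := loc_pt_nilp (hms' b' (mem_head _ _)).
  exists (('X - b'%:P) ^+ k' * p).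
    rewrite coprimepMr pb andbT; apply: coprimep_expr; rewrite coprimep_XsubC rootE.
    by rewrite hornerXsubC subr_eq0 eq_sym.
  move=> c; rewrite inE rmorphM => /predU1P[->|cbs]; last by apply: loc_ptM; apply: hp.
  by rewrite mulrC; apply: loc_ptM.
have /Bezout_eq1_coprimepP[[u v] /= uv1] : coprimep (('X - b%:P) ^+ k) p by apply: coprimep_expl.
move=> w; exists (w * liftp u * liftp (('X - b%:P) ^+ k)); first exact: loc_ptM.
move=> b' b'bs; have -> : w - w * liftp u * liftp (('X - b%:P) ^+ k) = w * liftp v * liftp p.
  by rewrite -{1}[w]mulr1 -(rmorph1 liftp) -uv1 rmorphD !rmorphM /=; ring.
by apply: loc_ptM; apply: hp.
Qed.

Lemma line_mult_sum (bs : seq E) o (q : D) : uniq bs ->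
    (forall b, (b \in bs) = (ev0 b g == 0) && (ev0 b h == 0)) ->
    resultant g h = 'X^o * q -> q.[0] != 0 ->
  exists ms : E -> nat, (forall b, b \in bs -> qdim pc (loc_pt b) (ms b)) /\
    (\sum_(b <- bs) ms b)%N = o.
Proof.
move=> ubs hbs rE q0; have dl := loc_line_qdim rE q0.
have /(_ _)/constructive_indefinite_description-hm b :=
  qdim_sup loc_line_subsp (loc_pt_subsp b) (@loc_line_pt b) dl.
exists (fun b => proj1_sig (hm b)).
have hms b : b \in bs -> qdim pc (loc_pt b) (proj1_sig (hm b)) by case: (hm b).
split=> //; apply: (qdim_uniq loc_line_subsp) dl.
apply: eq_qdim (loc_pts_qdim ubs hms) => v; split=> [hv|hv b _]; last exact: loc_line_pt.
by apply: loc_line_cap => b gb hb; apply: hv; rewrite hbs gb hb eqxx.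
Qed.

End Ideal.
End PlaneCurves.

Lemma dhomog_eval (R : comNzRingType) n e (f : {mpoly R[n]}) (c : R) (t : 'I_n -> R) :
  f \is e.-homog -> f.@[fun i => c * t i] = c ^+ e * f.@[t].
Proof.
move=> /dhomogP hf; rewrite !mevalE mulr_sumr; apply: eq_big_seq => m mf.
rewrite mulrCA; congr (_ * _).
have -> : c ^+ e = \prod_(i < n) c ^+ m i by rewrite prodrXr -mdegE hf.
by rewrite -big_split; apply: eq_bigr => i _; rewrite exprMn.
Qed.

Lemma dhomog_cast (R : nzRingType) n e e' (f : {mpoly R[n]}) :
  f \is e.-homog -> e = e' -> f \is e'.-homog.
Proof. by move=> + <-. Qed.

Lemma dhomogDB (R : nzRingType) n e (f g h : {mpoly R[n]}) :
  f \is e.-homog -> g \is e.-homog -> h \is e.-homog -> f - (g + h) \is e.-homog.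
Proof. by move=> hf hg hh; apply: rpredB => //; apply: rpredD. Qed.

Lemma dhomog_comb (R : nzRingType) n e m (c : 'I_m -> R) (f : 'I_m -> {mpoly R[n]}) :
  (forall k, f k \is e.-homog) -> \sum_k c k *: f k \is e.-homog.
Proof. by move=> hf; apply: rpred_sum => k _; apply: rpredZ; apply: hf. Qed.

(** * Multiplicities of projective curves in charts *)

Section HomogeneousMultiplicity.
Variable E : closedFieldType.
Variables (d : nat) (G H : {mpoly E[3]}).
Hypotheses (hG : G \is d.-homog) (hH : H \is d.-homog).
Variable Q : 'I_3 -> E.

(* [hmem f]: the homogeneous form f vanishes in the local ring of the projective plane at Q
   modulo (G, H). *)
Definition hmem (f : {mpoly E[3]}) : Prop :=
  exists e B A C, [/\ B \is e.-homog, B.@[Q] != 0 & B * f = A * G + C * H].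
(** Members of a finite family in a local ring can be homogenized to one common degree, so forms of
    equal degree detect its dimension in every chart. *)
Definition hindep m : Prop :=
  exists e (f : 'I_m -> {mpoly E[3]}), (forall k, f k \is e.-homog) /\
    forall c : 'I_m -> E, hmem (\sum_k c k *: f k) -> forall k, c k = 0.
Definition hmult m := hindep m /\ ~ hindep m.+1.

(** * Dehomogenization by an arbitrary linear form [l0] that is nonzero at Q *)

Section Chart.
Variables (D : comNzRingType) (io : {rmorphism E -> D}) (V : comAlgType D).
Variable chart : {rmorphism {mpoly E[3]} -> V}.
Hypothesis chartZ : forall c f, chart (c *: f) = io c *: chart f.
Variable l0 : {mpoly E[3]}.
Hypotheses (l0h : l0 \is 1.-homog) (l0Q : l0.@[Q] != 0).
Hypothesis chart_eval : forall t, l0.@[t] = 1 ->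
  exists ev : {rmorphism V -> E}, forall f, ev (chart f) = f.@[t].
Hypothesis chart_lift : forall v, exists e0, forall e, (e0 <= e)%N ->
  exists2 f, f \is e.-homog & chart f = v.
Variable ev : {rmorphism V -> E}.
Hypothesis evQ : forall f, ev (chart f) = f.@[fun i => (l0.@[Q])^-1 * Q i].

Definition chart_mem (f : V) : Prop :=
  exists B A C, ev B != 0 /\ B * f = A * chart G + C * chart H.

(** A nonzero form is nonzero at some point outside [l0] = 0; rescaled to [l0] = 1, this point is
    visible in the chart. *)
Lemma chart_inj e f : f \is e.-homog -> chart f = 0 -> f = 0.
Proof.
move=> hf f0; apply/eqP; apply: contraTT isT => nzf.
have nzl0 : l0 != 0 by apply: contraNneq l0Q => ->; rewrite meval0.
have [t] := mpoly_nonroot (mulf_neq0 nzf nzl0).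
rewrite mevalM mulf_eq0 negb_or => /andP[ft lt].
have [|ev' hev'] := @chart_eval (fun i => (l0.@[t])^-1 * t i).
  by rewrite (dhomog_eval _ _ l0h) expr1 mulVf.
have := hev' f; rewrite f0 rmorph0 (dhomog_eval _ _ hf) => /esym/eqP.
by rewrite mulf_eq0 (negbTE ft) orbF expf_eq0 invr_eq0 (negbTE lt) andbF.
Qed.

Lemma chart_ev_neq0 e f : f \is e.-homog -> (ev (chart f) != 0) = (f.@[Q] != 0).
Proof.
by move=> hf; rewrite evQ (dhomog_eval _ _ hf) mulf_eq0 expf_eq0 invr_eq0 (negbTE l0Q) andbF.
Qed.

Lemma chart_memP e f : f \is e.-homog -> (chart_mem (chart f) <-> hmem f).
Proof.
move=> hf; split=> [[B [A [C [B0 BE]]]]|[eB [B [A [C [hB B0 BE]]]]]]; last first.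
  exists (chart B), (chart A), (chart C); rewrite (chart_ev_neq0 hB) B0; split=> //.
  by rewrite -!rmorphM BE rmorphD !rmorphM.
have [eb lb] := chart_lift B; have [ea la] := chart_lift A; have [ec lc] := chart_lift C.
(* A common degree in which all three products of the relation have homogeneous lifts; [chart_inj]
   then turns the affine relation into one between forms. *)
pose N := (eb + e + (ea + d) + (ec + d))%N.
have leN a b : (a + b <= N)%N -> (a <= N - b)%N /\ (N - b + b)%N = N.
  by move=> le; rewrite leq_subRL ?[(b + a)%N]addnC // ?subnK // (leq_trans _ le) ?leq_addl.
have [eB NB] := leN eb e (leq_trans (leq_addr _ _) (leq_addr _ _)).
have [eA NA] := leN ea d (leq_trans (leq_addl _ _) (leq_addr _ _)).
have [eC NC] := leN ec d (leq_addl _ _).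
have [B' hB' B'E] := lb _ eB; have [A' hA' A'E] := la _ eA; have [C' hC' C'E] := lc _ eC.
exists (N - e)%N, B', A', C'; split=> //; first by rewrite -(chart_ev_neq0 hB') B'E.
apply/eqP; rewrite -subr_eq0; apply/eqP; apply: (@chart_inj N).
  apply: dhomogDB.
  - exact: dhomog_cast (dhomogM hB' hf) NB.
  - exact: dhomog_cast (dhomogM hA' hG) NA.
  - exact: dhomog_cast (dhomogM hC' hH) NC.
by rewrite rmorphB rmorphD !rmorphM /= B'E A'E C'E BE subrr.
Qed.

Lemma chart_sum m (c : 'I_m -> E) (f : 'I_m -> {mpoly E[3]}) :
  chart (\sum_k c k *: f k) = lcomb io c (fun k => chart (f k)).
Proof. by rewrite rmorph_sum; apply: eq_bigr => k _; rewrite chartZ. Qed.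

Lemma chart_indepP m :
  (exists f : 'I_m -> V, qindep io chart_mem f) <-> hindep m.
Proof.
split=> [[f fi]|[e [f [hf fi]]]]; last first.
  exists (fun k => chart (f k)) => c; rewrite -chart_sum => /(@chart_memP e) h.
  by apply: fi; apply: h; apply: dhomog_comb.
have [e0 he0] := fin_all_exists (fun k => chart_lift (f k)).
pose e := (\max_k e0 k)%N.
have [F hF FE] := fin_all_exists2 (fun k => he0 k e (leq_bigmax k)).
exists e, F; split=> // c /(@chart_memP e) h; apply: fi.
have -> : lcomb io c f = chart (\sum_k c k *: F k).
  by rewrite chart_sum; apply: eq_bigr => k _; rewrite FE.
by apply: h; apply: dhomog_comb.
Qed.

End Chart.
End HomogeneousMultiplicity.

Section ChartLift.
Variables (E : fieldType) (V : comNzRingType) (chart : {rmorphism {mpoly E[3]} -> V}).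
Variable l0 : {mpoly E[3]}.
Hypotheses (l0h : l0 \is 1.-homog) (chart_l0 : chart l0 = 1).

Definition liftable (v : V) := exists e0, forall e, (e0 <= e)%N ->
  exists2 f, f \is e.-homog & chart f = v.

Lemma liftable_homog k f : f \is k.-homog -> liftable (chart f).
Proof.
move=> hf; exists k => e ke; exists (f * l0 ^+ (e - k)).
  by apply: dhomog_cast (dhomogM hf (dhomogMn _ l0h)) _; rewrite mul1n subnKC.
by rewrite rmorphM rmorphXn /= chart_l0 expr1n mulr1.
Qed.

Lemma liftableD u v : liftable u -> liftable v -> liftable (u + v).
Proof.
move=> [e1 h1] [e2 h2]; exists (maxn e1 e2) => e; rewrite geq_max => /andP[le1 le2].
have [f1 hf1 <-] := h1 e le1; have [f2 hf2 <-] := h2 e le2.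
by exists (f1 + f2); rewrite ?rmorphD //; apply: dhomogD.
Qed.

Lemma liftableM u v : liftable u -> liftable v -> liftable (u * v).
Proof.
move=> [e1 h1] [e2 h2]; exists (e1 + e2)%N => e le12.
have [f1 hf1 <-] := h1 e1 (leqnn _).
have [|f2 hf2 <-] := h2 (e - e1)%N; first by rewrite leq_subRL // (leq_trans _ le12) ?leq_addr.
exists (f1 * f2); rewrite ?rmorphM //; apply: dhomog_cast (dhomogM hf1 hf2) _.
by rewrite subnKC // (leq_trans _ le12) ?leq_addr.
Qed.

End ChartLift.

Section AffineCharts.
Variable E : closedFieldType.

(** [dehom] is the chart whose [l0] is the coordinate selected by [chart_idx], nonzero at [Q], so
    the chart-free multiplicity is Fulton's. *)
Lemma dehom_multP d (G H : {mpoly E[3]}) (Q : 'I_3 -> E) m :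
  G \is d.-homog -> H \is d.-homog -> nonzero3 Q -> hmult G H Q m -> imult_proj G H Q m.
Proof.
move=> hG hH nzQ; rewrite /imult_proj; set i := chart_idx Q.
have Qi : Q i != 0.
  rewrite /i /chart_idx; case: ifP => // q2; case: ifP => // q1.
  case: nzQ => j; suff : j \in [:: ord0; inord 1; ord_max].
    by rewrite !inE => /or3P[]/eqP-> //; rewrite ?q1 ?q2.
  by case: j => [[|[|[|//]]] hj]; rewrite !inE -!val_eqE /= ?inordK.
pose chart : {rmorphism {mpoly E[3]} -> {mpoly E[2]}} := mmap (@mpolyC 2 E) (chart_sub E i).
have dehomE f : dehom i f = chart f by [].
have l0h : ('X_i : {mpoly E[3]}) \is 1.-homog by rewrite dhomogX /= mdeg1.
have chX j : chart 'X_j = chart_sub E i j by rewrite /chart /= mmapXU.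
have chl0 : chart 'X_i = 1 by rewrite chX /chart_sub unlift_none.
have chartZ c f : chart (c *: f) = idfun c *: chart f.
  by rewrite /chart /= mmapZ mul_mpolyC.
have chart_ev t : ('X_i : {mpoly E[3]}).@[t] = 1 ->
    forall f, (chart f).@[fun k => t (lift i k)] = f.@[t].
  rewrite mevalXU => ti.
  apply: (mpoly_rmorph_ext (f := meval (fun k => t (lift i k)) \o chart) (g := meval t)) => [c|j] /=.
    by rewrite mmapC !mevalC.
  rewrite chX mevalXU /chart_sub; case: unliftP => [k ->|->]; first by rewrite mevalXU.
  by rewrite meval1 ti.
have lft v : liftable chart v.
  elim/mpoly_ring_ind: v => [c|k|p q|p q].
  - have -> : c%:MP = chart c%:MP by rewrite /chart /= mmapC.
    apply: (liftable_homog l0h chl0 (k := 0)).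
    by rewrite -alg_mpolyC dhomogZ // dhomog1.
  - have -> : 'X_k = chart 'X_(lift i k) by rewrite chX /chart_sub liftK.
    by apply: (liftable_homog l0h chl0 (k := 1)); rewrite dhomogX /= mdeg1.
  - exact: liftableD.
  - exact: liftableM.
have l0Q : ('X_i : {mpoly E[3]}).@[Q] != 0 by rewrite mevalXU.
have evQ f : (chart f).@[chart_pt i Q] = f.@[fun j => (('X_i : {mpoly E[3]}).@[Q])^-1 * Q j].
  rewrite -[RHS]chart_ev; last first.
    by rewrite (dhomog_eval _ _ l0h) expr1 mulVf.
  by apply: meval_eq => k; rewrite mevalXU mulrC.
have memE f : chart_mem G H chart (meval (chart_pt i Q)) f <->
    local_ideal_mem (dehom i G) (dehom i H) f (chart_pt i Q).
  by split=> [[B [A [C [h1 h2]]]]|[B [A [C [h1 h2]]]]]; exists B, A, C.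
have indE k : (exists fs : 'I_k -> {mpoly E[2]},
    local_indep (dehom i G) (dehom i H) (chart_pt i Q) fs) <-> hindep G H Q k.
  rewrite -(@chart_indepP _ _ _ _ hG hH Q _ idfun _ chart chartZ _ l0h l0Q _ lft
     (meval (chart_pt i Q)) evQ k); last first.
    by move=> t /chart_ev h; exists (meval (fun k => t (lift i k))).
  by split=> -[fs hfs]; exists fs => c /memE; apply: hfs.
by case=> h1 h2; split; [apply/indE | move/indE].
Qed.

End AffineCharts.

Section LineCharts.
Variable R : comNzRingType.
Implicit Types z : option R.

(* A point of the projective line is coded by [Some a] for (a : 1) and by [None] for (1 : 0);
   (rep0 z, rep1 z) and (dir0 z, dir1 z) form a basis of determinant 1. The chart [line_chart z]
   restricts a form to (t1, t2) = rep z + X dir z, and [plane_chart z] keeps t3 as a second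
   coordinate; the line X = 0 is then the line joining (0 : 0 : 1) to (rep z : 0). *)
Definition rep0 z : R := if z is Some a then a else 1.
Definition rep1 z : R := if z is Some a then 1 else 0.
Definition dir0 z : R := if z is Some a then -1 else 0.
Definition dir1 z : R := if z is Some a then 0 else 1.

Definition pt z (b : R) : 'I_3 -> R :=
  fun i => match nat_of_ord i with 0%N => rep0 z | 1%N => rep1 z | _ => b end.

Definition line_gen z (i : 'I_2) : {poly R} :=
  if nat_of_ord i == 0%N then (rep0 z)%:P + dir0 z *: 'X else (rep1 z)%:P + dir1 z *: 'X.
Definition line_chart z : {mpoly R[2]} -> {poly R} := mmap polyC (line_gen z).
HB.instance Definition _ z := GRing.RMorphism.copy (line_chart z) (line_chart z).

Definition toT_gen (i : 'I_3) : {poly {mpoly R[2]}} :=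
  match nat_of_ord i with 0%N => ('X_(inord 0))%:P | 1%N => ('X_(inord 1))%:P | _ => 'X end.
Definition toT : {mpoly R[3]} -> {poly {mpoly R[2]}} := mmap (polyC \o @mpolyC 2 R) toT_gen.
HB.instance Definition _ := GRing.RMorphism.copy toT toT.

Definition plane_chart z : {mpoly R[3]} -> {poly {poly R}} := map_poly (line_chart z) \o toT.
HB.instance Definition _ z := GRing.RMorphism.copy (plane_chart z) (map_poly (line_chart z) \o toT).

Definition res3 (G H : {mpoly R[3]}) : {mpoly R[2]} := resultant (toT G) (toT H).

(** With [lin1], the coordinates dual to the basis (rep, dir): in [plane_chart z] they become 1 and
    the inner variable. *)
Definition lin0 z : {mpoly R[3]} := dir1 z *: 'X_(inord 0) - dir0 z *: 'X_(inord 1).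
Definition lin1 z : {mpoly R[3]} := rep0 z *: 'X_(inord 1) - rep1 z *: 'X_(inord 0).

Lemma rep_det z : rep0 z * dir1 z - rep1 z * dir0 z = 1.
Proof. by case: z => [a|] /=; rewrite ?mulr0 ?mul1r ?mulr1 ?mul0r ?subr0 // sub0r opprK. Qed.

Lemma plane_chartC z c : plane_chart z c%:MP = c%:P%:P.
Proof.
by rewrite /plane_chart /= /toT mmapC /= map_polyC /= /line_chart mmapC.
Qed.

Lemma plane_chartX z i : plane_chart z 'X_i =
  match nat_of_ord i with
  | 0%N => ((rep0 z)%:P + dir0 z *: 'X)%:P
  | 1%N => ((rep1 z)%:P + dir1 z *: 'X)%:P
  | _ => 'X end.
Proof.
rewrite /plane_chart /= /toT mmapXU /toT_gen; case: i => [[|[|[|//]]] hi] /=;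
  by rewrite ?map_polyX ?map_polyC //= /line_chart mmapXU /line_gen /= ?inordK.
Qed.

Lemma plane_chartZ z c f : plane_chart z (c *: f) = c%:P *: plane_chart z f.
Proof. by rewrite -mul_mpolyC rmorphM /= plane_chartC mul_polyC. Qed.

Lemma lin_homog z : lin0 z \is 1.-homog /\ lin1 z \is 1.-homog.
Proof. by split; apply: rpredB; apply: dhomogZ; rewrite dhomogX /= mdeg1. Qed.

Lemma chart_lin0 z : plane_chart z (lin0 z) = 1.
Proof.
rewrite /lin0 rmorphB /= !plane_chartZ !plane_chartX !inordK //= -!mul_polyC -!rmorphM -rmorphB /=.
rewrite -polyC1; congr (_%:P); rewrite -polyC1 -(rep_det z) rmorphB !rmorphM /=; ring.
Qed.

Lemma chart_lin1 z : plane_chart z (lin1 z) = 'X%:P.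
Proof.
rewrite /lin1 rmorphB /= !plane_chartZ !plane_chartX !inordK //= -!mul_polyC -!rmorphM -rmorphB /=.
congr (_%:P); rewrite -['X in RHS]mul1r -polyC1 -(rep_det z) rmorphB !rmorphM /=; ring.
Qed.

Lemma plane_chart_eval z t : (lin0 z).@[t] = 1 -> forall f,
  ((map_poly (horner_eval (lin1 z).@[t]) (plane_chart z f)).[t ord_max]) = f.@[t].
Proof.
move=> t1; apply: (mpoly_rmorph_ext (f := horner_eval (t ord_max) \o
   (map_poly (horner_eval (lin1 z).@[t]) \o plane_chart z)) (g := meval t)) => [c|i] /=.
  by rewrite plane_chartC map_polyC /= /horner_eval !hornerC mevalC.
have t0E : t (inord 0) = rep0 z + dir0 z * (lin1 z).@[t].
  transitivity (rep0 z * (lin0 z).@[t] + dir0 z * (lin1 z).@[t]); last by rewrite t1 mulr1.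
  by rewrite -[LHS]mul1r -(rep_det z) /lin0 /lin1 !mevalB !mevalZ !mevalXU; ring.
have t1E : t (inord 1) = rep1 z + dir1 z * (lin1 z).@[t].
  transitivity (rep1 z * (lin0 z).@[t] + dir1 z * (lin1 z).@[t]); last by rewrite t1 mulr1.
  by rewrite -[LHS]mul1r -(rep_det z) /lin0 /lin1 !mevalB !mevalZ !mevalXU; ring.
rewrite plane_chartX mevalXU; case: i => [[|[|[|//]]] hi] /=.
- rewrite map_polyC /= /horner_eval hornerC hornerD hornerZ hornerX hornerC -t0E.
  by congr t; apply: val_inj; rewrite /= inordK.
- rewrite map_polyC /= /horner_eval hornerC hornerD hornerZ hornerX hornerC -t1E.
  by congr t; apply: val_inj; rewrite /= inordK.
- by rewrite map_polyX /horner_eval hornerX; congr t; apply: val_inj.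
Qed.

Lemma lin0_pt z b : (lin0 z).@[pt z b] = 1.
Proof.
by rewrite /lin0 mevalB !mevalZ !mevalXU /pt /= !inordK //= -(rep_det z); ring.
Qed.

Lemma lin1_pt z b : (lin1 z).@[pt z b] = 0.
Proof. by rewrite /lin1 mevalB !mevalZ !mevalXU /pt /= !inordK //=; ring. Qed.

End LineCharts.

(** * The resultant as a binary form *)

Section ResultantForm.
Variable R : comNzRingType.

Definition graded d (f : {poly {mpoly R[2]}}) :=
  forall j, if (j <= d)%N then is_true (f`_j \is (d - j).-homog) else f`_j = 0.

Lemma gradedD d f g : graded d f -> graded d g -> graded d (f + g).
Proof.
move=> hf hg j; rewrite coefD; move: (hf j) (hg j).
by case: ifP => _ => [|-> ->]; [apply: dhomogD | rewrite addr0].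
Qed.

Lemma toTC c : toT (c%:MP : {mpoly R[3]}) = c%:MP%:P.
Proof. by rewrite /toT mmapC. Qed.

Lemma toTXU i : toT ('X_i : {mpoly R[3]}) =
  match nat_of_ord i with 0%N => ('X_(inord 0))%:P | 1%N => ('X_(inord 1))%:P | _ => 'X end.
Proof. by rewrite /toT mmapXU. Qed.

Lemma toT_monomial (m : 'X_{1..3}) : exists2 A : {mpoly R[2]},
  toT 'X_[m] = A%:P * 'X^(m ord_max) & A \is (mdeg m - m ord_max).-homog.
Proof.
pose o1 : 'I_3 := lift ord0 ord0.
exists ('X_(inord 0) ^+ m ord0 * 'X_(inord 1) ^+ m o1).
  rewrite /toT mmapX /mmap1 !big_ord_recl big_ord0 mulr1 /toT_gen /=.
  rewrite mulrA rmorphM !rmorphXn /=; congr (_ * _ ^+ m _); exact: val_inj.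
have -> : (mdeg m - m ord_max = 1 * m ord0 + 1 * m o1)%N.
  rewrite mdegE !big_ord_recl big_ord0 !mul1n addn0 addnA.
  by rewrite (_ : lift ord0 (lift ord0 ord0) = ord_max) ?addnK //; apply: val_inj.
by apply: dhomogM; apply: dhomogMn; rewrite dhomogX /= mdeg1.
Qed.

Lemma toT_graded d (G : {mpoly R[3]}) : G \is d.-homog -> graded d (toT G).
Proof.
move=> /dhomogP hG; rewrite [G]mpolyE rmorph_sum /= big_seq.
apply: (big_ind (graded d)) => [j||m mG]; first by rewrite coef0; case: ifP; rewrite ?rpred0.
  exact: gradedD.
rewrite -mul_mpolyC rmorphM /= toTC => j.
have [A -> hA] := toT_monomial m.
rewrite mulrA -rmorphM /= coefMXn coefC subn_eq0; move: hA; rewrite (hG _ mG) => hA.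
have md : (m ord_max <= d)%N by rewrite -(hG _ mG) /= mdegE (bigD1 ord_max) //= leq_addr.
case: ltngtP => [jm|mj|->].
- by rewrite (leq_trans (ltnW jm)) // rpred0.
- by case: ifP; rewrite ?rpred0.
- by rewrite md mul_mpolyC dhomogZ.
Qed.

Lemma dhomog0_const n (p : {mpoly R[n]}) : p \is 0.-homog -> p = (p@_0)%:MP.
Proof.
move=> hp; apply/mpolyP => m; rewrite mcoeffC; case: (eqVneq m 0%MM) => [->|nz].
  by rewrite mulr1.
by rewrite mulr0 (dhomog_nemf_coeff hp) //= mdeg_eq0.
Qed.

Lemma toT_eval (f : {mpoly R[3]}) t0 t1 t2 :
  (map_poly (meval (fun i : 'I_2 => if nat_of_ord i == 0%N then t0 else t1)) (toT f)).[t2] =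
  f.@[fun i : 'I_3 => match nat_of_ord i with 0%N => t0 | 1%N => t1 | _ => t2 end].
Proof.
set u := fun i : 'I_2 => _; set v := fun i : 'I_3 => _.
apply: (mpoly_rmorph_ext (f := horner_eval t2 \o (map_poly (meval u) \o @toT R))
  (g := meval v)) => [c|i] /=.
  by rewrite toTC map_polyC /= /horner_eval hornerC !mevalC.
rewrite toTXU mevalXU /u /v; case: i => [[|[|[|//]]] hi] /=.
- by rewrite map_polyC /= /horner_eval hornerC mevalXU inordK.
- by rewrite map_polyC /= /horner_eval hornerC mevalXU inordK.
- by rewrite map_polyX /horner_eval hornerX.
Qed.

Definition pole : 'I_3 -> R := fun i => match nat_of_ord i with 0%N => 0 | 1%N => 0 | _ => 1 end.

Lemma toT_coef_deg d (G : {mpoly R[3]}) : G \is d.-homog -> (toT G)`_d = (G.@[pole])%:MP.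
Proof.
move=> hG; have gT := toT_graded hG.
have hd := gT d; rewrite leqnn subnn in hd; rewrite (dhomog0_const hd); congr _%:MP.
rewrite /pole -(toT_eval G 0 0 1) (@horner_coef_wide _ d.+1); last first.
  apply: leq_trans (size_poly _ _) _; apply/leq_sizeP => j; rewrite ltnNge => dj.
  by have := gT j; rewrite (negbTE dj).
rewrite big_ord_recr /= big1 ?add0r => [|j _].
  by rewrite expr1n mulr1 coef_map /= (dhomog0_const hd) mevalC mcoeffC eqxx mulr1.
rewrite coef_map /=; have := gT j; rewrite ltnW // => hj.
have -> : ((toT G)`_j).@[fun i : 'I_2 => if nat_of_ord i == 0%N then 0 else 0] =
  ((toT G)`_j).@[fun i : 'I_2 => 0 * 0] by apply: meval_eq => i; rewrite mul0r; case: ifP.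
by rewrite (dhomog_eval _ _ hj) expr0n subn_eq0 leqNgt ltn_ord !mul0r.
Qed.

Lemma size_toT d (G : {mpoly R[3]}) : G \is d.-homog -> G.@[pole] != 0 -> size (toT G) = d.+1.
Proof.
move=> hG G1; apply/eqP; rewrite eqn_leq; apply/andP; split.
  apply/leq_sizeP => j; rewrite ltnNge => dj.
  by have := toT_graded hG j; rewrite (negbTE dj).
rewrite ltnNge; apply/negP => /leq_sizeP/(_ d (leqnn _))/eqP.
by rewrite (toT_coef_deg hG) mpolyC_eq0 (negbTE G1).
Qed.

Lemma lead_toT d (G : {mpoly R[3]}) :
  G \is d.-homog -> G.@[pole] != 0 -> lead_coef (toT G) = (G.@[pole])%:MP.
Proof. by move=> hG G1; rewrite lead_coefE (size_toT hG G1) (toT_coef_deg hG). Qed.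

Lemma dhomog_bigprod n (I : finType) (e : I -> nat) (f : I -> {mpoly R[n]}) :
  (forall i, f i \is (e i).-homog) -> \prod_i f i \is (\sum_i e i)%N.-homog.
Proof.
move=> hf; elim/big_rec2: _ => [|i k p _ hp]; first by rewrite dhomog1.
exact: dhomogM.
Qed.

(** The sum of the [s i] is that of all indices. It cancels the weights of the second block and
    leaves d for each of the d rows of the first. *)
Lemma sylvester_degree d a b (s : 'S_(a + b)) (w : 'I_(a + b) -> nat) : a = d -> b = d ->
  (forall i, w i = match split i with inl k => d + k | inr k => d + k end)%N ->
  (forall i, s i <= w i)%N -> (\sum_i (w i - s i))%N = (d ^ 2)%N.
Proof.
move=> ad bd; subst a b => wE le.
apply/eqP; rewrite -(eqn_add2r (\sum_i s i)) -big_split /=.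
rewrite (eq_bigr w) => [|i _]; last by rewrite subnK.
rewrite -(reindex_inj (h := s) (F := fun i => nat_of_ord i) (P := xpredT) perm_inj).
rewrite !big_split_ord /= (eq_bigr (fun k : 'I_d => d + k)%N) => [|k _]; last first.
  by rewrite wE (_ : split (lshift d k) = inl k) //; apply: (unsplitK (inl k)).
rewrite [X in (_ + X)%N == _](eq_bigr (fun k : 'I_d => d + k)%N) => [|k _]; last first.
  by rewrite wE (_ : split (rshift d k) = inr k) //; apply: (unsplitK (inr k)).
by rewrite addnA eqn_add2r big_split /= sum_nat_const card_ord mulnn.
Qed.

Lemma graded_shift d (f : {poly {mpoly R[2]}}) (j k : nat) : graded d f ->
  if (j <= d + k)%N then is_true (f`_(j - k) *+ (k <= j) \is (d + k - j).-homog)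
  else f`_(j - k) *+ (k <= j) = 0.
Proof.
move=> /(_ (j - k)%N); case: (leqP k j) => kj; last first.
  by move=> _; rewrite mulr0n; case: ifP => // _; apply: rpred0.
by rewrite mulr1n leq_subLR subnBA // [(k + d)%N]addnC.
Qed.

(* The (i, j) entry of the Sylvester matrix has degree w i - j in t1, t2 with sum over i of
   w i - i equal to d ^ 2. *)
Lemma res3_homog d (G H : {mpoly R[3]}) : G \is d.-homog -> H \is d.-homog ->
  G.@[pole] != 0 -> H.@[pole] != 0 -> res3 G H \is (d ^ 2)%N.-homog.
Proof.
move=> hG hH G1 H1.
have sG := size_toT hG G1; have sH := size_toT hH H1.
pose p := toT G; pose q := toT H.
have sp : (size p).-1 = d by rewrite /p sG.
have sq : (size q).-1 = d by rewrite /q sH.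
rewrite /res3 -/p -/q; move: p q sp sq (toT_graded hG : graded d p) (toT_graded hH : graded d q).
move=> p q sp sq gp gq {sG sH}.
pose w (i : 'I_((size q).-1 + (size p).-1)) : nat :=
  match split i with inl k => (d + k)%N | inr k => (d + k)%N end.
have entry (i j : 'I_((size q).-1 + (size p).-1)) :
  if (j <= w i)%N then is_true (Sylvester_mx p q i j \is (w i - j).-homog)
  else Sylvester_mx p q i j = 0.
  by rewrite Sylvester_mxE /w; case: (split i) => k; apply: graded_shift.
have hp (s : 'S_((size q).-1 + (size p).-1)) :
    \prod_i Sylvester_mx p q i (s i) \is (d ^ 2)%N.-homog.
  case: (boolP [forall i, (s i <= w i)%N]) => [/forallP le|/forallPn[i hi]]; last first.
    by rewrite (bigD1 i) //=; have := entry i (s i); rewrite (negbTE hi) => ->; rewrite mul0r rpred0.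
  have hq : \prod_i Sylvester_mx p q i (s i) \is (\sum_i (w i - s i))%N.-homog.
    by apply: dhomog_bigprod => i; have := entry i (s i); rewrite le.
  exact: dhomog_cast hq (sylvester_degree sq sp (fun i => erefl) le).
rewrite /resultant /determinant; apply: rpred_sum => s _.
by case: (odd_perm s); rewrite ?expr1 ?expr0 ?mulN1r ?mul1r ?dhomogN; apply: hp.
Qed.

End ResultantForm.

Section MapForms.
Variables (R S : comNzRingType) (phi : {rmorphism R -> S}).

Lemma toT_map (f : {mpoly R[3]}) : toT (map_mpoly phi f) = map_poly (map_mpoly phi) (toT f).
Proof.
apply: (mpoly_rmorph_ext (f := @toT S \o map_mpoly phi)
  (g := map_poly (map_mpoly phi) \o @toT R)) => [c|i] /=.
  by rewrite map_mpolyC !toTC map_polyC /= map_mpolyC.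
rewrite map_mpolyXU !toTXU; case: i => [[|[|[|//]]] hi] /=;
  by rewrite ?map_polyX ?map_polyC //= map_mpolyXU.
Qed.

Lemma line_chart_map (z : option R) (f : {mpoly R[2]}) :
  line_chart (omap phi z) (map_mpoly phi f) = map_poly phi (line_chart z f).
Proof.
apply: (mpoly_rmorph_ext (f := line_chart (omap phi z) \o map_mpoly phi)
  (g := map_poly phi \o line_chart z)) => [c|i] /=.
  by rewrite map_mpolyC /line_chart !mmapC /= map_polyC.
rewrite map_mpolyXU /line_chart !mmapXU /line_gen.
by case: z => [a|]; case: ifP => _ /=;
  rewrite rmorphD /= -!mul_polyC rmorphM /= !map_polyC map_polyX /= ?rmorphN ?rmorph0 ?rmorph1.
Qed.

Lemma map_mpoly_homog n e (f : {mpoly R[n]}) : f \is e.-homog -> map_mpoly phi f \is e.-homog.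
Proof.
move=> /dhomogP hf; apply/dhomogP => m; rewrite mcoeff_msupp mcoeff_map_mpoly => nz.
apply: hf; rewrite mcoeff_msupp; apply: contraNneq nz => f0.
by rewrite f0 raddf0.
Qed.

Lemma pole_map (f : {mpoly R[3]}) : (map_mpoly phi f).@[@pole S] = phi f.@[@pole R].
Proof.
rewrite -meval_map_mpoly; apply: meval_eq => i.
by rewrite /pole /=; case: (nat_of_ord i) => [|[|?]]; rewrite ?rmorph0 ?rmorph1.
Qed.

Lemma res3_map d (G H : {mpoly R[3]}) : G \is d.-homog -> H \is d.-homog ->
  phi G.@[@pole R] != 0 -> phi H.@[@pole R] != 0 ->
  map_mpoly phi (res3 G H) = res3 (map_mpoly phi G) (map_mpoly phi H).
Proof.
move=> hG hH G1 H1; have nz0 a : phi a != 0 -> a != 0.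
  by apply: contraNneq => ->; rewrite rmorph0.
rewrite /res3 !toT_map; apply: map_resultant_ring.
  by rewrite (lead_toT hG) ?nz0 //= map_mpolyC mpolyC_eq0.
by rewrite (lead_toT hH) ?nz0 //= map_mpolyC mpolyC_eq0.
Qed.

End MapForms.

Lemma pihomog_sum_id n (R : nzRingType) e (f : {mpoly R[n]}) :
  f = \sum_(k < maxn (msize f) e.+1) pihomog mdeg k f.
Proof. by apply: pihomog_partitionE; apply: leq_maxl. Qed.

(** The component of degree e + b of [f * g] is [f] times the component of degree b of [g];
    cancelling [f] shows that [g] is this component. *)
Lemma dhomog_factor n (R : idomainType) e b (f g : {mpoly R[n]}) :
  f != 0 -> f \is e.-homog -> f * g \is (e + b)%N.-homog -> g \is b.-homog.
Proof.
move=> nzf hf hfg; have := pihomog_dE hfg.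
rewrite {1}(pihomog_sum_id b g) mulr_sumr linear_sum /=.
have lb : (b < maxn (msize g) b.+1)%N by rewrite leq_max leqnn orbT.
rewrite (bigD1 (Ordinal lb)) //= big1 ?addr0 => [|k ne]; last first.
  apply: (@pihomog_ne0 _ _ _ (e + k)%N); last by apply: dhomogM => //; apply: pihomogP.
  by rewrite eqn_add2l; apply: contraNneq ne => eqk; apply/eqP/val_inj.
rewrite pihomog_dE; last by apply: dhomogM => //; apply: pihomogP.
by move=> /(mulfI nzf) <-; apply: pihomogP.
Qed.

Lemma quot_add (T : comNzRingType) (l F G q1 q2 : T) :
  F + l * q1 + (G + l * q2) = F + G + l * (q1 + q2).
Proof. by rewrite mulrDr addrACA. Qed.

Lemma quot_mul (T : comNzRingType) (l F G q1 q2 : T) :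
  (F + l * q1) * (G + l * q2) = F * G + l * (q1 * (G + l * q2) + F * q2).
Proof. ring. Qed.

(** * Binary forms as products of linear forms *)

Section BinaryForms.
Variable E : closedFieldType.
Implicit Types (z w : option E) (r : {mpoly E[2]}).

Definition ell z : {mpoly E[2]} := rep1 z *: 'X_(inord 0) - rep0 z *: 'X_(inord 1).
Definition rep z : 'I_2 -> E := fun i => if nat_of_ord i == 0%N then rep0 z else rep1 z.

Lemma ell_homog z : ell z \is 1.-homog.
Proof. by apply: rpredB; apply: dhomogZ; rewrite dhomogX /= mdeg1. Qed.

Lemma ell_rep z w : ((ell z).@[rep w] == 0) = (z == w).
Proof.
rewrite /ell mevalB !mevalZ !mevalXU /rep !inordK //=.
case: z w => [a|] [b|] /=; rewrite ?mul1r ?mulr1 ?mul0r ?mulr0 ?subr0 ?sub0r ?subrr ?oppr_eq0 ?oner_eq0 //.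
  by rewrite subr_eq0 eq_sym.
by rewrite !eqxx.
Qed.

Lemma ell_neq0 z : ell z != 0.
Proof.
have [w zw] : exists w, z != w by case: z => [a|]; [exists None | exists (Some 0)].
by rewrite -ell_rep in zw; apply: contraNneq zw => ->; rewrite meval0.
Qed.

Lemma line_chart_rep z r : (line_chart z r).[0] = r.@[rep z].
Proof.
apply: (mpoly_rmorph_ext (f := horner_eval 0 \o line_chart z) (g := meval (rep z))) => [c|i] /=.
  by rewrite /line_chart mmapC /= /horner_eval hornerC mevalC.
rewrite /line_chart mmapXU mevalXU /horner_eval /line_gen /rep.
by case: ifP => _; rewrite hornerD hornerZ hornerX hornerC mulr0 addr0.
Qed.

Lemma line_chart_ell z : line_chart z (ell z) = - 'X.
Proof.
rewrite /ell rmorphB /= -!mul_mpolyC !rmorphM /= /line_chart !mmapC !mmapXU /line_gen !inordK //=.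
rewrite -['X in RHS]mul1r -polyC1 -(rep_det z) rmorphB !rmorphM /= -!mul_polyC; ring.
Qed.

(* Modulo ell z, the plane retracts onto the line through [rep z]. *)
Lemma ell_retract z : exists (u : {mpoly E[2]}) (sb : {rmorphism {mpoly E[2]} -> {mpoly E[2]}}),
  [/\ forall c, sb c%:MP = c%:MP, forall i, sb 'X_i = u * (rep z i)%:MP &
      forall f, exists q, f = sb f + ell z * q].
Proof.
pose u : {mpoly E[2]} := dir1 z *: 'X_(inord 0) - dir0 z *: 'X_(inord 1); exists u.
have [sb sbC sbX] : exists2 sb : {rmorphism {mpoly E[2]} -> {mpoly E[2]}},
    forall c, sb c%:MP = c%:MP & forall i, sb 'X_i = u * (rep z i)%:MP.
  exists (mmap (@mpolyC 2 E) (fun i => u * (rep z i)%:MP)) => [c|i] /=.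
    by rewrite mmapC.
  by rewrite mmapXU.
exists sb; split=> // f.
elim/mpoly_ring_ind: f => [c|i|f g [q1 h1] [q2 h2]|f g [q1 h1] [q2 h2]].
- by exists 0; rewrite sbC mulr0 addr0.
- rewrite sbX /rep /u /ell -!mul_mpolyC.
  have d1 : (dir1 z)%:MP * (rep0 z)%:MP - (rep1 z)%:MP * (dir0 z)%:MP = 1 :> {mpoly E[2]}.
    by rewrite -!rmorphM -rmorphB /= [dir1 z * _]mulrC rep_det.
  case: i => [[|[|//]] hi] /=.
    exists (- (dir0 z)%:MP); rewrite (_ : Ordinal hi = inord 0); last by apply: val_inj; rewrite /= inordK.
    by rewrite -[LHS]mul1r -d1; ring.
  exists (- (dir1 z)%:MP); rewrite (_ : Ordinal hi = inord 1); last by apply: val_inj; rewrite /= inordK.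
  by rewrite -[LHS]mul1r -d1; ring.
- exists (q1 + q2); rewrite rmorphD /=.
  by move: (sb f) (sb g) h1 h2 => F G' -> ->; apply: quot_add.
- exists (q1 * g + sb f * q2); rewrite rmorphM /=.
  by move: (sb f) (sb g) h1 h2 => F G' -> ->; apply: quot_mul.
Qed.

(** The retraction [sb] kills [ell z] and takes values in a domain, and anything it kills is a
    multiple of [ell z]. *)
Lemma ell_prime z f g r : f * g = ell z * r ->
  (exists q, f = ell z * q) \/ (exists q, g = ell z * q).
Proof.
have [u [sb [sbC sbX sbE]]] := ell_retract z => fg.
have sbl : sb (ell z) = 0.
  rewrite /ell rmorphB /= -!mul_mpolyC !rmorphM /= !sbC !sbX /rep !inordK //=.
  by rewrite mulrCA [X in _ - X]mulrCA [X in u * X]mulrC subrr.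
have /eqP : sb f * sb g = 0 by rewrite -rmorphM fg rmorphM /= sbl mul0r.
rewrite mulf_eq0 => /orP[] /eqP s0; [left; have [q fE] := sbE f | right; have [q fE] := sbE g].
  by exists q; rewrite {1}fE s0 add0r.
by exists q; rewrite {1}fE s0 add0r.
Qed.

(** By homogeneity the retraction sends [r] to a power of [u] times the value of [r] at [rep z]. *)
Lemma ell_dvd n z r : r \is n.+1.-homog -> r.@[rep z] = 0 ->
  exists2 q, r = ell z * q & q \is n.-homog.
Proof.
move=> hr r0; have [u [sb [sbC sbX sbE]]] := ell_retract z.
have [q rq] := sbE r.
have sbr : sb r = 0.
  have -> : sb r = (map_mpoly (@mpolyC 2 E) r).@[fun i => u * (rep z i)%:MP].
    apply: (mpoly_rmorph_ext (f := sb) (g := meval (fun i => u * (rep z i)%:MP) \o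
       map_mpoly (@mpolyC 2 E))) => [c|i] /=; first by rewrite sbC map_mpolyC mevalC.
    by rewrite sbX map_mpolyXU mevalXU.
  rewrite (dhomog_eval _ _ (map_mpoly_homog _ hr)).
  have := meval_map_mpoly (@mpolyC 2 E : {rmorphism _ -> _}) r (rep z).
  by rewrite r0 raddf0 => /= e; rewrite [X in _ * X]e mulr0.
exists q; first by rewrite rq sbr add0r.
by apply: (dhomog_factor (ell_neq0 z) (ell_homog z)); rewrite add1n; rewrite rq sbr add0r in hr.
Qed.

(** If r(X, 1) has no root it is a nonzero constant c; then [r] is c times a positive power of the
    second variable and vanishes at (1 : 0), the point coded by [None]. *)
Lemma binary_zero n r : r \is n.+1.-homog -> exists z, r.@[rep z] = 0.
Proof.
move=> hr.
pose p : {poly E} := mmap (@polyC E) (fun i => if nat_of_ord i == 0%N then 'X else 1) r.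
pose p1 : {poly E} := mmap (@polyC E) (fun i => if nat_of_ord i == 0%N then 1 else 'X) r.
have pE a : p.[a] = r.@[rep (Some a)].
  apply: (mpoly_rmorph_ext (f := horner_eval a \o mmap (@polyC E) _) (g := meval _)) => [c|i] /=.
    by rewrite mmapC mevalC /horner_eval hornerC.
  by rewrite mmapXU mevalXU /rep /horner_eval; case: ifP; rewrite ?hornerX ?hornerC.
have p1E a : p1.[a] = r.@[fun i => if nat_of_ord i == 0%N then 1 else a].
  apply: (mpoly_rmorph_ext (f := horner_eval a \o mmap (@polyC E) _) (g := meval _)) => [c|i] /=.
    by rewrite mmapC mevalC /horner_eval hornerC.
  by rewrite mmapXU mevalXU /horner_eval; case: ifP; rewrite ?hornerX ?hornerC.
have [/size_poly1P[c nzc pc]|/closed_rootP[a /rootP pa]] := boolP (size p == 1%N); last first.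
  by exists (Some a); rewrite -pE.
exists None; rewrite /rep /=.
have -> : r.@[fun i : 'I_2 => if nat_of_ord i == 0%N then 1 else 0] = p1.[0] by rewrite p1E.
suff -> : p1 = c *: 'X^(n.+1) by rewrite hornerZ hornerXn expr0n mulr0.
apply/eqP; rewrite -subr_eq0; apply/negPn/negP => nz.
(* The factor ['X] makes the test point u nonzero, so r(1, u) can be computed as u^(n+1) r(1/u,
   1). *)
have /closed_nonrootP[u] : 'X * (p1 - c *: 'X^(n.+1)) != 0 by rewrite mulf_neq0 ?polyX_eq0.
rewrite /root hornerM hornerX mulf_eq0 negb_or => /andP[u0]; rewrite hornerD hornerN hornerZ hornerXn.
rewrite p1E -(hornerC c u^-1) -pc pE; case/negP; rewrite subr_eq0; apply/eqP.
rewrite mulrC -(dhomog_eval _ _ hr); apply: meval_eq => i.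
by rewrite /rep /=; case: ifP => _; rewrite ?divff ?mulVf ?mulfV ?mulr1.
Qed.

Lemma binary_factor n r : r \is n.-homog -> r != 0 ->
  exists c zs, [/\ c != 0, size zs = n & r = c *: \prod_(z <- zs) ell z].
Proof.
elim: n r => [|n IH] r hr nzr.
  exists r@_0, [::]; rewrite big_nil; have rE := dhomog0_const hr.
  split=> //; first by apply: contraNneq nzr => c0; rewrite rE c0 mpolyC0.
  by rewrite -mul_mpolyC mulr1.
have [z rz] := binary_zero hr; have [q rE hq] := ell_dvd hr rz.
have nzq : q != 0 by apply: contraNneq nzr => q0; rewrite rE q0 mulr0.
have [c [zs [nzc szs qE]]] := IH q hq nzq.
exists c, (z :: zs); rewrite /= szs big_cons; split=> //.
by rewrite rE qE -scalerAr.
Qed.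

Lemma prod_ell_homog zs : \prod_(z <- zs) ell z \is (size zs).-homog.
Proof.
elim: zs => [|z zs IH]; first by rewrite big_nil dhomog1.
by rewrite big_cons; apply: dhomog_cast (dhomogM (ell_homog z) IH) _.
Qed.

Lemma prod_ell_neq0 zs : \prod_(z <- zs) ell z != 0.
Proof.
elim: zs => [|z zs IH]; first by rewrite big_nil oner_neq0.
by rewrite big_cons mulf_neq0 // ell_neq0.
Qed.

Lemma prod_ell_eval zs w : ((\prod_(z <- zs) ell z).@[rep w] == 0) = (w \in zs).
Proof.
elim: zs => [|z zs IH]; first by rewrite big_nil meval1 oner_eq0.
by rewrite big_cons mevalM mulf_eq0 IH ell_rep inE eq_sym.
Qed.

Lemma prod_ell_line zs w c : c != 0 -> exists2 q : {poly E},
  line_chart w (c *: \prod_(z <- zs) ell z) = 'X^(count_mem w zs) * q & q.[0] != 0.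
Proof.
move=> nzc; have lM f g : line_chart w (f * g) = line_chart w f * line_chart w g by apply: rmorphM.
have sM f g : c *: (f * g) = f * (c *: g) :> {mpoly E[2]} by rewrite scalerAr.
elim: zs => [|z zs [q IH q0]].
  exists c%:P; last by rewrite hornerC.
  by rewrite big_nil -mul_mpolyC mulr1 /line_chart mmapC mul1r.
have [zw|ne] := eqVneq z w.
  exists (- q); last by rewrite hornerN oppr_eq0.
  rewrite big_cons sM lM IH -{1}zw line_chart_ell /= zw eqxx exprS.
  by rewrite mulrN mulNr mulrA.
exists (line_chart w (ell z) * q).
  by rewrite big_cons sM lM IH /= (negbTE ne) mulrCA.
by rewrite hornerM mulf_neq0 // line_chart_rep ell_rep.
Qed.

End BinaryForms.

Section CurveMultiplicity.
Variable E : closedFieldType.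
Variables (d : nat) (G H : {mpoly E[3]}).
Hypotheses (d0 : (0 < d)%N) (hG : G \is d.-homog) (hH : H \is d.-homog)
  (G1 : G.@[@pole E] != 0) (H1 : H.@[@pole E] != 0).
Variable z : option E.

Lemma plane_chart_lead f : f \is d.-homog -> f.@[@pole E] != 0 ->
  lead_coef (plane_chart z f) = (f.@[@pole E])%:P /\ size (plane_chart z f) = d.+1.
Proof.
move=> hf f1; rewrite /plane_chart /=.
have lE : line_chart z (lead_coef (toT f)) = (f.@[@pole E])%:P.
  by rewrite (lead_toT hf f1) /line_chart mmapC.
have nz : line_chart z (lead_coef (toT f)) != 0 by rewrite lE polyC_eq0.
by rewrite lead_coef_map_id0 ?size_map_poly_id0 ?rmorph0 // (size_toT hf).
Qed.

Lemma res3_line : line_chart z (res3 G H) = resultant (plane_chart z G) (plane_chart z H).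
Proof.
have nz f : f \is d.-homog -> f.@[@pole E] != 0 -> line_chart z (lead_coef (toT f)) != 0.
  by move=> hf f1; rewrite (lead_toT hf f1) /line_chart mmapC polyC_eq0.
exact: (map_resultant_ring (f := @line_chart E z) (nz G hG G1) (nz H hH H1)).
Qed.

Definition plane_chart_rmorph : {rmorphism {mpoly E[3]} -> {poly {poly E}}} := plane_chart z.
Local Notation pch := plane_chart_rmorph.

Lemma ev0_chart b f : ev0 b (plane_chart z f) = f.@[pt z b].
Proof.
have := plane_chart_eval (lin0_pt z b) f; rewrite lin1_pt => <-.
by rewrite /ev0 /red0.
Qed.

Lemma plane_chart_lift v : liftable pch v.
Proof.
have [h0 h1] := lin_homog z; have c0 := chart_lin0 z.
have lC c : liftable pch c%:P%:P.
  rewrite -(plane_chartC z) -[plane_chart z]/(pch : _ -> _); apply: (liftable_homog h0 c0 (k := 0)).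
  by rewrite -alg_mpolyC dhomogZ // dhomog1.
have lx : liftable pch 'X%:P.
  by rewrite -(chart_lin1 z); apply: (liftable_homog h0 c0 h1).
have lP (p : {poly E}) : liftable pch p%:P.
  elim/poly_ind: p => [|p c IH]; first by rewrite -polyC0; apply: lC.
  by rewrite rmorphD rmorphM /=; apply: liftableD => //; apply: liftableM.
have ly : liftable pch 'X.
  have -> : 'X = pch 'X_ord_max by rewrite /pch /= plane_chartX.
  by apply: (liftable_homog h0 c0 (k := 1)); rewrite dhomogX /= mdeg1.
elim/poly_ind: v => [|p c IH]; first by rewrite -polyC0; apply: lP.
by apply: liftableD => //; apply: liftableM.
Qed.

Lemma curve_line_mult (bs : seq E) o (q : {poly E}) : uniq bs ->
    (forall b, (b \in bs) = (G.@[pt z b] == 0) && (H.@[pt z b] == 0)) ->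
    line_chart z (res3 G H) = 'X^o * q -> q.[0] != 0 ->
  exists ms : E -> nat, (forall b, b \in bs -> hmult G H (pt z b) (ms b)) /\
    (\sum_(b <- bs) ms b)%N = o.
Proof.
move=> ubs hbs rE q0; rewrite res3_line in rE.
have [lG sG] := plane_chart_lead hG G1; have [lH sH] := plane_chart_lead hH H1.
have cG : const_lead (plane_chart z G) by exists G.@[@pole E].
have cH : const_lead (plane_chart z H) by exists H.@[@pole E].
have s1 : (1 < size (plane_chart z G))%N by rewrite sG ltnS.
have s2 : (1 < size (plane_chart z H))%N by rewrite sH ltnS.
have hbs' b : (b \in bs) = (ev0 b (plane_chart z G) == 0) && (ev0 b (plane_chart z H) == 0).
  exact: etrans (hbs b) (esym (congr2 (fun x y => (x == 0) && (y == 0)) (ev0_chart b G) (ev0_chart b H))).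
have [ms [hms sms]] := line_mult_sum cG s1 s2 ubs hbs' rE q0.
exists ms; split=> // b bbs; have := hms b bbs.
have memE f : chart_mem G H pch (ev0 b) f <->
    loc_pt (plane_chart z G) (plane_chart z H) b f.
  by split=> [[B [A [C [h1 h2]]]]|[B h1 [A [C h2]]]]; exists B => //; exists A, C.
move=> /(qdim_indep (loc_pt_subsp _ _ b)).
have l0Q : (lin0 z).@[pt z b] != 0 by rewrite lin0_pt oner_neq0.
have indP k := @chart_indepP _ _ _ _ hG hH (pt z b) _ (polyC : {rmorphism E -> {poly E}}) _
  pch (@plane_chartZ E z) _ (lin_homog z).1 l0Q _ plane_chart_lift (ev0 b) _ k.
have indE k : (exists f : 'I_k -> {poly {poly E}}, qindep polyC
     (loc_pt (plane_chart z G) (plane_chart z H) b) f) <-> hindep G H (pt z b) k.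
  rewrite -indP.
  - by split=> -[f hf]; exists f => c /memE; apply: hf.
  - move=> t t1; exists (horner_eval (t ord_max) \o map_poly (horner_eval (lin1 z).@[t])) => f.
    exact: plane_chart_eval.
  - by move=> f; apply: (etrans (ev0_chart b f)); apply: meval_eq => i; rewrite lin0_pt invr1 mul1r.
by case=> h1 h2; split; [apply/indE | move/indE].
Qed.

End CurveMultiplicity.

(** * Transversal intersections *)

Section Transversality.

Lemma euler_eval (R : comNzRingType) n e (f : {mpoly R[n]}) t :
  f \is e.-homog -> \sum_i t i * f^`M(i).@[t] = f.@[t] *+ e.
Proof.
move=> /dhomogP hf; have fE := mpolyE f.
have -> : \sum_i t i * f^`M(i).@[t] =
    \sum_(m <- msupp f) \sum_i t i * (f@_m *: 'X_[m])^`M(i).@[t].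
  rewrite exchange_big; apply: eq_bigr => i _.
  by rewrite -mulr_sumr -raddf_sum -linear_sum /= -fE.
rewrite [in RHS]fE raddf_sum -sumrMnl; apply: eq_big_seq => m mf /=.
rewrite mevalZ -(hf _ mf) /= mdegE -sumrMnr; apply: eq_bigr => i _.
rewrite mderivZ mderivX !mevalZ mulrCA -mulrnAr; congr (_ * _).
have [->|mi] := posnP (m i); first by rewrite mul0r mulr0 mulr0n.
rewrite mulrCA -[t i](mevalXU t) -mevalM -mpolyXD mulr_natl addmC submK //.
by apply/mnm_lepP => j; rewrite mnm1E; case: eqP => // <-.
Qed.

Lemma taylor_first (R : comNzRingType) n (Q : 'I_n -> R) (f : {mpoly R[n]}) :
  exists2 F : 'I_n -> {mpoly R[n]}, f = f.@[Q]%:MP + \sum_k F k * ('X_k - (Q k)%:MP) &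
    forall k, (F k).@[Q] = f^`M(k).@[Q].
Proof.
elim/mpoly_ring_ind: f => [c|i|f g [F fE FQ] [F' gE FQ']|f g [F fE FQ] [F' gE FQ']].
- exists (fun _ => 0) => [|k]; last by rewrite mderivC.
  by rewrite mevalC big1 ?addr0 // => k _; rewrite mul0r.
- exists (fun k => (i == k)%:R) => [|k].
    rewrite mevalXU (bigD1 i) //= eqxx mul1r big1 ?addr0 => [|k /negbTE ne].
      by rewrite addrC subrK.
    by rewrite eq_sym ne mul0r.
  rewrite mderivX mnm1E mevalZ; case: eqP => [->|_]; last by rewrite mul0r meval0.
  by rewrite -{1}[U_(k)%MM]add0m addmK mpolyX0 !meval1 mul1r.
- exists (fun k => F k + F' k) => [|k]; last by rewrite mderivD !mevalD FQ FQ'.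
  rewrite {1}fE {1}gE addrACA mevalD rmorphD /= -big_split; congr (_ + _).
  by apply: eq_bigr => k _; rewrite mulrDl.
- exists (fun k => F k * g + f.@[Q]%:MP * F' k) => [|k]; last first.
    by rewrite mderivM !mevalD !mevalM mevalC FQ FQ'.
  rewrite mevalM rmorphM /= (eq_bigr (fun k => F k * ('X_k - (Q k)%:MP) * g +
    f.@[Q]%:MP * (F' k * ('X_k - (Q k)%:MP)))) => [|k _]; last first.
    by rewrite mulrDl [F k * g * _]mulrAC mulrA.
  by rewrite big_split -mulr_suml -mulr_sumr /= addrCA -mulrDr -gE {1}fE mulrDl addrC.
Qed.

(** Cramer's rule: the determinant, a unit at a transversal point, times any combination of the
    local coordinates x, y lies in the ideal of the two curves. *)
Lemma local_cramer (T : comNzRingType) (g1 g2 h1 h2 x y u v : T) :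
  (g1 * h2 - g2 * h1) * (u * x + v * y) =
  (u * h2 - v * h1) * (g1 * x + g2 * y) + (v * g1 - u * g2) * (h1 * x + h2 * y).
Proof. ring. Qed.

Variable E : closedFieldType.
Variables (d : nat) (G H : {mpoly E[3]}) (z : option E) (b : E).
Hypotheses (hG : G \is d.-homog) (hH : H \is d.-homog).
Local Notation Q := (pt z b).
Hypotheses (GQ : G.@[Q] = 0) (HQ : H.@[Q] = 0).
Hypothesis grad_free : forall a c : E,
  (forall i, a * G^`M(i).@[Q] + c * H^`M(i).@[Q] = 0) -> a = 0 /\ c = 0.

Let o1 : 'I_3 := lift ord0 ord0.
Let o2 : 'I_3 := lift ord0 (lift ord0 ord0).

Lemma chart_first (V : comNzRingType) (ch : {rmorphism {mpoly E[3]} -> V}) (ic : {rmorphism E -> V})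
    (x y : V) (f : {mpoly E[3]}) (F : 'I_3 -> {mpoly E[3]}) :
  (forall c, ch c%:MP = ic c) -> ch 'X_ord0 = ic (rep0 z) + ic (dir0 z) * x ->
  ch 'X_o1 = ic (rep1 z) + ic (dir1 z) * x -> ch 'X_o2 = y ->
  f = \sum_k F k * ('X_k - (Q k)%:MP) ->
  ch f = ch ((dir0 z)%:MP * F ord0 + (dir1 z)%:MP * F o1) * x + ch (F o2) * (y - ic b).
Proof.
move=> hC h0 h1 h2 ->; rewrite !big_ord_recl big_ord0 addr0 -/o1 -/o2.
rewrite !(rmorphD, rmorphM, rmorphN) /= h0 h1 h2 !hC /pt /=; ring.
Qed.

(** The derivative of [f] at Q in the direction of the inner variable of [plane_chart z]. *)
Definition dslope (f : {mpoly E[3]}) : E :=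
  dir0 z * f^`M(ord0).@[Q] + dir1 z * f^`M(o1).@[Q].

Lemma plane_chart_first f : f.@[Q] = 0 -> exists u v : {poly {poly E}},
  [/\ plane_chart z f = u * 'X%:P + v * ('X - b%:P%:P), ev0 b u = dslope f &
      ev0 b v = f^`M(o2).@[Q]].
Proof.
move=> fQ; have [F fE FQ] := taylor_first Q f; rewrite fQ mpolyC0 add0r in fE.
exists (plane_chart z ((dir0 z)%:MP * F ord0 + (dir1 z)%:MP * F o1)), (plane_chart z (F o2)).
have e k : ev0 b (plane_chart z (F k)) = f^`M(k).@[Q] by rewrite -FQ; apply: ev0_chart.
split; last exact: e; last first.
  by apply: (etrans (ev0_chart _ _ _)); rewrite mevalD !mevalM !mevalC !FQ.
apply: (chart_first (ch := plane_chart_rmorph z) (ic := polyC \o polyC) (plane_chartC z) _ _ _ fE).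
- by apply: (etrans (plane_chartX z _)); rewrite /= rmorphD -mul_polyC rmorphM.
- by apply: (etrans (plane_chartX z _)); rewrite /= rmorphD -mul_polyC rmorphM.
- exact: plane_chartX.
Qed.

Lemma slope_det : dslope G * H^`M(o2).@[Q] - G^`M(o2).@[Q] * dslope H != 0.
Proof.
have eul f : f \is d.-homog -> f.@[Q] = 0 ->
    rep0 z * f^`M(ord0).@[Q] + (rep1 z * f^`M(o1).@[Q] + b * f^`M(o2).@[Q]) = 0.
  move=> hf fQ; have := euler_eval Q hf; rewrite fQ mul0rn !big_ord_recl big_ord0 addr0.
  by rewrite -/o1 -/o2.
(* Euler's identity makes both gradients orthogonal to Q, so a combination of them whose two
   derivatives in the chart vanish is zero altogether. *)
have key a c : a * dslope G + c * dslope H = 0 ->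
    a * G^`M(o2).@[Q] + c * H^`M(o2).@[Q] = 0 -> a = 0 /\ c = 0.
  move=> e1 e2; apply: grad_free.
  have eG := eul G hG GQ; have eH := eul H hH HQ.
  move: e1 e2 eG eH; rewrite /dslope.
  set g0 := G^`M(ord0).@[Q]; set g1 := G^`M(o1).@[Q]; set g2 := G^`M(o2).@[Q].
  set h0 := H^`M(ord0).@[Q]; set h1 := H^`M(o1).@[Q]; set h2 := H^`M(o2).@[Q].
  move=> e1 e2 eG eH.
  have e3 : rep0 z * (a * g0 + c * h0) + rep1 z * (a * g1 + c * h1) = 0.
    transitivity (a * (rep0 z * g0 + (rep1 z * g1 + b * g2)) +
       c * (rep0 z * h0 + (rep1 z * h1 + b * h2)) - b * (a * g2 + c * h2)); first by ring.
    by rewrite eG eH e2 !mulr0 addr0 subr0.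
  have e4 : dir0 z * (a * g0 + c * h0) + dir1 z * (a * g1 + c * h1) = 0.
    by rewrite -e1; ring.
  have w0 : a * g0 + c * h0 = 0.
    rewrite -[LHS]mul1r -(rep_det z).
    transitivity (dir1 z * (rep0 z * (a * g0 + c * h0) + rep1 z * (a * g1 + c * h1)) -
      rep1 z * (dir0 z * (a * g0 + c * h0) + dir1 z * (a * g1 + c * h1))); first by ring.
    by rewrite e3 e4 !mulr0 subr0.
  have w1 : a * g1 + c * h1 = 0.
    rewrite -[LHS]mul1r -(rep_det z).
    transitivity (rep0 z * (dir0 z * (a * g0 + c * h0) + dir1 z * (a * g1 + c * h1)) -
      dir0 z * (rep0 z * (a * g0 + c * h0) + rep1 z * (a * g1 + c * h1))); first by ring.
    by rewrite e3 e4 !mulr0 subr0.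
  move=> i; suff : i \in [:: ord0; o1; o2] by rewrite !inE => /or3P[]/eqP->.
  by case: i => [[|[|[|//]]] hi]; rewrite !inE -!val_eqE.
apply/eqP => det0.
(* If the determinant vanishes, its columns are successively used as coefficients in [key], until
   all chart derivatives are zero and the coefficients (1, 0) give a contradiction. *)
have [h20 /eqP] : H^`M(o2).@[Q] = 0 /\ - G^`M(o2).@[Q] = 0.
  by apply: key; [rewrite -[RHS]det0 | ]; ring.
rewrite oppr_eq0 => /eqP g20.
have [h10 /eqP] : dslope H = 0 /\ - dslope G = 0.
  by apply: key; rewrite ?g20 ?h20; ring.
rewrite oppr_eq0 => /eqP g10.
have [/eqP] : (1 : E) = 0 /\ (0 : E) = 0 by apply: key; rewrite ?g10 ?g20; ring.
by rewrite oner_eq0.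
Qed.

Lemma hmem_vanishing e f : f \is e.-homog -> f.@[Q] = 0 -> hmem G H Q f.
Proof.
move=> hf fQ.
have [g1 [g2 [gE g1Q g2Q]]] := plane_chart_first GQ.
have [h1 [h2 [hE h1Q h2Q]]] := plane_chart_first HQ.
have [u [v [fE _ _]]] := plane_chart_first fQ.
have l0Q : (lin0 z).@[Q] != 0 by rewrite lin0_pt oner_neq0.
have memP := @chart_memP _ _ _ _ hG hH Q _ _ (plane_chart_rmorph z) _ (lin_homog z).1 l0Q _
  (@plane_chart_lift E z) (ev0 b) _ e f hf.
apply/memP.
- move=> t t1; exists (horner_eval (t ord_max) \o map_poly (horner_eval (lin1 z).@[t])) => k.
  exact: plane_chart_eval.
- by move=> k; apply: (etrans (ev0_chart z b k)); apply: meval_eq => i; rewrite lin0_pt invr1 mul1r.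
exists (g1 * h2 - g2 * h1), (u * h2 - v * h1), (v * g1 - u * g2); split.
  by rewrite rmorphB !rmorphM /= g1Q g2Q h1Q h2Q slope_det.
rewrite /plane_chart_rmorph /= fE gE hE; exact: local_cramer.
Qed.

(** Evaluation at Q shows that 1 is independent, while any two forms of equal degree have a
    nontrivial combination vanishing at Q, which lies in the local ideal. *)
Lemma transversal_hmult : hmult G H Q 1.
Proof.
split.
  exists 0%N, (fun _ => 1); split=> [_|c]; first by rewrite dhomog1.
  rewrite big_ord1 => -[e [B [A [C [_ BQ BE]]]]] k; rewrite ord1.
  have := congr1 (meval Q) BE; rewrite mevalD !mevalM GQ HQ !mulr0 addr0 mevalZ meval1 mulr1.
  by move/eqP; rewrite mulf_eq0 (negbTE BQ) => /eqP.
case=> e [f [hf fi]].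
have mem (c : 'I_2 -> E) : c ord0 * (f ord0).@[Q] + c ord_max * (f ord_max).@[Q] = 0 -> forall k, c k = 0.
  move=> c0; apply: fi; apply: (@hmem_vanishing e); first exact: dhomog_comb.
  rewrite !big_ord_recl big_ord0 addr0 mevalD !mevalZ.
  by rewrite (_ : lift ord0 ord0 = ord_max) //; apply: val_inj.
have := mem (fun k => if k == ord0 then (f ord_max).@[Q] else - (f ord0).@[Q]).
rewrite eqxx /= mulNr [X in X - _]mulrC subrr => /(_ erefl) fz.
have f0 : (f ord0).@[Q] = 0.
  by have := fz ord_max => /= /eqP; rewrite oppr_eq0 => /eqP.
have := mem (fun k => if k == ord0 then 1 else 0); rewrite eqxx /= f0 mulr0 mul0r addr0.
by move=> /(_ erefl ord0) /= /eqP; rewrite oner_eq0.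
Qed.

End Transversality.

(** * Images of curves under a rational map *)

Section AlgebraicDependence.
Variable K : fieldType.

(** Since [msize] is the degree plus one, every exponent that occurs is below b, and there are b^n
    such monomials. *)
Lemma mpoly_lindep n b (I : finType) (f : I -> {mpoly K[n]}) :
  (forall i, msize (f i) <= b)%N -> (b ^ n < #|I|)%N ->
  exists2 c : I -> K, (exists i, c i != 0) & \sum_i c i *: f i = 0.
Proof.
move=> fb lt_bn; pose mon (g : {ffun 'I_n -> 'I_b}) := [multinom (g k : nat) | k < n].
pose J : finType := {ffun 'I_n -> 'I_b}.
pose A : 'M[K]_(#|I|, #|J|) := \matrix_(i, j) (f (enum_val i))@_(mon (enum_val j)).
have nzk : kermx A != 0.
  rewrite kermx_eq0 /row_free neq_ltn (leq_ltn_trans (rank_leq_col _)) //.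
  by rewrite card_ffun !card_ord.
case/rowV0Pn: nzk => u /sub_kermxP uA /rV0Pn[i0 nzu].
exists (fun i => u 0 (enum_rank i)); first by exists (enum_val i0); rewrite enum_valK.
apply/mpolyP => m; rewrite raddf_sum mcoeff0 /=.
case: (boolP [forall k, (m k < b)%N]) => [/forallP mb|/forallPn[k]]; last first.
  rewrite -leqNgt => bm; apply: big1 => i _; rewrite mcoeffZ memN_msupp_eq0 ?mulr0 //.
  apply: msize_mdeg_ge; apply: leq_trans (fb i) _; apply: leq_trans bm _.
  by rewrite mdegE (bigD1 k) //= leq_addr.
pose g : J := [ffun k => Ordinal (mb k)].
have mg : m = mon g by apply/mnmP => k; rewrite mnmE ffunE.
have := congr1 (fun M : 'rV_#|J| => M 0 (enum_rank g)) uA; rewrite !mxE => uA0.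
rewrite -[RHS]uA0 (reindex (fun i : 'I_#|I| => enum_val i)) /=; last first.
  by exists enum_rank => i _; rewrite ?enum_valK ?enum_rankK.
by apply: eq_bigr => i _; rewrite mcoeffZ !mxE enum_valK enum_rankK -mg.
Qed.

Lemma msizeM_bound n (p q : {mpoly K[n]}) a b :
  (msize p <= a.+1)%N -> (msize q <= b.+1)%N -> (msize (p * q)%R <= (a + b).+1)%N.
Proof.
move=> pa qb; have [->|nzp] := eqVneq p 0; first by rewrite mul0r msize0.
have [->|nzq] := eqVneq q 0; first by rewrite mulr0 msize0.
by rewrite msizeM // -subn1 leq_subLR add1n -addnS -addSn leq_add.
Qed.

Lemma msizeX_bound n (p : {mpoly K[n]}) a k :
  (msize p <= a.+1)%N -> (msize (p ^+ k)%R <= (k * a).+1)%N.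
Proof.
move=> pa; elim: k => [|k IH]; first by rewrite expr0 msize1.
by rewrite exprS mulSn; apply: msizeM_bound.
Qed.

Variable s : 'I_3 -> {mpoly K[3]}.

Definition sub_s : {mpoly K[3]} -> {mpoly K[3]} := mmap (@mpolyC 3 K) s.
HB.instance Definition _ := GRing.RMorphism.copy sub_s sub_s.

Definition eval_rel (M : {poly {mpoly K[3]}}) (f : {mpoly K[3]}) := (map_poly sub_s M).[f].

Lemma algebraic_relation f : exists2 M, M != 0 & eval_rel M f = 0.
Proof.
pose D := (msize f + \sum_k msize (s k))%N.
(* There are m^4 products of powers of the three [s k] and [f] with exponents below m, all of degree
   at most 4mD. The choice of m gives (4mD + 1)^3 <= (4D + 1)^3 m^3 < m^4, so they are dependent. *)
pose m := ((4 * D + 1) ^ 3 + 1)%N.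
pose I : finType := ({ffun 'I_3 -> 'I_m} * 'I_m)%type.
pose mon (g : {ffun 'I_3 -> 'I_m}) := [multinom (g k : nat) | k < 3].
pose F (x : I) := (\prod_k s k ^+ (x.1 k)) * f ^+ x.2.
have fD : (msize f <= D.+1)%N by rewrite ltnW // ltnS leq_addr.
have sD k : (msize (s k) <= D.+1)%N.
  by rewrite ltnW // ltnS /D (bigD1 k) //= addnCA leq_addr.
have pw (p : {mpoly K[3]}) k : (msize p <= D.+1)%N -> (k < m)%N -> (msize (p ^+ k)%R <= (m * D).+1)%N.
  move=> pD km; apply: leq_trans (msizeX_bound _ pD) _.
  by rewrite ltnS leq_mul2r (ltnW km) orbT.
have Fb x : (msize (F x) <= (4 * m * D).+1)%N.
  have -> : (4 * m * D = m * D + (m * D + m * D) + m * D)%N.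
    by rewrite -mulnA; move: (m * D)%N => y; rewrite !mulSn mul0n addn0 !addnA.
  rewrite /F !big_ord_recl big_ord0 mulr1.
  apply: msizeM_bound; last exact: pw.
  by apply: msizeM_bound; [|apply: msizeM_bound]; apply: pw.
have [|c [[g0 l0] nzc] c0] := @mpoly_lindep 3 _ I F Fb.
  rewrite card_prod card_ffun !card_ord.
  apply: (@leq_ltn_trans (((4 * D + 1) * m) ^ 3)).
    by rewrite leq_exp2r // mulnDl mul1n mulnAC -addn1 leq_add2l /m addn1.
  by rewrite expnMn mulnC ltn_pmul2l ?expn_gt0 ?/m ?addn1 //= addn1.
pose M : {poly {mpoly K[3]}} := \sum_(x : I) (c x *: 'X_[mon x.1])%:P * 'X^(x.2).
exists M.
  apply: contraNneq nzc => M0; have := congr1 (fun P : {poly {mpoly K[3]}} => (P`_l0)@_(mon g0)) M0.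
  rewrite coef0 mcoeff0 /M coef_sum raddf_sum /= (bigD1 (g0, l0)) //= big1 => [|[g l] ne].
    by rewrite addr0 coefCM coefXn eqxx mulr1 mcoeffZ mcoeffX eqxx mulr1 => ->.
  rewrite /= coefCM coefXn; case: eqP => [ll|_]; last by rewrite mulr0 mcoeff0.
  rewrite mulr1 mcoeffZ mcoeffX; case: eqP => [gg|_]; last by rewrite mulr0.
  case/eqP: ne; congr (_, _); last exact/val_inj.
  by apply/ffunP => k; apply: val_inj; have /mnmP/(_ k) := gg; rewrite !mnmE.
rewrite -[RHS]c0 /eval_rel /M rmorph_sum horner_sum; apply: eq_bigr => x _ /=.
rewrite rmorphM /= map_polyC map_polyXn hornerM hornerXn hornerC /= /sub_s mmapZ mmapX mul_mpolyC.
rewrite -scalerAl; congr (_ *: (_ * _)); apply: eq_bigr => k _; by rewrite mnmE.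
Qed.

Lemma minimal_relation f : exists M, [/\ M != 0, eval_rel M f = 0 &
  forall M' : {poly {mpoly K[3]}}, M' != 0 -> (size M' < size M)%N -> eval_rel M' f != 0].
Proof.
have [M nzM M0] := algebraic_relation f.
move: {2}(size M) (leqnn (size M)) => n; elim: n M nzM M0 => [|n IH] M nzM M0 szM.
  by rewrite leqn0 size_poly_eq0 (negbTE nzM) in szM.
case: (classic (exists M' : {poly {mpoly K[3]}}, [/\ M' != 0, (size M' < size M)%N & eval_rel M' f = 0])).
  by case=> M' [nzM' lt M'0]; apply: (IH M') => //; rewrite -ltnS (leq_trans lt).
move=> no; exists M; split=> // M' nzM' lt; apply/eqP => M'0; apply: no.
by exists M'.
Qed.

Lemma eval_relX M f : eval_rel (M * 'X) f = eval_rel M f * f.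
Proof. by rewrite /eval_rel rmorphM /= map_polyX hornerMX. Qed.

Lemma eval_relD M M' f : eval_rel (M + M') f = eval_rel M f + eval_rel M' f.
Proof. by rewrite /eval_rel rmorphD hornerD. Qed.

Lemma eval_relC c f : eval_rel c%:P f = sub_s c.
Proof. by rewrite /eval_rel map_polyC hornerC. Qed.

(* The image under s of the curve f = 0 lies in a curve N = 0. *)
Lemma curve_image f : f != 0 ->
  exists N A : {mpoly K[3]}, N != 0 /\ sub_s N = f * A.
Proof.
move=> nzf; have [M [nzM M0 Mmin]] := minimal_relation f.
elim/poly_ind: M nzM M0 Mmin => [|M N _]; first by rewrite eqxx.
move=> nz; rewrite eval_relD eval_relX eval_relC => e0 Mmin.
(* [N] is the constant term of a relation for [f] over K[s] of minimal degree, so N(s) is a multiple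
   of [f]; if [N] were zero, division by [f] would shorten the relation. *)
exists N, (- eval_rel M f); split; last first.
  by rewrite mulrN mulrC; apply/eqP; rewrite -addr_eq0 addrC e0.
apply: contraTneq isT => N0; move: nz e0 Mmin; rewrite N0 polyC0 [sub_s 0]raddf0 !addr0 => nz e0 Mmin.
have nzM : M != 0 by apply: contraNneq nz => ->; rewrite mul0r.
have := Mmin M nzM; rewrite size_mulX // ltnSn => /(_ isT).
by move/eqP: e0; rewrite mulf_eq0 (negbTE nzf) orbF => ->.
Qed.

Lemma mderiv_sub_s k p :
  (sub_s p)^`M(k) = \sum_i sub_s p^`M(i) * (s i)^`M(k).
Proof.
elim/mpoly_ring_ind: p => [c|j|p q hp hq|p q hp hq].
- rewrite /sub_s mmapC mderivC big1 // => i _.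
  by rewrite mderivC raddf0 mul0r.
- rewrite [sub_s _]mmapXU (bigD1 j) //= big1 ?addr0 => [|i /negbTE ne].
    rewrite mderivX mnm1E eqxx -{1}[U_(j)%MM]add0m addmK mpolyX0 scale1r.
    by rewrite rmorph1 mul1r.
  by rewrite mderivX mnm1E eq_sym ne scale0r raddf0 mul0r.
- rewrite rmorphD mderivD hp hq -big_split; apply: eq_bigr => i _.
  by rewrite mderivD rmorphD mulrDl.
- rewrite rmorphM mderivM hp hq mulr_suml mulr_sumr -big_split; apply: eq_bigr => i _.
  by rewrite mderivM rmorphD !rmorphM /= mulrDl mulrAC -!mulrA.
Qed.

Lemma mderiv_eval_rel k M f : (eval_rel M f)^`M(k) =
  \sum_i eval_rel (map_poly (mderiv i) M) f * (s i)^`M(k) + eval_rel M^`() f * f^`M(k).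
Proof.
elim/poly_ind: M => [|M c IH].
  rewrite linear0 -polyC0 eval_relC rmorph0 mderiv0 mul0r addr0 big1 // => i _.
  by rewrite map_poly0 -polyC0 eval_relC rmorph0 mul0r.
rewrite eval_relD eval_relX eval_relC mderivD mderivM IH mderiv_sub_s.
rewrite derivD derivM derivX derivC mulr1 addr0 eval_relD eval_relX.
have step i : eval_rel (map_poly (mderiv i) (M * 'X + c%:P)) f =
    eval_rel (map_poly (mderiv i) M) f * f + sub_s c^`M(i).
  rewrite raddfD /= map_polyC -eval_relX -(eval_relC _ f) -eval_relD; congr (eval_rel (_ + _) f).
  apply/polyP => -[|j]; rewrite coef_map !coefMX ?raddf0 //=.
  by rewrite coef_map.
have -> : \sum_i eval_rel (map_poly (mderiv i) (M * 'X + c%:P)) f * (s i)^`M(k) =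
    (\sum_i eval_rel (map_poly (mderiv i) M) f * (s i)^`M(k)) * f +
    \sum_i sub_s c^`M(i) * (s i)^`M(k).
  by rewrite mulr_suml -big_split; apply: eq_bigr => i _; rewrite step mulrDl mulrAC.
rewrite !mulrDl -!addrA; congr (_ + _).
by rewrite [RHS]addrC -addrA; congr (_ + _); rewrite mulrAC.
Qed.

Definition jacobian : {mpoly K[3]} := \det (\matrix_(i < 3, j < 3) (s i)^`M(j)).

(** Differentiating a minimal relation [M j] of each coordinate over K[s] writes a matrix times the
    Jacobian matrix as minus a diagonal matrix. Its entries, the derivatives of [M j] at the
    coordinates, are nonzero by minimality and characteristic zero. *)
Lemma jacobian_neq0 : [pchar K] =i pred0 -> (forall N, sub_s N = 0 -> N = 0) -> jacobian != 0.
Proof.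
move=> charK sinj.
have [M MP] := fin_all_exists (fun j : 'I_3 => minimal_relation 'X_j).
pose Dj j := eval_rel (M j)^`() 'X_j.
have nzD j : Dj j != 0.
  have [nzM M0 Mmin] := MP j.
  have sM : (1 < size (M j))%N.
    rewrite ltnNge; apply: contra nzM => /size1_polyC ME; move: M0; rewrite ME eval_relC => /sinj ->.
    by rewrite polyC0.
  apply: Mmin; last by rewrite lt_size_deriv.
  apply: contraTneq isT => d0; have := congr1 (fun P : {poly {mpoly K[3]}} => P`_(size (M j)).-2) d0.
  rewrite coef_deriv coef0 prednK ?ltn_predRL // -lead_coefE => /eqP.
  rewrite -mulr_natl -mpolyC_nat mulf_eq0 mpolyC_eq0 lead_coef_eq0 (negbTE nzM) orbF.
  by rewrite (pcharf0P _).1 //; move: sM; case: (size (M j)) => [|[|k]].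
pose A := \matrix_(j < 3, i < 3) eval_rel (map_poly (mderiv i) (M j)) 'X_j.
have AJ : A *m (\matrix_(i < 3, j < 3) (s i)^`M(j)) = - diag_mx (\row_j Dj j).
  apply/matrixP => j k; rewrite !mxE.
  have [_ M0 _] := MP j.
  have := mderiv_eval_rel k (M j) 'X_j; rewrite M0 mderiv0 => /esym/eqP; rewrite addr_eq0 => /eqP e.
  rewrite (eq_bigr (fun i => eval_rel (map_poly (mderiv i) (M j)) 'X_j * (s i)^`M(k))) => [|i _].
    rewrite e -/(Dj j) mderivX mnm1E; case: eqP => [->|_].
      by rewrite -{1}[U_(k)%MM]add0m addmK mpolyX0 scale1r mulr1.
    by rewrite scale0r mulr0.
  by rewrite !mxE.
apply: contraTneq isT => J0; have := congr1 determinant AJ.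
rewrite det_mulmx -/jacobian J0 mulr0 -scaleN1r detZ det_diag => /esym/eqP.
rewrite mulf_eq0 signr_eq0 /= => /prodf_eq0[j _]; rewrite mxE.
by rewrite (negbTE (nzD j)).
Qed.

End AlgebraicDependence.

Lemma homog_components_line (K : closedFieldType) n (N : {mpoly K[n]}) v k :
  (forall a, N.@[fun i => a * v i] = 0) -> (pihomog mdeg k N).@[v] = 0.
Proof.
move=> h; pose b := maxn (msize N) k.+1.
pose q := \poly_(j < b) (pihomog mdeg j N).@[v].
have qE a : q.[a] = 0.
  rewrite -(h a) {1}(pihomog_partitionE (leq_maxl (msize N) k.+1)) horner_poly raddf_sum.
  apply: eq_bigr => j _ /=; rewrite (dhomog_eval _ _ (pihomogP _ _ _)).
  by rewrite mulrC.
have q0 : q = 0.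
  apply/eqP/negPn/negP => /closed_nonrootP[a]; by rewrite /root qE eqxx.
have := coef_poly b (fun j => (pihomog mdeg j N).@[v]) k.
by rewrite -/q q0 coef0 leq_max leqnn orbT.
Qed.

Lemma closed_root_exists (K : closedFieldType) d (a : K) : (0 < d)%N -> exists b, b ^+ d = a.
Proof.
move=> d0; have /closed_rootP[b] : size ('X^d - a%:P) != 1%N.
  by rewrite size_XnsubC // eqSS -lt0n.
by rewrite rootE hornerD hornerN hornerC hornerXn subr_eq0 => /eqP; exists b.
Qed.

(** Dominance speaks of forms only. A relation N(s) = 0 holds at all multiples of s(t), because
    every scalar is a d-th power and s(b t) = b^d s(t), hence it holds for each homogeneous
    component of [N]. *)
Lemma dominant_independent (K : closedFieldType) d (s : 'I_3 -> {mpoly K[3]}) :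
  (0 < d)%N -> (forall i, s i \is d.-homog) -> dominant s ->
  forall N, sub_s s N = 0 -> N = 0.
Proof.
move=> d0 hs dom N N0.
have NE t : N.@[evalS s t] = 0.
  transitivity ((sub_s s N).@[t]); last by rewrite N0 meval0.
  apply: (mpoly_rmorph_ext (f := meval (evalS s t)) (g := meval t \o @sub_s K s)) => [c|i] /=.
    by rewrite /sub_s mmapC !mevalC.
  by rewrite /sub_s mmapXU mevalXU.
have comp k : pihomog mdeg k N = 0.
  apply: dom => [|t _ _]; first by exists k; apply: pihomogP.
  apply: homog_components_line => a; have [b <-] := closed_root_exists a d0.
  rewrite -(NE (fun i => b * t i)); apply: meval_eq => i.
  by rewrite /evalS (dhomog_eval _ _ (hs i)).
by rewrite (pihomog_sum_id 0 N) big1.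
Qed.

(** * Members of the net without common component *)

Section GaussLemma.
Variable K : closedFieldType.
Local Notation V := {poly {poly K}}.

Definition spec (a : K) : V -> {poly K} := map_poly (horner_eval a).
HB.instance Definition _ a := GRing.RMorphism.copy (spec a) (map_poly (horner_eval a)).
(** Trivial content over K[X]: as K is algebraically closed, only linear factors have to be
    excluded. *)
Definition primitive (q : V) := forall a, spec a q != 0.

Lemma spec_dvd a q : spec a q = 0 -> exists q1 : V, q = ('X - a%:P)%:P * q1.
Proof.
move=> qa; exists (map_poly (fun c => c %/ ('X - a%:P)) q).
apply/polyP => k; rewrite coefCM coef_map_id0 ?div0p // mulrC divpK // dvdp_XsubCl.
apply/rootP; have := congr1 (fun p : {poly K} => p`_k) qa.
by rewrite coef0 /spec coef_map.
Qed.

Lemma primitive_part (q : V) : q != 0 ->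
  exists (c : {poly K}) (q1 : V), [/\ c != 0, q = c%:P * q1 & primitive q1].
Proof.
move: {2}(size (lead_coef q)) (leqnn (size (lead_coef q))) => n.
elim: n q => [|n IH] q szq nzq.
  by move: szq; rewrite leqn0 size_poly_eq0 lead_coef_eq0 (negbTE nzq).
case: (classic (primitive q)) => [pq|].
  by exists 1, q; rewrite oner_neq0 mul1r.
move=> /not_all_ex_not[a /negP]; rewrite negbK => /eqP/spec_dvd[q1 qE].
have nzX : 'X - a%:P != 0 by rewrite polyXsubC_eq0.
have nzq1 : q1 != 0 by apply: contraNneq nzq => q10; rewrite qE q10 mulr0.
have [|c [q2 [nzc q1E pq2]]] := IH q1 _ nzq1.
  move: szq; rewrite qE lead_coefM lead_coefC size_mul ?lead_coef_eq0 //.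
  by rewrite size_XsubC.
by exists (('X - a%:P) * c), q2; rewrite mulf_neq0 // qE q1E rmorphM mulrA.
Qed.

(** The linear factors of [c] are removed one at a time: at a root of [c] the product [q * w]
    specializes to 0, and since [q] does not, the factor divides [w]. *)
Lemma gauss_dvd (c : {poly K}) (q g w : V) : c != 0 -> primitive q ->
  c%:P * g = q * w -> exists w', g = q * w'.
Proof.
move=> nzc pq; move: {2}(size c) (leqnn (size c)) => n.
elim: n c w nzc => [|n IH] c w nzc szc cg; first by rewrite leqn0 size_poly_eq0 (negbTE nzc) in szc.
have [/size_poly1P[k nzk ck]|/closed_rootP[a /factor_theorem[c1 cE]]] := boolP (size c == 1%N).
  exists (k^-1%:P%:P * w); rewrite mulrCA -cg ck mulrA -!rmorphM /= mulVf //.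
  by rewrite mul1r.
have nzX : 'X - a%:P != 0 by rewrite polyXsubC_eq0.
have nzc1 : c1 != 0 by apply: contraNneq nzc => c10; rewrite cE c10 mul0r.
have : spec a q * spec a w = 0.
  rewrite -rmorphM -cg rmorphM /= /spec map_polyC /= /horner_eval cE hornerM.
  by rewrite hornerXsubC subrr mulr0 mul0r.
move/eqP; rewrite mulf_eq0 (negbTE (pq a)) => /eqP/spec_dvd[w1 wE].
apply: (IH c1 w1 nzc1).
  by rewrite -ltnS; apply: leq_trans szc; rewrite cE size_mul // size_XsubC addn2.
have nzXC : ('X - a%:P)%:P != 0 :> V by rewrite polyC_eq0.
apply: (mulfI nzXC); rewrite mulrA -rmorphM /= [_ * c1]mulrC -cE cg wE mulrCA.
by [].
Qed.

Lemma fresh_elements (bad : seq K) n : exists S : seq K, [/\ uniq S, size S = n &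
  forall x, x \in S -> x \notin bad].
Proof.
elim: n => [|n [S [uS sS hS]]]; first by exists [::].
have /closed_nonrootP[x] : \prod_(a <- bad ++ S) ('X - a%:P) != 0.
  by rewrite prodf_seq_neq0; apply/allP => a _; rewrite polyXsubC_eq0.
rewrite root_prod_XsubC mem_cat negb_or => /andP[xb xS].
exists (x :: S); rewrite /= xS uS sS; split=> // y; rewrite inE => /predU1P[->//|].
exact: hS.
Qed.

(** For distinct values of a, the gcds of [g0] with g1 + a g2 are pairwise coprime, since a common
    factor would divide all three polynomials. If [size g0] values failed, the product of the gcds
    would divide [g0] and exceed its degree. *)
Lemma coprime_pencil (g0 g1 g2 : V) (bad : seq K) : g0 != 0 ->
  size (gcdp (gcdp g0 g1) g2) = 1%N ->
  exists2 a, a \notin bad & coprimep g0 (g1 + a%:P%:P * g2).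
Proof.
move=> nz0 g1E; have [S [uS sS hS]] := fresh_elements bad (size g0).
apply: NNPP => no.
pose f a := g1 + a%:P%:P * g2; pose h a := gcdp g0 (f a).
have szh a : a \in S -> (1 < size (h a))%N.
  move=> aS; rewrite ltnNge; apply/negP => le1; apply: no; exists a; first exact: hS.
  rewrite /coprimep eqn_leq le1 lt0n size_poly_eq0 gcdp_eq0 (negbTE nz0) //.
have cop a b : a != b -> coprimep (h a) (h b).
  move=> ab; rewrite /coprimep eqn_leq lt0n size_poly_eq0 gcdp_eq0 [h a == 0]gcdp_eq0 (negbTE nz0) /= andbT.
  set e := gcdp (h a) (h b).
  have ea : e %| h a := dvdp_gcdl _ _; have eb : e %| h b := dvdp_gcdr _ _.
  have e0 : e %| g0 := dvdp_trans ea (dvdp_gcdl _ _).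
  have efa : e %| f a := dvdp_trans ea (dvdp_gcdr _ _).
  have efb : e %| f b := dvdp_trans eb (dvdp_gcdr _ _).
  have e2 : e %| g2.
    have : e %| f a - f b by apply: dvdp_sub.
    rewrite /f opprD addrACA subrr add0r -mulrBl -!rmorphB /= mul_polyC dvdpZr //.
    by rewrite polyC_eq0 subr_eq0.
  have e1 : e %| g1.
    have : e %| f a - a%:P%:P * g2 by apply: dvdp_sub => //; apply: dvdp_mull.
    by rewrite /f addrK.
  rewrite -g1E; apply: dvdp_leq; first by rewrite -size_poly_eq0 g1E.
  by rewrite !dvdp_gcd e0 e1 e2.
have prodS T : uniq T -> {subset T <= S} ->
    (\prod_(a <- T) h a %| g0) && (size T < size (\prod_(a <- T) h a)%R)%N.
  elim: T => [|a T IH] /=; first by rewrite big_nil dvd1p size_poly1.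
  move=> /andP[aT uT] sT; have aS : a \in S by apply: sT; rewrite inE eqxx.
  have /andP[d1 s1] := IH uT (fun x xT => sT x (mem_behead (s := a :: T) xT)).
  rewrite big_cons Gauss_dvdp; last first.
    have : forall b, b \in T -> coprimep (h a) (h b).
      by move=> b bT; apply: cop; apply: contraNneq aT => ->.
    elim: T {aT uT sT d1 s1 IH} => [|b T IHT] hT; first by rewrite big_nil coprimep1.
    rewrite big_cons coprimepMr hT ?mem_head //=.
    by apply: IHT => c cT; apply: hT; rewrite inE cT orbT.
  rewrite d1 dvdp_gcdl /=; have h1 := szh a aS.
  have nzh : h a != 0 by rewrite -size_poly_gt0 ltnW.
  have nzP : \prod_(b <- T) h b != 0 by rewrite -size_poly_gt0 (leq_trans _ s1).
  rewrite size_mul // -ltnS prednK; last by rewrite addn_gt0 (ltnW h1).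
  by apply: leq_trans (leq_add h1 s1); rewrite addnC addn2.
have /andP[dv] := prodS S uS (fun x xS => xS).
by rewrite sS ltnNge dvdp_leq.
Qed.

End GaussLemma.

Lemma rmorph_cofactor (A B : comNzRingType) (ch : {rmorphism A -> B}) (Q C g l : A) (q w : B) k :
  ch Q = q -> ch C = w -> ch g = q * w -> ch l = 1 -> ch (Q * C - g * l ^+ k) = 0.
Proof.
by move=> hQ hC hg hl; rewrite rmorphB !rmorphM rmorphXn /= hQ hC hg hl expr1n mulr1 subrr.
Qed.

(** [gcdp] divides only up to factors from K[X]; its primitive part is a true common divisor by
    Gauss's lemma. *)
Lemma gcd3_size (K : closedFieldType) (g : 'I_3 -> {poly {poly K}}) : (forall i, g i != 0) ->
  (forall q, (forall i, exists w, g i = q * w) -> (size q <= 1)%N) ->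
  size (gcdp (gcdp (g ord0) (g (inord 1))) (g ord_max)) = 1%N.
Proof.
move=> nzg hg.
set q := gcdp _ _.
have nzq : q != 0 by rewrite gcdp_eq0 gcdp_eq0 (negbTE (nzg _)).
have [c [q1 [nzc qE pq1]]] := primitive_part nzq.
have q1q : q1 %| q by rewrite qE mul_polyC dvdpZr ?dvdpp.
have q1g i : q1 %| g i.
  apply: dvdp_trans q1q _; suff : i \in [:: ord0; inord 1; ord_max].
    rewrite !inE => /or3P[]/eqP->; rewrite /q.
    - by apply: dvdp_trans (dvdp_gcdl _ _) (dvdp_gcdl _ _).
    - by apply: dvdp_trans (dvdp_gcdl _ _) (dvdp_gcdr _ _).
    - exact: dvdp_gcdr.
  by case: i => [[|[|[|//]]] hi]; rewrite !inE -!val_eqE /= ?inordK.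
have : (size q1 <= 1)%N.
  apply: hg => i; have /Pdiv.Idomain.dvdpP[[k w] /= nzk kE] := q1g i.
  by apply: (gauss_dvd (c := k) nzk pq1 (w := w)); rewrite mul_polyC kE mulrC.
have -> : size q1 = size q by rewrite qE mul_polyC size_scale.
by move=> le1; apply/eqP; rewrite eqn_leq le1 size_poly_gt0.
Qed.

(** * A pair of curves of the net with nonzero resultant, found in the chart t2 = 1 *)

Section PencilResultant.
Variable K : closedFieldType.
Local Notation V := {poly {poly K}}.
Local Notation z := (Some (0 : K)).
Local Notation pch := (plane_chart_rmorph z).
Local Notation X1 := ('X_(inord 1) : {mpoly K[3]}).

Lemma lin0_some0 : lin0 z = X1.
Proof. by rewrite /lin0 /= scale0r scaleN1r opprK add0r. Qed.

Lemma X1_homog : X1 \is 1.-homog. Proof. by rewrite dhomogX /= mdeg1. Qed.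

Lemma X1_neq0 : X1 != 0.
Proof. by rewrite -msize_poly_eq0 msizeX. Qed.

Lemma X1_chart : pch X1 = 1.
Proof. by rewrite -lin0_some0; apply: chart_lin0. Qed.

Lemma pch_inj e f : f \is e.-homog -> pch f = 0 -> f = 0.
Proof.
move=> hf; have l0Q : (lin0 z).@[pt z 0] != 0 by rewrite lin0_pt oner_neq0.
apply: (chart_inj (lin_homog z).1 l0Q _ hf) => t t1.
exists (horner_eval (t ord_max) \o map_poly (horner_eval (lin1 z).@[t])) => k.
exact: plane_chart_eval.
Qed.

Lemma X1_prime (f g c : {mpoly K[3]}) : f * g = X1 * c ->
  (exists f', f = X1 * f') \/ (exists g', g = X1 * g').
Proof.
have [kill killC killX] : exists2 kill : {rmorphism {mpoly K[3]} -> {mpoly K[3]}},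
    forall a, kill a%:MP = a%:MP & forall i, kill 'X_i = if i == inord 1 then 0 else 'X_i.
  exists (mmap (@mpolyC 3 K) (fun i => if i == inord 1 then 0 else 'X_i)) => [a|i] /=.
    by rewrite mmapC.
  by rewrite mmapXU.
have killE k : exists q, k = kill k + X1 * q.
  elim/mpoly_ring_ind: k => [a|i|p q [p' pE] [q' qE]|p q [p' pE] [q' qE]].
  - by exists 0; rewrite killC mulr0 addr0.
  - rewrite killX; case: eqP => [->|_]; first by exists 1; rewrite add0r mulr1.
    by exists 0; rewrite mulr0 addr0.
  - exists (p' + q'); rewrite rmorphD; move: (kill p) (kill q) pE qE => P P' -> ->.
    exact: quot_add.
  - exists (p' * q + kill p * q'); rewrite rmorphM; move: (kill p) (kill q) pE qE => P P' -> ->.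
    exact: quot_mul.
move=> fg; have : kill f * kill g = 0 by rewrite -rmorphM fg rmorphM killX eqxx mul0r.
move/eqP; rewrite mulf_eq0 => /orP[]/eqP k0.
  by left; have [q fE] := killE f; exists q; rewrite {1}fE k0 add0r.
by right; have [q gE] := killE g; exists q; rewrite {1}gE k0 add0r.
Qed.

Lemma X1_cancel Q C g k : ~ (exists Q', Q = X1 * Q') -> Q * C = g * X1 ^+ k ->
  exists C', g = Q * C'.
Proof.
move=> nQ; elim: k C => [|k IH] C QC; first by exists C; rewrite QC expr0 mulr1.
have QC' : Q * C = X1 * (g * X1 ^+ k) by rewrite QC exprS mulrCA.
have [//|[C' CE]] := X1_prime QC'; apply: (IH C'); apply: (mulfI X1_neq0).
by rewrite -QC' CE mulrCA.
Qed.

(** Any homogeneous lift is divided by t2 as long as possible; t2 becomes 1 in the chart, so [q] is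
    unchanged. *)
Lemma homogenization (q : V) : q != 0 -> exists e Q, [/\ Q \is e.-homog, pch Q = q &
  ~ (exists Q', Q = X1 * Q')].
Proof.
move=> nzq; have [e0 /(_ e0 (leqnn _))[Q hQ QE]] := plane_chart_lift z q.
elim: e0 Q hQ QE => [|e IH] Q hQ QE.
  exists 0%N, Q; split=> // -[Q' Q'E].
  have nzQ : Q != 0 by apply: contraNneq nzq => Q0; rewrite -QE Q0 rmorph0.
  have nzQ' : Q' != 0 by apply: contraNneq nzQ => Q0; rewrite Q'E Q0 mulr0.
  have : msize Q = 1%N.
    by rewrite (dhomog0_const hQ) msizeC; case: eqP => // c0; rewrite (dhomog0_const hQ) c0 mpolyC0 eqxx in nzQ.
  rewrite Q'E msizeM ?X1_neq0 // msizeX /= mdeg1 => /=.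
  by case: (msize Q') (msize_poly_eq0 Q') => [|k] //=; rewrite (negbTE nzQ').
case: (classic (exists Q', Q = X1 * Q')) => [[Q' Q'E]|no]; last by exists e.+1, Q.
apply: (IH Q'); last by rewrite -QE Q'E rmorphM /= X1_chart mul1r.
by apply: (dhomog_factor X1_neq0 X1_homog); rewrite -Q'E add1n.
Qed.

Variables (d : nat) (s : 'I_3 -> {mpoly K[3]}).
Hypotheses (d0 : (0 < d)%N) (hs : forall i, s i \is d.-homog) (s1 : forall i, (s i).@[@pole K] != 0)
  (sgcd : gcd_one s).

(** A common divisor in the chart homogenizes to [Q] prime to t2. The powers of t2 in the
    homogenized relations then cancel, so [Q] divides every [s i] and [gcd_one] makes it
    constant. *)
Lemma chart_gcd_one (q : V) : (forall i, exists w, plane_chart z (s i) = q * w) -> (size q <= 1)%N.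
Proof.
move=> hq.
have nzs i : plane_chart z (s i) != 0.
  have [_ sz] := plane_chart_lead z (hs i) (s1 i).
  by rewrite -size_poly_gt0 sz.
have nzq : q != 0.
  have [w wE] := hq ord0; apply: contraTneq (nzs ord0) => q0.
  by rewrite wE q0 mul0r eqxx.
have [e [Q [hQ QE nQ]]] := homogenization nzq.
have [i|c [nzc Qc]] := sgcd (q := Q); last first.
  by rewrite -QE Qc [pch _]plane_chartC size_polyC; case: (_ != 0).
have [w wE] := hq i; have [e0 lw] := plane_chart_lift z w.
pose N := (e0 + e + d)%N.
have [|C hC CE] := lw (e0 + d)%N; first exact: leq_addr.
have h1 : Q * C \is N.-homog by apply: dhomog_cast (dhomogM hQ hC) _; rewrite /N addnCA addnA.
have h2 : s i * X1 ^+ (e0 + e) \is N.-homog.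
  by apply: dhomog_cast (dhomogM (hs i) (dhomogMn _ X1_homog)) _; rewrite mul1n addnC.
apply: (X1_cancel (k := (e0 + e)%N) nQ (C := C)).
apply/eqP; rewrite -subr_eq0; apply/eqP; apply: (@pch_inj N); first exact: rpredB.
have chs : pch (s i) = q * w := wE.
exact: (rmorph_cofactor _ QE CE chs X1_chart).
Qed.

Lemma charts_coprime :
  size (gcdp (gcdp (plane_chart z (s ord0)) (plane_chart z (s (inord 1))))
    (plane_chart z (s ord_max))) = 1%N.
Proof.
apply: (gcd3_size (g := fun i => plane_chart z (s i)) _ chart_gcd_one) => i.
have [_ sz] := plane_chart_lead z (hs i) (s1 i).
by rewrite -size_poly_gt0 sz.
Qed.

Lemma pencil_res_neq0 : exists z6 : 'I_6 -> K,
  [/\ (\sum_i xs z6 i *: s i).@[@pole K] != 0, (\sum_i ys z6 i *: s i).@[@pole K] != 0 &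
      res3 (\sum_i xs z6 i *: s i) (\sum_i ys z6 i *: s i) != 0].
Proof.
have [_ sz0] := plane_chart_lead z (hs ord0) (s1 ord0).
have nz0 : plane_chart z (s ord0) != 0 by rewrite -size_poly_gt0 sz0.
(* The pair is s_1 and s_2 + a s_3; the excluded value of a is the one for which the second form
   vanishes at (0:0:1). *)
have [a ab cop] := coprime_pencil
  [:: - (s (inord 1)).@[@pole K] / (s ord_max).@[@pole K]] nz0 charts_coprime.
pose u (i : 'I_3) : K := if i == ord0 then 1 else 0.
pose v (i : 'I_3) : K := if i == inord 1 then 1 else if i == ord_max then a else 0.
pose z6 (i : 'I_6) : K := match split (i : 'I_(3 + 3)) with inl k => u k | inr k => v k end.
have uE : \sum_i xs z6 i *: s i = s ord0.
  rewrite (bigD1 ord0) //= big1 => [|i ne].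
    by rewrite /xs /z6 (_ : split _ = inl ord0) ?scale1r ?addr0 //; apply: (unsplitK (inl _)).
  by rewrite /xs /z6 (_ : split _ = inl i) ?/u ?(negbTE ne) ?scale0r //; apply: (unsplitK (inl _)).
have vE : \sum_i ys z6 i *: s i = s (inord 1) + a%:MP * s ord_max.
  have yE i : ys z6 i = v i.
    by rewrite /ys /z6 (_ : split _ = inr i) //; apply: (unsplitK (inr _)).
  rewrite !big_ord_recl big_ord0 !yE /v -!val_eqE /= !inordK //= scale0r add0r addr0 scale1r mul_mpolyC.
  by congr (s _ + _ *: s _); apply: val_inj; rewrite /= ?inordK.
exists z6; rewrite uE vE; have h1 : s (inord 1) + a%:MP * s ord_max \is d.-homog.
  by apply: dhomogD => //; rewrite mul_mpolyC dhomogZ.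
have p1 : (s (inord 1) + a%:MP * s ord_max).@[@pole K] != 0.
  move: ab; rewrite inE mevalD mevalM mevalC; apply: contraNneq => e.
  by apply/eqP; apply: (mulIf (s1 ord_max)); rewrite mulfVK //; apply/eqP; rewrite -addr_eq0 addrC e.
split=> //; apply: contraTneq isT => r0.
have := res3_line (hs ord0) h1 (s1 ord0) p1 z.
rewrite r0 rmorph0 => /esym/eqP; rewrite resultant_eq0.
have -> : plane_chart z (s (inord 1) + a%:MP * s ord_max) =
   plane_chart z (s (inord 1)) + a%:P%:P * plane_chart z (s ord_max).
  rewrite -[LHS]/(pch _) rmorphD rmorphM; congr (_ + _ * _); exact: plane_chartC.
by move: cop; rewrite /coprimep => /eqP->.
Qed.

End PencilResultant.

Lemma hindep_le (E : closedFieldType) (G H : {mpoly E[3]}) Q m k :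
  (k <= m)%N -> hindep G H Q m -> hindep G H Q k.
Proof.
move=> km [e [f [hf fi]]]; exists e, (fun j => f (widen_ord km j)); split=> // c hc j.
pose c' (i : 'I_m) := if insub (nat_of_ord i) is Some j then c j else 0.
have c'E (i : 'I_k) : c' (widen_ord km i) = c i.
  by rewrite /c' insubT //= => ik; congr c; apply: val_inj.
rewrite -c'E; apply: fi; suff -> : \sum_i c' i *: f i = \sum_i c i *: f (widen_ord km i) by [].
rewrite (bigID (fun i : 'I_m => (i < k)%N)) /= [X in _ + X]big1 ?addr0 => [|i].
  rewrite (big_ord_narrow km); apply: eq_bigr => i _; by rewrite c'E.
by move=> nik; rewrite /c' insubF ?scale0r //; apply: negbTE.
Qed.

Lemma hmult_uniq (E : closedFieldType) (G H : {mpoly E[3]}) Q m m' :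
  hmult G H Q m -> hmult G H Q m' -> m = m'.
Proof.
move=> [h1 n1] [h2 n2]; apply/eqP; rewrite eqn_leq [(m <= m')%N]leqNgt [(m' <= m)%N]leqNgt.
by apply/andP; split; apply/negP => lt; [apply: n2; apply: hindep_le h1 | apply: n1; apply: hindep_le h2].
Qed.

(** * Fibres of a dominant map *)

Section CrossProduct.
Variable R : comNzRingType.
Implicit Types u v w : 'I_3 -> R.
Let o1 : 'I_3 := lift ord0 ord0.
Let o2 : 'I_3 := lift ord0 (lift ord0 ord0).

Definition cross u v : 'I_3 -> R := fun i =>
  match nat_of_ord i with
  | 0%N => u o1 * v o2 - u o2 * v o1
  | 1%N => u o2 * v ord0 - u ord0 * v o2
  | _ => u ord0 * v o1 - u o1 * v ord0
  end.
Definition dot u v : R := \sum_i u i * v i.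

Lemma dotE u v : dot u v = u ord0 * v ord0 + (u o1 * v o1 + u o2 * v o2).
Proof. by rewrite /dot !big_ord_recl big_ord0 addr0. Qed.

Lemma ord3_ind (P : 'I_3 -> Prop) : P ord0 -> P o1 -> P o2 -> forall i, P i.
Proof.
move=> h0 h1 h2 i; suff : i \in [:: ord0; o1; o2] by rewrite !inE => /or3P[]/eqP->.
by case: i => [[|[|[|//]]] hi]; rewrite !inE -!val_eqE.
Qed.

Lemma dot_cross u v : dot u (cross u v) = 0 /\ dot v (cross u v) = 0.
Proof. by rewrite !dotE /cross /=; split; ring. Qed.

Lemma dotZr a u v : dot u (fun i => a * v i) = a * dot u v.
Proof. by rewrite /dot mulr_sumr; apply: eq_bigr => i _; rewrite mulrCA. Qed.

(** The triple product identity: w x (u x v) = (v . w) u - (u . w) v. *)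
Lemma cross_parallel u v w : dot u w = 0 -> dot v w = 0 ->
  forall i j, w i * cross u v j = w j * cross u v i.
Proof.
move=> uw vw.
have e0 : w ord0 * cross u v o1 - w o1 * cross u v ord0 = u o2 * dot v w - v o2 * dot u w.
  by rewrite !dotE /cross /=; ring.
have e1 : w o1 * cross u v o2 - w o2 * cross u v o1 = u ord0 * dot v w - v ord0 * dot u w.
  by rewrite !dotE /cross /=; ring.
have e2 : w o2 * cross u v ord0 - w ord0 * cross u v o2 = u o1 * dot v w - v o1 * dot u w.
  by rewrite !dotE /cross /=; ring.
move/eqP: e0; move/eqP: e1; move/eqP: e2; rewrite uw vw !mulr0 subr0 !subr_eq0 => /eqP e2 /eqP e1 /eqP e0.
by elim/ord3_ind => //; elim/ord3_ind.
Qed.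

End CrossProduct.

Lemma cross_span (F : fieldType) (u v w : 'I_3 -> F) i0 : cross u v i0 != 0 ->
  dot u w = 0 -> dot v w = 0 -> exists c, forall i, w i = c * cross u v i.
Proof.
move=> nz uw vw; exists (w i0 / cross u v i0) => i; apply: (mulIf nz).
by rewrite mulrAC divfK // (cross_parallel uw vw).
Qed.

Lemma cross_free (F : fieldType) (u v : 'I_3 -> F) i0 a c : cross u v i0 != 0 ->
  (forall i, a * u i + c * v i = 0) -> a = 0 /\ c = 0.
Proof.
move=> nz h; pose w i := a * u i + c * v i.
have w0 : forall i, w i = 0 by [].
have e1 : cross w v i0 = a * cross u v i0 by elim/ord3_ind: i0 {nz}; rewrite /cross /w /=; ring.
have e2 : cross u w i0 = c * cross u v i0 by elim/ord3_ind: i0 {nz e1}; rewrite /cross /w /=; ring.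
have z1 : cross w v i0 = 0 by elim/ord3_ind: i0 {nz e1 e2}; rewrite /cross /= !w0; ring.
have z2 : cross u w i0 = 0 by elim/ord3_ind: i0 {nz e1 e2 z1}; rewrite /cross /= !w0; ring.
split; apply: (mulIf nz); rewrite mul0r; [by rewrite -e1 | by rewrite -e2].
Qed.

Section NormalForms.
Variable E : fieldType.
Implicit Types (z : option E) (b : E).

Lemma pt_normal (Q : 'I_3 -> E) : (exists i : 'I_3, (i < 2)%N && (Q i != 0)) ->
  exists z b, prop_eq Q (pt z b).
Proof.
case=> i /andP[i2 Qi].
have [Q1|Q1] := eqVneq (Q (lift ord0 ord0)) 0.
  have Q0 : Q ord0 != 0.
    move: i2 Qi; elim/ord3_ind: i => //=; by rewrite Q1 eqxx.
  exists None, (Q (lift ord0 (lift ord0 ord0)) / Q ord0), (Q ord0); split=> //.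
  by elim/ord3_ind; rewrite /pt /= ?mulr1 ?mulr0 // mulrC divfK.
set o1 := lift ord0 ord0 in Q1.
exists (Some (Q ord0 / Q o1)), (Q (lift ord0 (lift ord0 ord0)) / Q o1), (Q o1); split=> //.
by elim/ord3_ind; rewrite /pt /= ?mulr1 ?mulr0 // mulrC divfK.
Qed.

Lemma pt_inj z b z' b' : prop_eq (pt z b) (pt z' b') -> z = z' /\ b = b'.
Proof.
case=> c [nzc h]; have := h ord0; have := h (lift ord0 ord0); have := h ord_max.
rewrite /pt /=; case: z z' {h} => [a|] [a'|] /=; rewrite ?mulr1 ?mulr0.
- by move=> -> <- ->; rewrite !mul1r.
- by move=> _ /eqP; rewrite oner_eq0.
- by move=> _ c0; rewrite -c0 eqxx in nzc.
- by move=> -> _ <-; rewrite mul1r.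
Qed.

Lemma pt_nonzero z b : nonzero3 (pt z b).
Proof.
by case: z => [a|]; [exists (lift ord0 ord0) | exists ord0]; rewrite /pt /= oner_neq0.
Qed.

Lemma prop_eq_sym (u v : 'I_3 -> E) : prop_eq u v -> prop_eq v u.
Proof.
case=> c [nzc h]; exists c^-1; split=> [|i]; first by rewrite invr_eq0.
by rewrite h mulKf.
Qed.

End NormalForms.

Lemma sum_count_mem (T : eqType) (U zs : seq T) : uniq U -> {subset zs <= U} ->
  (\sum_(z <- U) count_mem z zs)%N = size zs.
Proof.
move=> uU; elim: zs => [_|x zs IH sub] /=; first by rewrite big1.
rewrite big_split /= IH => [|y yzs]; last by apply: sub; rewrite inE yzs orbT.
rewrite -add1n; congr (_ + _)%N; rewrite -[RHS](_ : count_mem x U = 1%N); last first.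
  by rewrite count_uniq_mem // sub // mem_head.
by rewrite -sum1_count [RHS]big_mkcond /=; apply: eq_bigr => y _; rewrite eq_sym; case: eqP.
Qed.

Section LineRoots.
Variable E : closedFieldType.
Variables (d : nat) (z : option E).

Lemma line_roots (f : {mpoly E[3]}) : f \is d.-homog -> f.@[@pole E] != 0 ->
  exists bs : seq E, uniq bs /\ forall b, (b \in bs) = (f.@[pt z b] == 0).
Proof.
move=> hf f1; have [lE sE] := plane_chart_lead z hf f1.
have cl : const_lead (plane_chart z f) by exists f.@[@pole E].
have [rs rsE] := closed_field_poly_normal (red0 (plane_chart z f)).
exists (undup rs); split=> [|b]; first exact: undup_uniq.
have nz : red0 (plane_chart z f) != 0 by rewrite -size_poly_eq0 const_lead_red0 // sE.
rewrite mem_undup -ev0_chart ev0E rsE hornerZ mulf_eq0 lead_coef_eq0 (negbTE nz) /=.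
by rewrite -root_prod_XsubC.
Qed.

Lemma res3_vanish (G H : {mpoly E[3]}) b : (0 < d)%N -> G \is d.-homog -> H \is d.-homog ->
  G.@[@pole E] != 0 -> H.@[@pole E] != 0 ->
  G.@[pt z b] = 0 -> H.@[pt z b] = 0 -> (res3 G H).@[rep z] = 0.
Proof.
move=> d0 hG hH G1 H1 Gb Hb; rewrite -line_chart_rep (res3_line hG hH G1 H1).
have [_ sG] := plane_chart_lead z hG G1; have [_ sH] := plane_chart_lead z hH H1.
have s1 : (1 < size (plane_chart z G))%N by rewrite sG ltnS.
have s2 : (1 < size (plane_chart z H))%N by rewrite sH ltnS.
have [[u v] _ rE] := resultant_in_ideal s1 s2.
rewrite -(ev0_polyC b) rE /=.
have e1 := ev0_chart z b G; have e2 := ev0_chart z b H; rewrite Gb in e1; rewrite Hb in e2.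
move: (plane_chart z G) (plane_chart z H) e1 e2 => g h e1 e2.
by rewrite rmorphD !rmorphM /= e1 e2 !mulr0 addr0.
Qed.

End LineRoots.

Lemma order0_uniq (E : fieldType) a b (q q' : {poly E}) :
  'X^a * q = 'X^b * q' -> q.[0] != 0 -> q'.[0] != 0 -> a = b.
Proof.
wlog le_ab : a b q q' / (a <= b)%N => [hw e q0 q0'|e q0 q0'].
  by case: (leqP a b) => [le|/ltnW le]; [apply: hw e _ _ | symmetry; apply: hw (esym e) _ _].
apply/eqP; rewrite eqn_leq le_ab leqNgt; apply/negP => lt_ab.
have : q = 'X^(b - a) * q'.
  by apply: (mulfI (expf_neq0 a (polyX_neq0 E))); rewrite e mulrA -exprD subnKC.
by move=> qE; case/negP: q0; rewrite qE hornerM hornerXn expr0n subn_eq0 leqNgt lt_ab mul0r.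
Qed.

Lemma map_mpoly_deriv (R S : comNzRingType) (phi : {rmorphism R -> S}) n (i : 'I_n) (f : {mpoly R[n]}) :
  (map_mpoly phi f)^`M(i) = map_mpoly phi f^`M(i).
Proof.
apply/mpolyP => m; rewrite mcoeff_deriv mcoeff_map_mpoly [RHS]mcoeff_map_mpoly mcoeff_deriv.
by rewrite raddfMn.
Qed.

Section FiberCount.
Variables (K : closedFieldType) (d : nat) (s : 'I_3 -> {mpoly K[3]}).
Hypotheses (d0 : (0 < d)%N) (hs : forall i, s i \is d.-homog).
Variables (B1 : seq (option K)) (bl : option K -> seq K) (o : option K -> nat).
Hypotheses (uB1 : uniq B1) (ubl : forall a, uniq (bl a))
  (hbl : forall a b, (b \in bl a) = [forall i, (s i).@[pt a b] == 0]).
Variables (E : closedFieldType) (phi : {rmorphism K -> E}) (z6 : 'I_6 -> E).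

Definition sE i := map_mpoly phi (s i).
Definition pencil (c : 'I_3 -> E) : {mpoly E[3]} := \sum_i c i *: sE i.
Local Notation G := (pencil (xs z6)).
Local Notation H := (pencil (ys z6)).
Local Notation p := (cross (xs z6) (ys z6)).

(** The scalar separates the two kinds of common zeros of the pencil: a base point for c = 0, a
    point of the fibre over p otherwise. *)
Definition in_fib (Q : 'I_3 -> E) (c : E) := forall i, (sE i).@[Q] = c * p i.

Hypotheses (G1 : G.@[@pole E] != 0) (H1 : H.@[@pole E] != 0) (p0 : p ord0 != 0).
Hypothesis hJ : forall Q c, c != 0 -> in_fib Q c -> (map_mpoly phi (jacobian s)).@[Q] != 0.
Hypothesis hL : forall a b c, a \in B1 -> c != 0 -> ~ in_fib (pt (omap phi a) b) c.
Hypothesis hbase : forall z b, (forall i, (sE i).@[pt z b] = 0) ->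
  exists a b0, [/\ a \in B1, z = omap phi a, b = phi b0 & forall i, (s i).@[pt a b0] = 0].
Hypothesis hord : forall a, a \in B1 -> exists2 q : {poly E},
  line_chart (omap phi a) (res3 G H) = 'X^(o a) * q & q.[0] != 0.
Hypothesis rnz : res3 G H != 0.

Lemma sE_homog i : sE i \is d.-homog.
Proof. exact: map_mpoly_homog. Qed.

Lemma pencil_homog c : pencil c \is d.-homog.
Proof. by apply: dhomog_comb => i; apply: sE_homog. Qed.

Lemma pencil_eval c Q : (pencil c).@[Q] = dot c (fun i => (sE i).@[Q]).
Proof. by rewrite /pencil raddf_sum; apply: eq_bigr => i _ /=; rewrite mevalZ. Qed.

Lemma pencil_deriv c j Q : (pencil c)^`M(j).@[Q] = \sum_i c i * (sE i)^`M(j).@[Q].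
Proof.
rewrite /pencil (linear_sum (mderiv j)) (raddf_sum (meval Q)).
by apply: eq_bigr => i _ /=; rewrite mderivZ mevalZ.
Qed.

Lemma pencil_zero Q : (G.@[Q] == 0) && (H.@[Q] == 0) <-> exists c, in_fib Q c.
Proof.
split=> [/andP[/eqP gQ /eqP hQ]|[c hc]].
  by apply: (cross_span p0); rewrite -pencil_eval.
have [e1 e2] := dot_cross (xs z6) (ys z6).
have dE u : dot u (fun i => (sE i).@[Q]) = c * dot u p.
  by rewrite -dotZr; apply: eq_bigr => i _; rewrite hc.
by rewrite !pencil_eval !dE e1 e2 mulr0 eqxx.
Qed.

Lemma map_pt a (b : K) i : pt (omap phi a) (phi b) i = phi (pt a b i).
Proof.
by elim/ord3_ind: i; rewrite /pt /=; case: a => //= *; rewrite ?rmorph0 ?rmorph1.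
Qed.

Lemma sE_pt a b i : (sE i).@[pt (omap phi a) (phi b)] = phi (s i).@[pt a b].
Proof. by rewrite -meval_map_mpoly; apply: meval_eq => j; apply: map_pt. Qed.

(** The gradient of a member of the net is its coefficient vector times the Jacobian matrix, which
    is invertible at the point; the vectors x and y are independent because their cross product is
    nonzero. *)
Lemma transversal_fiber z b c : c != 0 -> in_fib (pt z b) c -> hmult G H (pt z b) 1.
Proof.
move=> nzc hc; have /andP[/eqP gQ /eqP hQ] : (G.@[pt z b] == 0) && (H.@[pt z b] == 0).
  by apply/pencil_zero; exists c.
apply: (transversal_hmult (pencil_homog _) (pencil_homog _) gQ hQ) => x y xy.
apply: (cross_free p0) => i; move: i.
pose w i := x * xs z6 i + y * ys z6 i; rewrite -/(forall i, w i = 0).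
pose M : 'M[E]_3 := \matrix_(i, j) (sE i)^`M(j).@[pt z b].
have detM : \det M != 0.
  have := hJ nzc hc; rewrite /jacobian -det_map_mx; congr (_ != 0).
  rewrite -[LHS]/((meval (pt z b) : {rmorphism _ -> _}) _) -det_map_mx; congr (\det _).
  by apply/matrixP => i j; rewrite !mxE map_mpoly_deriv.
have wM : (\row_i w i) *m M = 0.
  apply/rowP => j; rewrite !mxE -[RHS](xy j) !pencil_deriv !mulr_sumr -big_split.
  by apply: eq_bigr => i _ /=; rewrite !mxE /w; ring.
have w0 : \row_i w i = 0.
  apply/eqP/negPn/negP => nz; case/negP: detM; apply/det0P.
  by exists (\row_i w i).
by move=> i; have := congr1 (fun v : 'rV_3 => v 0 i) w0; rewrite !mxE.
Qed.

Lemma common_roots z : exists bs : seq E, uniq bs /\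
  forall b, (b \in bs) = (G.@[pt z b] == 0) && (H.@[pt z b] == 0).
Proof.
have [bs [ub hb]] := line_roots z (pencil_homog (xs z6)) G1.
exists [seq b <- bs | H.@[pt z b] == 0]; split; first exact: filter_uniq.
by move=> b; rewrite mem_filter hb andbC.
Qed.

(** By [hL] a line of a base point contains no fibre point, so its common zeros are base points,
    with coordinates in K, and share the order [o a]. *)
Lemma base_mults : exists ms : option K -> K -> nat, forall a, a \in B1 ->
  (forall b, b \in bl a -> hmult G H (pt (omap phi a) (phi b)) (ms a b)) /\
  (\sum_(b <- bl a) ms a b)%N = o a.
Proof.
suff h a : exists ms : K -> nat, a \in B1 ->
  (forall b, b \in bl a -> hmult G H (pt (omap phi a) (phi b)) (ms b)) /\
  (\sum_(b <- bl a) ms b)%N = o a.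
  pose F a := proj1_sig (constructive_indefinite_description _ (h a)).
  exists F => a aB; rewrite /F; case: (constructive_indefinite_description _ _) => ms /=.
  exact.
case: (boolP (a \in B1)) => [aB|_]; last by exists (fun _ => 0%N).
have [q rE q0] := hord aB.
have [||ms [h1 h2]] := curve_line_mult d0 (pencil_homog _) (pencil_homog _) G1 H1
   (bs := map phi (bl a)) _ _ rE q0.
- by rewrite map_inj_uniq //; apply: fmorph_inj.
- move=> b; apply/idP/idP => [/mapP[b0 b0a ->]|/pencil_zero[c hc]].
    apply/pencil_zero; exists 0 => i; rewrite mul0r sE_pt.
    by move: b0a; rewrite hbl => /forallP/(_ i)/eqP ->; rewrite rmorph0.
  have c0 : c = 0 by apply/eqP/negPn/negP => /(hL aB); apply; apply: hc.
  have [|a' [b0 [_ aa -> hb0]]] := @hbase (omap phi a) b; first by move=> i; rewrite hc c0 mul0r.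
  have -> : a = a' by case: a a' aa {hb0 aB rE hc} => [x|] [y|] //= [] /fmorph_inj ->.
  by apply: map_f; rewrite hbl; apply/forallP => i; rewrite hb0.
exists (fun b => ms (phi b)) => _; split; last by rewrite -h2 big_map.
by move=> b bb; apply: h1; apply: map_f.
Qed.

Lemma line_fiber z n (q : {poly E}) : (forall a, a \in B1 -> z <> omap phi a) ->
  line_chart z (res3 G H) = 'X^n * q -> q.[0] != 0 ->
  exists bs : seq E, [/\ uniq bs, size bs = n &
    forall b, b \in bs <-> exists2 c, c != 0 & in_fib (pt z b) c].
Proof.
move=> zB rE q0; have [bs [ub hb]] := common_roots z.
have fibE b : b \in bs <-> exists2 c, c != 0 & in_fib (pt z b) c.
  rewrite hb pencil_zero; split=> [[c hc]|[c _ hc]]; last by exists c.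
  exists c => //; apply/eqP => c0; have [|a [b0 [aB za _ _]]] := @hbase z b.
    by move=> i; rewrite hc c0 mul0r.
  exact: (zB a).
exists bs; split=> //.
have [ms [h1 <-]] := curve_line_mult d0 (pencil_homog _) (pencil_homog _) G1 H1 ub hb rE q0.
rewrite -sum1_size; apply: eq_big_seq => b bbs.
have /fibE[c nzc hc] := bbs.
exact: hmult_uniq (transversal_fiber nzc hc) (h1 b bbs).
Qed.

Lemma res3_factors : exists c zs, [/\ c != 0, size zs = (d ^ 2)%N,
  res3 G H = c *: \prod_(z <- zs) ell z &
  forall a, a \in B1 -> count_mem (omap phi a) zs = o a].
Proof.
have rh := res3_homog (pencil_homog (xs z6)) (pencil_homog (ys z6)) G1 H1.
have [c [zs [nzc szs rE]]] := binary_factor rh rnz.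
exists c, zs; split=> // a aB; have [q qE q0] := hord aB.
have [q' q'E q0'] := prod_ell_line zs (omap phi a) nzc.
by apply: (order0_uniq (q := q') (q' := q)) => //; rewrite -q'E -qE rE.
Qed.

Lemma fiber_list : exists FL : seq (option E * E), [/\ uniq FL,
  (size FL + \sum_(a <- B1) o a)%N = (d ^ 2)%N &
  forall z b, (z, b) \in FL <-> exists2 c, c != 0 & in_fib (pt z b) c].
Proof.
have [c [zs [nzc szs rE cB]]] := res3_factors.
pose BE := map (omap phi) B1.
have uBE : uniq BE.
  by rewrite map_inj_uniq // => -[x|] [y|] //= [] /fmorph_inj ->.
(* The d^2 roots of the resultant, with multiplicity, split into the base lines, counted [o a] times
   each, and these lines, each counted once per fibre point on it. *)
pose others := undup [seq z <- zs | z \notin BE].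
have oth z : z \in others -> forall a, a \in B1 -> z <> omap phi a.
  rewrite mem_undup mem_filter => /andP[zB _] a aB za; case/negP: zB.
  by rewrite za; apply: map_f.
have hbs z : exists bs : seq E, z \in others -> [/\ uniq bs, size bs = count_mem z zs &
    forall b, b \in bs <-> exists2 c, c != 0 & in_fib (pt z b) c].
  case: (boolP (z \in others)) => [zo|_]; last by exists [::].
  have [q qE q0] := prod_ell_line zs z nzc; rewrite -rE in qE.
  by have [bs hbs] := line_fiber (oth z zo) qE q0; exists bs.
pose F z := proj1_sig (constructive_indefinite_description _ (hbs z)).
have FP z : z \in others -> [/\ uniq (F z), size (F z) = count_mem z zs &
    forall b, b \in F z <-> exists2 c, c != 0 & in_fib (pt z b) c].
  by rewrite /F; case: (constructive_indefinite_description _ _).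
exists [seq (z, b) | z <- others, b <- F z]; split.
- apply: allpairs_uniq_dep => [|z zo|[z b] [z' b'] _ _ []]; first exact: undup_uniq.
    by have [] := FP z zo.
  by move=> -> ->.
- rewrite size_allpairs_dep sumnE big_map.
  have -> : (\sum_(a <- B1) o a = \sum_(z <- BE) count_mem z zs)%N.
    by rewrite big_map; apply: eq_big_seq => a /cB ->.
  rewrite (eq_big_seq (fun z => count_mem z zs)) => [|z /FP[] //].
  rewrite -big_cat /= -szs; apply: sum_count_mem => [|z zz].
    rewrite cat_uniq undup_uniq uBE andbT /=; apply/hasPn => z zB.
    by rewrite mem_undup mem_filter zB.
  by rewrite mem_cat mem_undup mem_filter zz andbT orNb.
- move=> z b; split=> [/allpairsPdep[z' [b' [z'o b'F [-> ->]]]]|[c' nzc' hc]].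
    by have [_ _ h] := FP z' z'o; apply/h.
  have zz : z \in zs.
    have /andP[/eqP gQ /eqP hQ] : (G.@[pt z b] == 0) && (H.@[pt z b] == 0).
      by apply/pencil_zero; exists c'.
    have := res3_vanish d0 (pencil_homog _) (pencil_homog _) G1 H1 gQ hQ.
    by rewrite rE mevalZ => /eqP; rewrite mulf_eq0 (negbTE nzc) prod_ell_eval.
  have zo : z \in others.
    rewrite mem_undup mem_filter zz andbT; apply/mapP => -[a aB za].
    by apply: (hL aB nzc' (b := b)); rewrite -za.
  by apply/allpairsPdep; exists z, b; split=> //; have [_ _ h] := FP z zo; apply/h; exists c'.
Qed.

(** A root off the base lines has positive order, and there the order counts fibre points. This will
    exclude foreign factors from the content. *)
Lemma line_zero_cases z : (res3 G H).@[rep z] = 0 ->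
  (exists2 a, a \in B1 & z = omap phi a) \/
  (exists b, exists2 c, c != 0 & in_fib (pt z b) c).
Proof.
move=> rz; case: (classic (exists2 a, a \in B1 & z = omap phi a)) => [|no]; first by left.
right; have [c [zs [nzc szs rE _]]] := res3_factors.
have zz : z \in zs.
  by move/eqP: rz; rewrite rE mevalZ mulf_eq0 (negbTE nzc) prod_ell_eval.
have [q qE q0] := prod_ell_line zs z nzc; rewrite -rE in qE.
have [|bs [_ sbs hbs]] := line_fiber _ qE q0.
  by move=> a aB za; apply: no; exists a.
case: bs sbs hbs => [|b bs] sbs hbs; last by exists b; apply/hbs; rewrite mem_head.
by move: sbs => /esym/eqP; rewrite /= -leqn0 leqNgt -has_count has_pred1 zz.
Qed.

End FiberCount.

(** * Specialization of the coefficients of a generic pair *)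

Section Specialization.
Variables (K E : closedFieldType) (phi : {rmorphism K -> E}).

Definition spec6 (z6 : 'I_6 -> E) : {mpoly K[6]} -> E := mmap phi z6.
HB.instance Definition _ z6 := GRing.RMorphism.copy (spec6 z6) (spec6 z6).

Lemma spec6E z6 f : spec6 z6 f = (map_mpoly phi f).@[z6].
Proof.
apply: (mpoly_rmorph_ext (f := spec6 z6) (g := meval z6 \o map_mpoly phi)) => [c|i] /=.
  by rewrite /spec6 mmapC map_mpolyC mevalC.
by rewrite /spec6 mmapXU map_mpolyXU mevalXU.
Qed.

Lemma spec6C z6 c : spec6 z6 c%:MP = phi c. Proof. by rewrite /spec6 mmapC. Qed.

Lemma spec6X z6 i : spec6 z6 'X_i = z6 i. Proof. by rewrite /spec6 mmapXU. Qed.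

Lemma map_ell (a : option K) : map_mpoly phi (ell a) = ell (omap phi a).
Proof.
rewrite /ell rmorphB /= -!mul_mpolyC !rmorphM /= !map_mpolyC !map_mpolyXU.
by case: a => [a|] /=; rewrite ?rmorph0 ?rmorph1.
Qed.

Lemma line_poly_map (a : option K) (f : {mpoly K[3]}) b :
  (map_mpoly phi f).@[pt (omap phi a) b] = (map_poly phi (red0 (plane_chart a f))).[b].
Proof.
apply: (mpoly_rmorph_ext (f := meval (pt (omap phi a) b) \o map_mpoly phi)
  (g := horner_eval b \o map_poly phi \o @red0 K \o plane_chart a)) => [c|i] /=.
  by rewrite map_mpolyC mevalC plane_chartC /red0 !map_polyC /= /horner_eval !hornerC.
rewrite map_mpolyXU mevalXU plane_chartX; elim/ord3_ind: i; rewrite /pt /= /red0.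
- rewrite map_polyC /= /horner_eval hornerD hornerZ hornerX hornerC mulr0 addr0.
  by rewrite map_polyC hornerC; case: a => //=; rewrite rmorph1.
- rewrite map_polyC /= /horner_eval hornerD hornerZ hornerX hornerC mulr0 addr0.
  by rewrite map_polyC hornerC; case: a => /= *; rewrite ?rmorph1 ?rmorph0.
- by rewrite !map_polyX /horner_eval hornerX.
Qed.

Variables (d : nat) (s : 'I_3 -> {mpoly K[3]}).
Hypotheses (d0 : (0 < d)%N) (hs : forall i, s i \is d.-homog).

Lemma map_sub_s (N : {mpoly K[3]}) Q :
  (map_mpoly phi (sub_s s N)).@[Q] = (map_mpoly phi N).@[fun i => (map_mpoly phi (s i)).@[Q]].
Proof.
apply: (mpoly_rmorph_ext (f := meval Q \o map_mpoly phi \o @sub_s K s)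
  (g := meval _ \o map_mpoly phi)) => [c|i] /=.
  by rewrite /sub_s mmapC !map_mpolyC !mevalC.
by rewrite /sub_s mmapXU map_mpolyXU mevalXU.
Qed.

(** Scaling [Q] by a d-th root of 1/c makes s(Q) equal to [p] exactly, so the identity N(s) = f A
    can be evaluated although [N] need not be homogeneous. *)
Lemma curve_avoid e (f N A : {mpoly K[3]}) Q c (p : 'I_3 -> E) : f \is e.-homog ->
  sub_s s N = f * A -> c != 0 -> (forall i, (map_mpoly phi (s i)).@[Q] = c * p i) ->
  (map_mpoly phi f).@[Q] = 0 -> (map_mpoly phi N).@[p] = 0.
Proof.
move=> hf NA nzc hc fQ; have [a ad] := closed_root_exists c^-1 d0.
have -> : (map_mpoly phi N).@[p] =
    (map_mpoly phi N).@[fun i => (map_mpoly phi (s i)).@[fun j => a * Q j]].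
  apply: meval_eq => i; rewrite (dhomog_eval _ _ (map_mpoly_homog phi (hs i))) ad hc.
  by rewrite mulKf.
rewrite -map_sub_s NA rmorphM mevalM.
by rewrite (dhomog_eval _ _ (map_mpoly_homog phi hf)) fQ mulr0 mul0r.
Qed.

End Specialization.

Lemma mderiv_homog n (R : comNzRingType) e (f : {mpoly R[n]}) i :
  f \is e.-homog -> f^`M(i) \is e.-1.-homog.
Proof.
move=> /dhomogP hf; apply/dhomogP => m; rewrite mcoeff_msupp mcoeff_deriv => nz.
have /hf /= <- : (m + U_(i))%MM \in msupp f.
  by rewrite mcoeff_msupp; apply: contraNneq nz => ->; rewrite mul0rn.
by rewrite mdegD mdeg1 addn1.
Qed.

Lemma jacobian_homog (K : fieldType) d (s : 'I_3 -> {mpoly K[3]}) :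
  (forall i, s i \is d.-homog) -> jacobian s \is (\sum_(i < 3) d.-1)%N.-homog.
Proof.
move=> hs; rewrite /jacobian /determinant; apply: rpred_sum => t _.
have hp : \prod_(i < 3) (\matrix_(i < 3, j < 3) (s i)^`M(j)) i (t i) \is (\sum_(i < 3) d.-1)%N.-homog.
  by apply: dhomog_bigprod => i; rewrite mxE; apply: mderiv_homog.
by case: (odd_perm t); rewrite ?expr1 ?expr0 ?mulN1r ?mul1r ?dhomogN.
Qed.

Definition line_form (K : comNzRingType) (a : option K) : {mpoly K[3]} :=
  rep1 a *: 'X_ord0 - rep0 a *: 'X_(lift ord0 ord0).

Lemma line_form_homog (K : comNzRingType) (a : option K) : line_form a \is 1.-homog.
Proof. by apply: rpredB; apply: dhomogZ; rewrite dhomogX /= mdeg1. Qed.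

Lemma line_form_neq0 (K : fieldType) (a : option K) : line_form a != 0.
Proof.
pose v : 'I_3 -> K := fun i => match nat_of_ord i with 0%N => dir0 a | 1%N => dir1 a | _ => 0 end.
have : (line_form a).@[v] != 0.
  rewrite /line_form mevalB !mevalZ !mevalXU /v /=.
  by rewrite -opprB oppr_eq0 rep_det oner_neq0.
by apply: contraNneq => ->; rewrite meval0.
Qed.

Lemma line_form_pt (K E : comNzRingType) (phi : {rmorphism K -> E}) (a : option K) b :
  (map_mpoly phi (line_form a)).@[pt (omap phi a) b] = 0.
Proof.
rewrite /line_form rmorphB /= -!mul_mpolyC !rmorphM /= !map_mpolyC !map_mpolyXU.
rewrite mevalB !mevalM !mevalC !mevalXU /pt /=.
by case: a => [a|] /=; rewrite ?rmorph0 ?rmorph1; ring.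
Qed.

Lemma X_order (R : idomainType) (p : {poly R}) : p != 0 ->
  exists o q, p = 'X^o * q /\ q.[0] != 0.
Proof.
move=> nzp; have [o [q]] := multiplicity_XsubC p 0; rewrite nzp /= => q0 pE.
by exists o, q; rewrite pE subr0 mulrC.
Qed.

Section GenericPencil.
Variables (K : closedFieldType) (d : nat) (s : 'I_3 -> {mpoly K[3]}).
Hypotheses (d0 : (0 < d)%N) (hs : forall i, s i \is d.-homog).

Local Notation R6 := {mpoly K[6]}.
Definition gen_pencil (c : 'I_3 -> 'I_6) : {mpoly R6[3]} :=
  \sum_i ('X_(c i) : R6) *: map_mpoly (@mpolyC 6 K) (s i).
Definition cx (i : 'I_3) : 'I_6 := lshift 3 i.
Definition cy (i : 'I_3) : 'I_6 := rshift 3 i.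
Definition gen_res : {mpoly R6[2]} := res3 (gen_pencil cx) (gen_pencil cy).

Lemma gen_pencil_homog c : gen_pencil c \is d.-homog.
Proof. by apply: dhomog_comb => i; apply: map_mpoly_homog. Qed.

Lemma map_gen_pencil (E : closedFieldType) (phi : {rmorphism K -> E}) z6 c :
  map_mpoly (spec6 phi z6) (gen_pencil c) = pencil s phi (z6 \o c).
Proof.
rewrite /gen_pencil rmorph_sum; apply: eq_bigr => i _ /=.
rewrite -mul_mpolyC rmorphM /= map_mpolyC /= spec6X mul_mpolyC; congr (_ *: _).
apply: (mpoly_rmorph_ext (f := map_mpoly (spec6 phi z6) \o map_mpoly (@mpolyC 6 K))
  (g := map_mpoly phi)) => [a|j] /=.
  by rewrite !map_mpolyC /= spec6C.
by rewrite !map_mpolyXU.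
Qed.

Lemma gen_res_map (E : closedFieldType) (phi : {rmorphism K -> E}) z6 :
  (pencil s phi (xs z6)).@[@pole E] != 0 -> (pencil s phi (ys z6)).@[@pole E] != 0 ->
  map_mpoly (spec6 phi z6) gen_res = res3 (pencil s phi (xs z6)) (pencil s phi (ys z6)).
Proof.
move=> G1 H1; rewrite /gen_res (res3_map (d := d)) ?gen_pencil_homog -?pole_map ?map_gen_pencil //.
Qed.

Lemma gen_res_line (E : closedFieldType) (phi : {rmorphism K -> E}) z6 (a : option K) :
  (pencil s phi (xs z6)).@[@pole E] != 0 -> (pencil s phi (ys z6)).@[@pole E] != 0 ->
  line_chart (omap phi a) (res3 (pencil s phi (xs z6)) (pencil s phi (ys z6))) =
  map_poly (spec6 phi z6) (line_chart (omap (@mpolyC 6 K) a) gen_res).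
Proof.
move=> G1 H1; rewrite -gen_res_map // -line_chart_map.
by case: a => [a|] //=; rewrite spec6C.
Qed.

Lemma base_list : (forall i, (s i).@[@pole K] != 0) ->
  exists bl : option K -> seq K, (forall a, uniq (bl a)) /\
  forall a b, (b \in bl a) = [forall i, (s i).@[pt a b] == 0].
Proof.
move=> s1; have h a : exists bs : seq K, uniq bs /\
    forall b, (b \in bs) = [forall i, (s i).@[pt a b] == 0].
  have [bs [ub hb]] := line_roots a (hs ord0) (s1 ord0).
  exists [seq b <- bs | [forall i, (s i).@[pt a b] == 0]]; split; first exact: filter_uniq.
  move=> b; rewrite mem_filter hb; case: (boolP [forall i, _]) => //= /forallP h.
  exact: h.
exists (fun a => proj1_sig (constructive_indefinite_description _ (h a))).
by split=> a; case: (constructive_indefinite_description _ _) => bs [].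
Qed.

(** Over any extension, base points lie on the root lines of one fixed nonzero resultant over K. The
    remaining coordinate is a root of a nonzero polynomial over K, hence lies in K. *)
Lemma base_on_lines (z60 : 'I_6 -> K) (zs0 : seq (option K)) c0 :
  let G0 := \sum_i xs z60 i *: s i in let H0 := \sum_i ys z60 i *: s i in
  (forall i, (s i).@[@pole K] != 0) ->
  G0.@[@pole K] != 0 -> H0.@[@pole K] != 0 -> c0 != 0 ->
  res3 G0 H0 = c0 *: \prod_(z <- zs0) ell z ->
  forall (E : closedFieldType) (phi : {rmorphism K -> E}) z b,
  (forall i, (sE s phi i).@[pt z b] = 0) ->
  exists a b0, [/\ a \in undup zs0, z = omap phi a, b = phi b0 & forall i, (s i).@[pt a b0] = 0].
Proof.
move=> G0 H0 s1 G1 H1 nzc rE E phi z b hb.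
have hG : G0 \is d.-homog by apply: dhomog_comb.
have hH : H0 \is d.-homog by apply: dhomog_comb.
have vanish (c : 'I_3 -> K) : (map_mpoly phi (\sum_i c i *: s i)).@[pt z b] = 0.
  rewrite (rmorph_sum (map_mpoly phi)) (raddf_sum (meval (pt z b))) big1 // => i _ /=.
  by rewrite -mul_mpolyC rmorphM /= mevalM [X in _ * X]hb mulr0.
have pm (f : {mpoly K[3]}) : f.@[@pole K] != 0 -> (map_mpoly phi f).@[@pole E] != 0.
  by rewrite pole_map fmorph_eq0.
have := res3_vanish d0 (map_mpoly_homog phi hG) (map_mpoly_homog phi hH) (pm _ G1) (pm _ H1)
  (vanish (xs z60)) (vanish (ys z60)).
rewrite -(res3_map hG hH) ?fmorph_eq0 // rE -mul_mpolyC rmorphM /= map_mpolyC mevalM mevalC rmorph_prod.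
rewrite (eq_bigr (fun a => ell (omap phi a))) => [|a _]; last exact: map_ell.
rewrite -(big_map (omap phi) xpredT (fun a => ell a)) => /eqP.
rewrite mulf_eq0 fmorph_eq0 (negbTE nzc) /= prod_ell_eval => /mapP[a aS za].
have := hb ord0; rewrite /sE za line_poly_map.
have [lE sz] := plane_chart_lead a (hs ord0) (s1 ord0).
set P := red0 _; have nzP : P != 0.
  by rewrite -size_poly_eq0 const_lead_red0 ?sz //; exists (s ord0).@[@pole K].
have [rs rsE] := closed_field_poly_normal P.
have -> : map_poly phi P = (phi (lead_coef P)) *: \prod_(x <- map phi rs) ('X - x%:P).
  rewrite {1}rsE map_polyZ rmorph_prod big_map; congr (_ *: _).
  by apply: eq_bigr => x _; rewrite /= rmorphB /= map_polyX map_polyC.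
move=> /eqP; rewrite hornerZ mulf_eq0 fmorph_eq0 lead_coef_eq0 (negbTE nzP) /=.
rewrite -[_ == 0]/(root _ b) root_prod_XsubC => /mapP[b0 _ bb].
exists a, b0; split=> // [|i]; first by rewrite mem_undup.
by apply/eqP; rewrite -(fmorph_eq0 phi) -(sE_pt s phi) -za -bb hb.
Qed.

Definition gen_cross (i : 'I_3) : R6 := cross (fun j => 'X_(cx j)) (fun j => 'X_(cy j)) i.
Definition sub_cross : {mpoly K[3]} -> R6 := mmap (@mpolyC 6 K) gen_cross.
HB.instance Definition _ := GRing.RMorphism.copy sub_cross sub_cross.

Lemma sub_cross_spec (E : closedFieldType) (phi : {rmorphism K -> E}) z6 N :
  spec6 phi z6 (sub_cross N) = (map_mpoly phi N).@[cross (xs z6) (ys z6)].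
Proof.
apply: (mpoly_rmorph_ext (f := spec6 phi z6 \o sub_cross)
  (g := meval (cross (xs z6) (ys z6)) \o map_mpoly phi)) => [c|i] /=.
  by rewrite /sub_cross mmapC /= spec6C map_mpolyC mevalC.
rewrite /sub_cross mmapXU map_mpolyXU mevalXU /gen_cross.
by elim/ord3_ind: i; rewrite /cross /= rmorphB !rmorphM /= !spec6X.
Qed.

Lemma map_mpoly_idfun n (R : comNzRingType) (f : {mpoly R[n]}) : map_mpoly (idfun : {rmorphism R -> R}) f = f.
Proof. by apply/mpolyP => m; rewrite mcoeff_map_mpoly. Qed.

Definition join6 (T : Type) (u v : 'I_3 -> T) (i : 'I_6) : T :=
  match split (i : 'I_(3 + 3)) with inl k => u k | inr k => v k end.

Lemma join6_xs (E : closedFieldType) (u v : 'I_3 -> E) : xs (join6 u v) =1 u.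
Proof. by move=> i; rewrite /xs /join6 (_ : split _ = inl i) //; apply: (unsplitK (inl _)). Qed.

Lemma join6_ys (E : closedFieldType) (u v : 'I_3 -> E) : ys (join6 u v) =1 v.
Proof. by move=> i; rewrite /ys /join6 (_ : split _ = inr i) //; apply: (unsplitK (inr _)). Qed.

Lemma eq_cross (T : comNzRingType) (u u' v v' : 'I_3 -> T) : u =1 u' -> v =1 v' ->
  cross u v =1 cross u' v'.
Proof. by move=> hu hv i; rewrite /cross !hu !hv. Qed.

Lemma cross_onto (p : 'I_3 -> K) : p ord0 != 0 -> exists z6 : 'I_6 -> K,
  cross (xs z6) (ys z6) =1 p.
Proof.
move=> p0.
pose u : 'I_3 -> K := fun i => match nat_of_ord i with
  0%N => - p (lift ord0 ord0) / p ord0 | 1%N => 1 | _ => 0 end.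
pose v : 'I_3 -> K := fun i => match nat_of_ord i with
  0%N => - p (lift ord0 (lift ord0 ord0)) | 1%N => 0 | _ => p ord0 end.
exists (join6 u v) => i; rewrite (eq_cross (join6_xs u v) (join6_ys u v)).
elim/ord3_ind: i; rewrite /cross /u /v /=; first by rewrite mul1r mul0r subr0.
  by rewrite mul0r sub0r divfK // opprK.
by rewrite mulr0 mul1r sub0r opprK.
Qed.

Lemma sub_cross_neq0 N : N != 0 -> sub_cross N != 0.
Proof.
move=> nzN; have nzNX : N * 'X_ord0 != 0.
  by rewrite mulf_neq0 // -msize_poly_eq0 msizeX.
have [p] := mpoly_nonroot nzNX; rewrite mevalM mevalXU mulf_eq0 negb_or => /andP[Np p0].
have [z6 zp] := cross_onto p0.
apply: contraNneq Np => N0; have := sub_cross_spec idfun z6 N.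
by rewrite N0 rmorph0 map_mpoly_idfun (meval_eq _ zp) => <-.
Qed.

End GenericPencil.

Lemma neq0_eq (V : nmodType) (a b : V) : a = b -> a != 0 -> b != 0.
Proof. by move=> ->. Qed.

Section RmorphProducts.
Variables (A : comNzRingType) (B : idomainType) (f : {rmorphism A -> B}).

Lemma rmorph_mul3_neq0 a b c : f (a * b * c) != 0 -> [/\ f a != 0, f b != 0 & f c != 0].
Proof. by rewrite !rmorphM !mulf_eq0 !negb_or => /andP[/andP[]]. Qed.

Lemma rmorph_mul4_neq0 a b c e :
  f (a * b * c * e) != 0 -> [/\ f a != 0, f b != 0, f c != 0 & f e != 0].
Proof. by rewrite !rmorphM !mulf_eq0 !negb_or => /andP[/andP[/andP[]]]. Qed.

Lemma rmorph_bigprod_neq0 (I : eqType) (r : seq I) (F : I -> A) :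
  f (\prod_(i <- r) F i) != 0 -> forall i, i \in r -> f (F i) != 0.
Proof. by rewrite rmorph_prod prodf_seq_neq0 => /allP h i /h. Qed.

End RmorphProducts.

Section GoodPencils.
Variables (K : closedFieldType) (d : nat) (s : 'I_3 -> {mpoly K[3]}).
Hypotheses (hK : [pchar K] =i pred0) (d0 : (0 < d)%N) (hs : forall i, s i \is d.-homog)
  (s1 : forall i, (s i).@[@pole K] != 0) (sgcd : gcd_one s) (sdom : dominant s).

(* [B1] lists the lines through (0 : 0 : 1) and the base points, and [o] the orders along them of the
   resultant of two generic members of the net spanned by the s_i. *)
Record good (B1 : seq (option K)) (o : option K -> nat) (E : closedFieldType)
    (phi : {rmorphism K -> E}) (z6 : 'I_6 -> E) : Prop := Good {
  good_x : (pencil s phi (xs z6)).@[@pole E] != 0;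
  good_y : (pencil s phi (ys z6)).@[@pole E] != 0;
  good_p : cross (xs z6) (ys z6) ord0 != 0;
  good_jac : forall Q c, c != 0 -> in_fib s phi z6 Q c ->
    (map_mpoly phi (jacobian s)).@[Q] != 0;
  good_line : forall a b c, a \in B1 -> c != 0 -> ~ in_fib s phi z6 (pt (omap phi a) b) c;
  good_ord : forall a, a \in B1 -> exists2 q : {poly E},
    line_chart (omap phi a) (res3 (pencil s phi (xs z6)) (pencil s phi (ys z6))) = 'X^(o a) * q
    & q.[0] != 0;
  good_res : res3 (pencil s phi (xs z6)) (pencil s phi (ys z6)) != 0 }.

Lemma generic_good : exists (B1 : seq (option K)) (bl : option K -> seq K) (o : option K -> nat)
    (W : {mpoly K[6]}),
  [/\ uniq B1, forall a, uniq (bl a), forall a b, (b \in bl a) = [forall i, (s i).@[pt a b] == 0],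
      W != 0 & (forall (E : closedFieldType) (phi : {rmorphism K -> E}) z b,
        (forall i, (sE s phi i).@[pt z b] = 0) -> exists a b0,
        [/\ a \in B1, z = omap phi a, b = phi b0 & forall i, (s i).@[pt a b0] = 0]) /\
      (forall (E : closedFieldType) (phi : {rmorphism K -> E}) z6,
        (map_mpoly phi W).@[z6] != 0 -> good B1 o phi z6)].
Proof.
have [z60 [G1 H1 r0]] := pencil_res_neq0 hs s1 sgcd.
have hG c : \sum_i c i *: s i \is d.-homog by apply: dhomog_comb.
have [c0 [zs0 [nzc0 _ rE]]] := binary_factor (res3_homog (hG _) (hG _) G1 H1) r0.
have [bl [ubl hbl]] := base_list hs s1.
pose B1 := undup zs0.
have idE (c : 'I_3 -> K) : pencil s idfun c = \sum_i c i *: s i.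
  by apply: eq_bigr => i _; rewrite /sE map_mpoly_idfun.
(* The particular pair [z60] specializes it to the restriction of a nonzero product of linear
   forms. *)
have linenz a : line_chart (omap (@mpolyC 6 K) a) (gen_res s) != 0.
  have := gen_res_line hs (phi := idfun) (z6 := z60) a; rewrite !idE => /(_ G1 H1).
  have -> : omap idfun a = a by case: a.
  apply: contra_eqN => /eqP ->; rewrite rmorph0 rE.
  have [q -> q0] := prod_ell_line zs0 a nzc0.
  by rewrite mulf_neq0 ?expf_neq0 ?polyX_eq0 //; apply: contraNneq q0 => ->; rewrite horner0.
have /(_ _)/constructive_indefinite_description-hO a := X_order (linenz a).
pose o a := proj1_sig (hO a).
have /(_ _)/constructive_indefinite_description-hq a : exists q,
  line_chart (omap (@mpolyC 6 K) a) (gen_res s) = 'X^(o a) * q /\ q.[0] != 0.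
  by rewrite /o; case: (hO a).
(* The lowest coefficient, a polynomial in x and y, of the generic resultant along the line [a].
   Where it is nonzero, the order after specialization is exactly [o a]. *)
pose w a := (proj1_sig (hq a)).[0].
have nzw a : w a != 0 by rewrite /w; case: (hq a) => q /= [].
have nzJ := jacobian_neq0 hK (dominant_independent d0 hs sdom).
have [NJ [AJ [nzNJ NJE]]] := curve_image s nzJ.
have /(_ _)/constructive_indefinite_description-hN a := curve_image s (line_form_neq0 a).
pose N a := proj1_sig (hN a).
have NP a : N a != 0 /\ exists A, sub_s s (N a) = line_form a * A.
  by rewrite /N; case: (hN a) => M /= [A [h1 h2]]; split=> //; exists A.
pose Lx : {mpoly K[6]} := (gen_pencil s cx).@[@pole _].
pose Ly : {mpoly K[6]} := (gen_pencil s cy).@[@pole _].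
have Lspec (E : closedFieldType) (phi : {rmorphism K -> E}) z6 c :
  spec6 phi z6 (gen_pencil s c).@[@pole _] = (pencil s phi (z6 \o c)).@[@pole E].
  by rewrite -pole_map map_gen_pencil.
pose Np := 'X_ord0 * NJ * \prod_(a <- B1) N a.
pose W := Lx * Ly * sub_cross Np * \prod_(a <- None :: B1) w a.
exists B1, bl, o, W; split=> //; first exact: undup_uniq.
  rewrite /W !mulf_neq0 //.
  - apply: contraNneq G1 => L0; have := Lspec K idfun z60 cx; rewrite -/Lx L0 rmorph0 idE.
    by move=> <-.
  - apply: contraNneq H1 => L0; have := Lspec K idfun z60 cy; rewrite -/Ly L0 rmorph0 idE.
    by move=> <-.
  - apply: sub_cross_neq0; rewrite /Np !mulf_neq0 //; first by rewrite -msize_poly_eq0 msizeX.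
    by rewrite prodf_seq_neq0; apply/allP => a _; case: (NP a).
  - by rewrite prodf_seq_neq0; apply/allP => a _; rewrite nzw.
split; first exact: (base_on_lines d0 hs s1 G1 H1 nzc0 rE).
move=> E phi z6; rewrite -spec6E => /rmorph_mul4_neq0[gx gy hNp hw].
have {}gx : (pencil s phi (xs z6)).@[@pole E] != 0 := neq0_eq (Lspec E phi z6 cx) gx.
have {}gy : (pencil s phi (ys z6)).@[@pole E] != 0 := neq0_eq (Lspec E phi z6 cy) gy.
have {}hw := rmorph_bigprod_neq0 hw.
pose ev : {rmorphism {mpoly K[3]} -> E} := meval (cross (xs z6) (ys z6)) \o map_mpoly phi.
have {hNp} [hp hNJ /rmorph_bigprod_neq0 hN1] : [/\ ev 'X_ord0 != 0, ev NJ != 0 & ev (\prod_(a <- B1) N a) != 0].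
  exact: (rmorph_mul3_neq0 (f := ev) (neq0_eq (sub_cross_spec phi z6 Np) hNp)).
have {}hp : cross (xs z6) (ys z6) ord0 != 0.
  by move: hp; rewrite /ev /= map_mpolyXU mevalXU.
have hordE a : a \in None :: B1 -> exists2 q : {poly E},
    line_chart (omap phi a) (res3 (pencil s phi (xs z6)) (pencil s phi (ys z6))) = 'X^(o a) * q
    & q.[0] != 0.
  move=> /hw; rewrite (gen_res_line hs _ gx gy) /w; case: (hq a) => q /= [qE q0] qn.
  exists (map_poly (spec6 phi z6) q); first by rewrite qE rmorphM /= map_polyXn.
  by have := horner_map (spec6 phi z6) q 0; rewrite rmorph0 => ->.
split=> //.
- move=> Q c nzc hc; apply/eqP => J0; case/negP: hNJ; apply/eqP.
  exact: (curve_avoid d0 hs (jacobian_homog hs) NJE nzc hc J0).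
- move=> a b c aB nzc hc; have [_ [A NE]] := NP a; case/negP: (hN1 a aB); apply/eqP.
  exact: (curve_avoid d0 hs (line_form_homog a) NE nzc hc (line_form_pt phi a b)).
- by move=> a aB; apply: hordE; rewrite inE aB orbT.
- have [q qE q0] := hordE None (mem_head _ _); apply: contraNneq q0 => r0'.
  move: qE; rewrite r0' rmorph0 => /esym/eqP; rewrite mulf_eq0 expf_eq0 polyX_eq0 andbF /=.
  by move=> /eqP->; rewrite horner0.
Qed.

End GoodPencils.

(** * The degree and the multiplicity formula *)

Section ConnectingPencil.
Variable R : comNzRingType.
Let o1 : 'I_3 := lift ord0 ord0.
Let o2 : 'I_3 := lift ord0 (lift ord0 ord0).

(* The coefficients, as forms in S, of the two curves J_1^L and J_2^L at a point x. *)
Definition zL (L : 'M[R]_3) (x : 'I_3 -> R) : 'I_6 -> R :=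
  join6 (fun j => x o2 * L ord0 j - x ord0 * L o2 j) (fun j => x o2 * L o1 j - x o1 * L o2 j).

Definition mulmxf (L : 'M[R]_3) (p : 'I_3 -> R) : 'I_3 -> R := fun i => \sum_j L i j * p j.

Lemma join6E (u v : 'I_3 -> R) : (join6 u v \o cx =1 u) * (join6 u v \o cy =1 v).
Proof.
split=> i; rewrite /join6 /=.
  by rewrite (_ : split _ = inl i) //; apply: (unsplitK (inl _)).
by rewrite (_ : split _ = inr i) //; apply: (unsplitK (inr _)).
Qed.

Lemma join6_eq (z : 'I_6 -> R) u v : z \o cx =1 u -> z \o cy =1 v -> z =1 join6 u v.
Proof.
move=> hu hv i; rewrite -(splitK (i : 'I_(3 + 3))) /join6.
case: (split _) => j /=.
  by rewrite (_ : split (lshift 3 j) = inl j) -?hu //; apply: (unsplitK (inl _)).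
by rewrite (_ : split (rshift 3 j) = inr j) -?hv //; apply: (unsplitK (inr _)).
Qed.

Lemma eq_zL L x x' : x =1 x' -> zL L x =1 zL L x'.
Proof. by move=> h i; rewrite /zL /join6 !h. Qed.

Lemma zL_scale a L x : zL (a *: L) x =1 zL L (fun i => a * x i).
Proof.
by move=> i; rewrite /zL /join6; case: (split _) => j; rewrite !mxE; ring.
Qed.

Lemma det3E (L : 'M[R]_3) : \det L = dot (L ord0) (cross (L o1) (L o2)).
Proof.
rewrite (expand_det_row _ ord0) dotE !big_ord_recl big_ord0 addr0 /cofactor.
rewrite !(expand_det_row _ ord0) !big_ord_recl !big_ord0 /cofactor !det_mx11 !mxE /=.
have -> : lift (lift ord0 ord0) 0 = ord0 :> 'I_2 by apply: val_inj.
have -> : lift (lift ord0 ord0) ord0 = ord0 :> 'I_3 by apply: val_inj.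
have -> : lift (lift ord0 ord0) (lift ord0 ord0) = lift ord0 (lift ord0 ord0) :> 'I_3 by apply: val_inj.
have -> : lift (lift ord0 (lift ord0 ord0)) ord0 = ord0 :> 'I_3 by apply: val_inj.
have -> : lift (lift ord0 (lift ord0 ord0)) (lift ord0 ord0) = lift ord0 ord0 :> 'I_3 by apply: val_inj.
by rewrite /cross /bump /= !addn0; ring.
Qed.

(** Both coefficient vectors are orthogonal to p when x = L p, so their cross product is a multiple
    of p; the factor is x_3 det L. *)
Lemma zL_cross (L : 'M[R]_3) p :
  let z := zL L (mulmxf L p) in
  cross (z \o cx) (z \o cy) =1 fun i => mulmxf L p o2 * \det L * p i.
Proof.
move=> z i; rewrite /z /zL det3E.
rewrite (_ : cross _ _ i = cross (fun j => mulmxf L p o2 * L ord0 j - mulmxf L p ord0 * L o2 j)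
   (fun j => mulmxf L p o2 * L o1 j - mulmxf L p o1 * L o2 j) i); last first.
  by rewrite /cross !(fun u v j => (join6E u v).1 j) !(fun u v j => (join6E u v).2 j).
rewrite /mulmxf !big_ord_recl !big_ord0 !addr0 dotE.
by elim/ord3_ind: i; rewrite /cross /=; ring.
Qed.

End ConnectingPencil.

Lemma rmorph_zL (R S : comNzRingType) (h : {rmorphism R -> S}) L x i :
  h (zL L x i) = zL (map_mx h L) (h \o x) i.
Proof. by rewrite /zL /join6; case: (split _) => j; rewrite rmorphB !rmorphM /= !mxE. Qed.

Section FiberCardinality.
Variables (K : closedFieldType) (d : nat) (s : 'I_3 -> {mpoly K[3]}).
Hypotheses (d0 : (0 < d)%N) (hs : forall i, s i \is d.-homog)
  (s1 : forall i, (s i).@[@pole K] != 0).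
Variables (B1 : seq (option K)) (bl : option K -> seq K) (o : option K -> nat) (W : {mpoly K[6]}).
Hypotheses (uB1 : uniq B1) (ubl : forall a, uniq (bl a))
  (hbl : forall a b, (b \in bl a) = [forall i, (s i).@[pt a b] == 0]) (nzW : W != 0)
  (hbase : forall (E : closedFieldType) (phi : {rmorphism K -> E}) z b,
     (forall i, (sE s phi i).@[pt z b] = 0) -> exists a b0,
     [/\ a \in B1, z = omap phi a, b = phi b0 & forall i, (s i).@[pt a b0] = 0])
  (hW : forall (E : closedFieldType) (phi : {rmorphism K -> E}) z6,
        (map_mpoly phi W).@[z6] != 0 -> good s B1 o phi z6).
Let n := (d ^ 2 - \sum_(a <- B1) o a)%N.

Lemma good_fiber_list (E : closedFieldType) (phi : {rmorphism K -> E}) z6 : good s B1 o phi z6 ->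
  exists FL : seq (option E * E), [/\ uniq FL,
  (size FL + \sum_(a <- B1) o a)%N = (d ^ 2)%N &
  forall z b, (z, b) \in FL <-> exists2 c, c != 0 & in_fib s phi z6 (pt z b) c].
Proof.
case=> G1 H1 p0 hJ hL hord rnz.
exact: (fiber_list d0 hs uB1 G1 H1 p0 hJ hL (@hbase E phi) hord rnz).
Qed.

Lemma sE_idfun i : sE s idfun i = s i.
Proof. exact: map_mpoly_idfun. Qed.

Lemma off_vertical t : nonzero3 t -> (exists f : {mpoly K[3]}, [/\ f \is d.-homog, f.@[@pole K] != 0 & f.@[t] = 0]) ->
  exists z b, prop_eq t (pt z b).
Proof.
move=> nzt [f [hf f1 ft]]; apply: pt_normal.
case: (eqVneq (t ord0) 0) => [t0|]; last by exists ord0.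
case: (eqVneq (t (lift ord0 ord0)) 0) => [t1|]; last by exists (lift ord0 ord0).
have fE : f.@[t] = t (lift ord0 (lift ord0 ord0)) ^+ d * f.@[@pole K].
  rewrite -(dhomog_eval _ _ hf); apply: meval_eq; elim/ord3_ind;
  by rewrite /pole /= ?mulr0 ?mulr1.
move/eqP: ft; rewrite fE mulf_eq0 (negbTE f1) orbF expf_eq0 d0 /= => /eqP t2.
by case: nzt => i; elim/ord3_ind: i; rewrite ?t0 ?t1 ?t2 eqxx.
Qed.

Lemma good_fiber_card z6 e p : e != 0 -> cross (xs z6) (ys z6) =1 (fun i => e * p i) ->
  good s B1 o idfun z6 -> fiber_card s p n.
Proof.
move=> nze pE gd; have [FL [uFL szFL hFL]] := good_fiber_list gd.
have szn : size FL = n by rewrite /n -szFL addnK.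
have [G1 _ p0 _ _ _ _] := gd.
have nzp0 : p ord0 != 0 by move: p0; rewrite pE mulf_eq0 negb_or => /andP[].
have fibE t : in_fiber s p t <-> nonzero3 t /\ exists2 c, c != 0 & in_fib s idfun z6 t c.
  split=> [[nzt [nb [c [nzc hc]]]]|[nzt [c nzc hc]]].
    split=> //; exists (c / e); first by rewrite mulf_neq0 ?invr_eq0.
    by move=> i; rewrite sE_idfun pE mulrA divfK //; apply: hc.
  split=> //; split; last first.
    by exists (c * e); split=> [|i]; [rewrite mulf_neq0|have := hc i; rewrite sE_idfun pE mulrA].
  case=> _ /(_ ord0) s0; have := hc ord0; rewrite sE_idfun s0 => /esym/eqP.
  by rewrite mulf_eq0 (negbTE nzc) (negbTE p0).
exists (fun k : 'I_n => let x := nth (None, 0) FL k in pt x.1 x.2); split; [|split].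
- move=> k; have : nth (None, 0) FL k \in FL by apply: mem_nth; rewrite szn.
  case: (nth _ _ _) => z b /hFL hc; apply/fibE; split=> //; exact: pt_nonzero.
- move=> k l /pt_inj; case e1: (nth _ _ k) => [z b]; case e2: (nth _ _ l) => [z' b'] /= [zz bb].
  by apply/val_inj/eqP; rewrite /= -(nth_uniq (None, 0) _ _ uFL) ?szn // e1 e2 zz bb.
- move=> t /fibE[nzt [c nzc hc]].
  have [|z [b tz]] := off_vertical nzt.
    exists (pencil s idfun (xs z6)); split=> //; first exact: pencil_homog.
    by have /andP[/eqP] := (pencil_zero s idfun p0 t).2 (ex_intro _ c hc).
  have zb : (z, b) \in FL.
    apply/hFL; have [c' [nzc' h']] := prop_eq_sym tz.
    exists (c' ^+ d * c); first by rewrite mulf_neq0 ?expf_neq0.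
    by move=> i; rewrite (meval_eq _ h') (dhomog_eval _ _ (sE_homog hs _ i)) hc mulrA.
  have kn : (index (z, b) FL < n)%N by rewrite -szn index_mem.
  by exists (Ordinal kn); rewrite /= nth_index.
Qed.

Definition conn_poly (L : 'M[K]_3) : {mpoly K[3]} :=
  mmap (@mpolyC 3 K) (zL (map_mx (@mpolyC 3 K) L) (fun i => 'X_i)) W.

Lemma conn_polyE L x : (conn_poly L).@[x] = W.@[zL L x].
Proof.
apply: (mpoly_rmorph_ext (f := meval x \o mmap (@mpolyC 3 K) _) (g := meval (zL L x))) => [c|i] /=.
  by rewrite mmapC !mevalC.
rewrite mmapXU mevalXU (rmorph_zL (meval x)) -map_mx_comp (eq_zL _ (x' := x)) => [|j /=]; last exact: mevalXU.
by congr (zL _ _ _); apply/matrixP => a b; rewrite mxE /= mevalC.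
Qed.

Lemma conn_exists : exists L p, L \in unitmx /\ W.@[zL L (mulmxf L p)] != 0.
Proof.
have [z6 nz] := mpoly_nonroot nzW.
have gd : good s B1 o idfun z6 by apply: hW; rewrite map_mpoly_idfun.
have p0 := good_p gd.
(* The first two rows are a good pair (x, y), and the last makes the determinant p_0 != 0. At the
   point (0, 0, 1), reached from the vector [q], the connecting pencil is this pair. *)
pose L : 'M[K]_3 := \matrix_(i, j) match nat_of_ord i with
  0%N => xs z6 j | 1%N => ys z6 j | _ => (j == ord0)%:R end.
have detL : \det L = cross (xs z6) (ys z6) ord0.
  by rewrite det3E dotE /cross !mxE /=; ring.
have uL : L \in unitmx by rewrite unitmxE detL unitfE.
pose q := invmx L *m (\col_i (if i == lift ord0 (lift ord0 ord0) then 1 else 0)).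
exists L, (fun j => q j 0); split=> //.
have Lq i : mulmxf L (fun j => q j 0) i = if i == lift ord0 (lift ord0 ord0) then 1 else 0.
  transitivity ((L *m q) i 0); first by rewrite mxE.
  by rewrite mulKVmx // mxE.
apply: contraNneq nz => <-; apply/eqP/meval_eq; apply: join6_eq => j.
  by rewrite !Lq !mxE /=; rewrite mul1r mul0r subr0.
by rewrite !Lq !mxE /=; rewrite mul1r mul0r subr0.
Qed.

Lemma good_degMap : is_degMap s n.
Proof.
have [L [p1 [uL nz1]]] := conn_exists.
have dL : \det L != 0 by rewrite -unitfE -unitmxE.
pose Lv : 'I_3 -> {mpoly K[3]} := mulmxf (map_mx (@mpolyC 3 K) L) (fun i => 'X_i).
pose N := mmap (@mpolyC 3 K) Lv (conn_poly L).
have NE p : N.@[p] = W.@[zL L (mulmxf L p)].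
  rewrite -conn_polyE /N.
  apply: (mpoly_rmorph_ext (f := meval p \o mmap (@mpolyC 3 K) _) (g := meval (mulmxf L p))) => [c|i] /=.
    by rewrite mmapC !mevalC.
  rewrite mmapXU mevalXU /Lv /mulmxf (raddf_sum (meval p)); apply: eq_bigr => j _ /=.
  by rewrite mevalM mevalXU mxE mevalC.
(* [N] need not be homogeneous, whereas open sets are cut out by forms, so its components are used.
   Where one of them is nonzero, [N] is nonzero at some multiple of the point, by [key]. *)
exists (fun p => nonzero3 p /\ exists f, (exists k, f = pihomog mdeg k N) /\ f.@[p] != 0).
have key p : (exists f, (exists k, f = pihomog mdeg k N) /\ f.@[p] != 0) -> exists a, N.@[fun i => a * p i] != 0.
  case=> f [[k ->] nz]; apply: NNPP => no; case/negP: nz; apply/eqP.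
  apply: homog_components_line => a; apply/eqP/negPn/negP => nza; apply: no; by exists a.
have gd p : N.@[p] != 0 -> good s B1 o idfun (zL L (mulmxf L p)).
  by rewrite NE => nz; apply: hW; rewrite map_mpoly_idfun.
split; [|split].
- exists (fun f => exists k, f = pihomog mdeg k N); split=> [f [k ->]|//].
  by exists k; apply: pihomogP.
- exists p1; have Np : N.@[p1] != 0 by rewrite NE.
  split.
    have := good_p (gd _ Np); rewrite (zL_cross L p1 ord0) => h; exists ord0.
    by apply: contraNneq h => ->; rewrite mulr0.
  apply: NNPP => no; case/negP: Np; rewrite (pihomog_sum_id 0 N) (raddf_sum (meval p1)) big1 // => k _.
  by apply/eqP/negPn/negP => nk; apply: no; eexists; split; [exists k|exact: nk].
- move=> p [nzp /key[a nza]] _.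
  have g := gd _ nza; have pE := zL_cross L (fun i => a * p i).
  have := good_p g; rewrite (pE ord0) mulrA => h.
  apply: (good_fiber_card (e := mulmxf L (fun i => a * p i) (lift ord0 (lift ord0 ord0)) * \det L * a)) g.
    by apply: contraNneq h => ->; rewrite mul0r.
  by move=> i; rewrite -(mulrA _ a); apply: pE.
Qed.

Lemma good_mult_base (F : closedFieldType) (phi : {rmorphism K -> F}) z :
  good s B1 o phi z -> exists m, mult_base phi z s m /\ m%:Z = (d ^ 2)%N%:Z - n%:Z.
Proof.
move=> gd; have [FL [_ szFL _]] := good_fiber_list gd.
have [G1 H1 p0 hJ hL hord rnz] := gd.
have [ms hms] := base_mults d0 hs ubl hbl G1 H1 p0 hL (@hbase F phi) hord.
exists (\sum_(a <- B1) o a)%N; split; last by rewrite /n -szFL addnK PoszD addrAC subrr add0r.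
pose BL := [seq (a, b) | a <- B1, b <- bl a].
have inBL x : x \in BL -> x.1 \in B1 /\ x.2 \in bl x.1.
  by move=> /allpairsPdep[a [b [aB bb ->]]].
have uBL : uniq BL.
  by apply: allpairs_uniq_dep => // -[x y] [x' y'] _ _ [-> ->].
pose P (k : 'I_(size BL)) := nth (None, 0) BL k.
have PB k : P k \in BL by apply: mem_nth.
have bpt a b : (b \in bl a) -> base_pt s (pt a b).
  by rewrite hbl => /forallP h; split=> [|i]; [apply: pt_nonzero | apply/eqP].
exists (size BL), (fun k => pt (P k).1 (P k).2), (fun k => ms (P k).1 (P k).2); split; [|split; [|split; [|split]]].
- by move=> k; apply: bpt; have [] := inBL _ (PB k).
- move=> k l /pt_inj; rewrite /P.
  case e1: (nth _ _ k) => [x b]; case e2: (nth _ _ l) => [x' b'] /= [zz bb].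
  by apply/val_inj/eqP; rewrite /= -(nth_uniq (None, 0) _ _ uBL) // e1 e2 zz bb.
- move=> t [nzt ht]; have [|x [b tx]] := off_vertical nzt.
    by exists (s ord0); split.
  have [|a [b0 [aB xa bb hb0]]] := @hbase K idfun x b.
    move=> i; rewrite sE_idfun; have [c [_ h']] := prop_eq_sym tx.
    by rewrite (meval_eq _ h') (dhomog_eval _ _ (hs i)) ht mulr0.
  have ab : (a, b0) \in BL.
    apply/allpairsPdep; exists a, b0; split=> //; rewrite hbl; apply/forallP => i; exact/eqP.
  have kn : (index (a, b0) BL < size BL)%N by rewrite index_mem.
  exists (Ordinal kn); rewrite /P /= nth_index //=; move: tx; rewrite xa bb.
  by case: (a).
- move=> k; have [aB bb] := inBL _ (PB k).
  have [hm _] := hms _ aB.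
  apply: (dehom_multP (pencil_homog hs phi (xs z)) (pencil_homog hs phi (ys z))).
    case: (pt_nonzero (P k).1 (P k).2) => i nz; exists i; by rewrite fmorph_eq0.
  have -> : (fun i => phi (pt (P k).1 (P k).2 i)) = pt (omap phi (P k).1) (phi (P k).2).
    by apply: functional_extensionality => i; rewrite map_pt.
  exact: hm.
- rewrite (eq_big_seq (fun a => \sum_(b <- bl a) ms a b)%N) => [|a /hms[] //].
  rewrite -(big_allpairs_dep (h := pair) (F := fun x => ms x.1 x.2)) -/BL.
  by rewrite (big_nth (None, 0)) big_mkord.
Qed.

End FiberCardinality.

(** * The content of the resultant *)

Section BinaryFormDivisors.
Variable E : closedFieldType.

Lemma count_le_cat (T : eqType) (s t : seq T) :
  (forall x, count_mem x s <= count_mem x t)%N -> exists u, perm_eq t (s ++ u).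
Proof.
elim: s t => [|x s IH] t h; first by exists t.
have xt : x \in t by rewrite -has_pred1 has_count; apply: leq_trans (h x); rewrite /= eqxx.
have /seq.permP tp := perm_to_rem xt.
have [|u hu] := IH (rem x t).
  by move=> y; have := h y; rewrite tp /= leq_add2l.
by exists u; apply: perm_trans (perm_to_rem xt) _; rewrite perm_cons.
Qed.

Lemma dvd_prod_ell (c : E) zs D r : c != 0 -> D * r = c *: \prod_(z <- zs) ell z ->
  exists c' zs1 zs2, [/\ c' != 0, D = c' *: \prod_(z <- zs1) ell z & perm_eq zs (zs1 ++ zs2)].
Proof.
move=> nzc; elim: zs D r => [|z zs IH] D r.
  rewrite big_nil => Dr; have nzDr : D * r != 0 by rewrite Dr scaler_eq0 negb_or nzc oner_neq0.
  move: (nzDr); rewrite mulf_eq0 negb_or => /andP[nzD nzr].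
  have : msize (D * r) = 1%N by rewrite Dr -mul_mpolyC mulr1 msizeC nzc.
  rewrite msizeM // (mpolySpred _ nzD) (mpolySpred _ nzr) addnS /= => -[/eqP].
  rewrite addn_eq0 => /andP[/eqP D0 _].
  have /msize_poly1P[c' nzc' ->] : msize D == 1%N by rewrite (mpolySpred _ nzD) D0.
  by exists c', [::], [::]; rewrite big_nil -mul_mpolyC mulr1.
rewrite big_cons scalerAr => Dr; have [[q DE]|[q rE]] := ell_prime Dr.
  have [|c' [zs1 [zs2 [nzc' qE pq]]]] := IH q r.
    by apply: (mulfI (ell_neq0 z)); rewrite mulrA -DE.
  exists c', (z :: zs1), zs2; rewrite big_cons scalerAr -qE; split=> //.
  by rewrite /= perm_cons.
have [|c' [zs1 [zs2 [nzc' qE pq]]]] := IH D q.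
  by apply: (mulfI (ell_neq0 z)); rewrite mulrCA -rE.
exists c', zs1, (z :: zs2); split=> //.
by rewrite perm_sym -(cat1s z zs2) perm_catCA /= perm_cons perm_sym.
Qed.

Definition multi (B : seq (option E)) (o : option E -> nat) := flatten [seq nseq (o a) a | a <- B].

Lemma size_multi B o : size (multi B o) = (\sum_(a <- B) o a)%N.
Proof.
by rewrite size_flatten sumnE /shape -map_comp big_map; apply: eq_bigr => a _ /=; rewrite size_nseq.
Qed.

Lemma count_multi B o a : uniq B -> count_mem a (multi B o) = if a \in B then o a else 0%N.
Proof.
rewrite /multi; elim: B => [|b B IH] //= /andP[bB uB].
rewrite count_cat count_nseq IH //=.
rewrite in_cons [a == b]eq_sym; have [<-|] := eqVneq b a; last by rewrite mul0n.
by rewrite (negbTE bB) mul1n addn0.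
Qed.

Lemma form_dvd n (r : {mpoly E[2]}) B o : uniq B -> r \is n.-homog ->
  (forall a k, a \in B -> (k < o a)%N -> (line_chart a r)`_k = 0) ->
  exists q, r = (\prod_(z <- multi B o) ell z) * q.
Proof.
move=> uB hr hk; have [->|nzr] := eqVneq r 0; first by exists 0; rewrite mulr0.
have [c [zs [nzc _ rE]]] := binary_factor hr nzr.
have [|u hu] := @count_le_cat _ (multi B o) zs.
  move=> a; rewrite count_multi //; case: ifP => // aB.
  have [q qE q0] := prod_ell_line zs a nzc; rewrite leqNgt; apply/negP => lt.
  have := hk a _ aB lt; rewrite rE qE coefXnM ltnn subnn -horner_coef0 => /eqP.
  exact/negP.
exists (c *: \prod_(z <- u) ell z).
by rewrite rE (perm_big _ hu) /= big_cat -scalerAr.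
Qed.

Lemma dhomog_msizeE n (r : {mpoly E[n]}) k : r \is k.-homog -> r != 0 -> msize r = k.+1.
Proof.
move=> /dhomogP hr nzr; apply/eqP; rewrite eqn_leq; apply/andP; split.
  by rewrite msizeE; apply/bigmax_leqP_seq => m mr _; rewrite (hr m mr).
have : msupp r != [::] by rewrite msupp_eq0.
case e: (msupp r) => [//|m l] _; have mr : m \in msupp r by rewrite e mem_head.
by rewrite -(hr m mr) /=; apply: msize_mdeg_lt.
Qed.

End BinaryFormDivisors.

Lemma rmorph_comb (R S : pzRingType) (h : {rmorphism R -> S}) a b p q a' b' p' q' :
  h a = a' -> h b = b' -> h p = p' -> h q = q' -> h (a * p - b * q) = a' * p' - b' * q'.
Proof. by move=> <- <- <- <-; rewrite rmorphB !rmorphM. Qed.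

Section SpecializedResultant.
Variables (K : closedFieldType) (d : nat) (s : 'I_3 -> {mpoly K[3]}).
Hypothesis hs : forall i, s i \is d.-homog.
Local Notation A := {mpoly {mpoly K[2]}[3]}.

Definition eps (x : 'I_3 -> K) : A -> {mpoly K[2]} := meval (fun i => (x i)%:MP).
HB.instance Definition _ x := GRing.RMorphism.copy (eps x) (eps x).

Lemma embT_toT f : embT f = map_poly (@mpolyC 3 {mpoly K[2]}) (toT f).
Proof.
apply: (mpoly_rmorph_ext (f := mmap (polyC \o @mpolyC 3 {mpoly K[2]} \o @mpolyC 2 K) (@tvar K))
  (g := map_poly (@mpolyC 3 {mpoly K[2]}) \o @toT K)) => [c|i] /=.
  by rewrite mmapC /= toTC map_polyC.
rewrite mmapXU toTXU /tvar; elim/ord3_ind: i => /=; by rewrite ?map_polyX ?map_polyC.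
Qed.

Lemma size_toT_le (f : {mpoly K[3]}) : f \is d.-homog -> (size (toT f) <= d.+1)%N.
Proof.
move=> hf; apply/leq_sizeP => j dj.
by have := toT_graded hf j; rewrite leqNgt dj.
Qed.

Lemma map_eps_embT x (f : {mpoly K[3]}) : map_poly (eps x) (embT f) = toT f.
Proof.
by rewrite embT_toT -map_poly_comp map_poly_id // => c _ /=; rewrite /eps mevalC.
Qed.

Lemma map_eps_Lsum x L k : map_poly (eps x) (Lsum s L k) = toT (\sum_j L k j *: s j).
Proof.
rewrite /Lsum (rmorph_sum (map_poly (eps x))) (rmorph_sum (@toT K)); apply: eq_bigr => j _ /=.
rewrite rmorphM /= map_eps_embT -mul_mpolyC rmorphM /= toTC; congr (_ * _).
by rewrite map_polyC /= /eps mevalC.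
Qed.

Lemma size_Lsum L k : (size (Lsum s L k) <= d.+1)%N.
Proof.
apply: leq_trans (size_sum _ _ _) _; apply/bigmax_leqP => j _; rewrite /cst mul_polyC.
apply: leq_trans (size_scale_leq _ _) _; rewrite embT_toT.
exact: leq_trans (size_poly _ _) (size_toT_le (hs j)).
Qed.

Let o1 : 'I_3 := lift ord0 ord0.
Let o2 : 'I_3 := lift ord0 (lift ord0 ord0).

Lemma toTZ (a : K) (f : {mpoly K[3]}) : toT (a *: f) = a%:MP%:P * toT f.
Proof. by rewrite -mul_mpolyC rmorphM /= toTC. Qed.

Lemma toT_comb (a b : K) (f g : {mpoly K[3]}) :
  toT (a *: f - b *: g) = a%:MP%:P * toT f - b%:MP%:P * toT g.
Proof. by apply: etrans (rmorphB _ _ _) _; congr (_ - _); apply: toTZ. Qed.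

Lemma map_eps_xvar x i : map_poly (eps x) (xvar K i) = (x i)%:MP%:P.
Proof. by rewrite /xvar map_polyC /= /eps mevalXU. Qed.

Lemma inord3 : ((inord 0 : 'I_3) = ord0) * ((inord 1 : 'I_3) = o1) * ((inord 2 : 'I_3) = o2).
Proof. by do ![split]; apply: val_inj; rewrite /= inordK. Qed.

Lemma pencil_diff (a b : K) (L : 'M[K]_3) i j u : u =1 (fun k => a * L i k - b * L j k) ->
  a *: (\sum_k L i k *: s k) - b *: (\sum_k L j k *: s k) = pencil s idfun u.
Proof.
move=> hu; rewrite /pencil !scaler_sumr -sumrB; apply: eq_bigr => k _.
by rewrite /sE map_mpoly_idfun hu scalerBl !scalerA.
Qed.

Lemma map_eps_J1 x L : map_poly (eps x) (J1 s L) = toT (pencil s idfun (xs (zL L x))).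
Proof.
rewrite -(pencil_diff (a := x o2) (b := x ord0) (i := ord0) (j := o2) (L := L)); last exact: join6_xs.
rewrite /J1 !inord3 toT_comb; apply: rmorph_comb;
  by [apply: map_eps_xvar | apply: map_eps_Lsum].
Qed.

Lemma map_eps_J2 x L : map_poly (eps x) (J2 s L) = toT (pencil s idfun (ys (zL L x))).
Proof.
rewrite -(pencil_diff (a := x o2) (b := x o1) (i := o1) (j := o2) (L := L)); last exact: join6_ys.
rewrite /J2 !inord3 toT_comb; apply: rmorph_comb;
  by [apply: map_eps_xvar | apply: map_eps_Lsum].
Qed.

Lemma size_comb_le (R : nzRingType) (a b : R) (f g : {poly R}) n :
  (size f <= n)%N -> (size g <= n)%N -> (size (a%:P * f - b%:P * g)%R <= n)%N.
Proof.
move=> hf hg; rewrite !mul_polyC; apply: leq_trans (size_polyD _ _) _.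
by rewrite size_polyN geq_max !(leq_trans (size_scale_leq _ _)).
Qed.

Lemma map_lead_neq0 (R S : nzRingType) (h : {rmorphism R -> S}) (p : {poly R}) n :
  (size p <= n.+1)%N -> size (map_poly h p) = n.+1 -> h (lead_coef p) != 0.
Proof.
move=> hp hm; have sp : size p = n.+1.
  by apply/eqP; rewrite eqn_leq hp -hm size_poly.
by rewrite lead_coefE sp /= -coef_map -[n]/(n.+1.-1) -hm -lead_coefE lead_coef_eq0 -size_poly_eq0 hm.
Qed.

Lemma size_J1 L : (size (J1 s L) <= d.+1)%N.
Proof. by rewrite /J1 /xvar; apply: size_comb_le; apply: size_Lsum. Qed.

Lemma size_J2 L : (size (J2 s L) <= d.+1)%N.
Proof. by rewrite /J2 /xvar; apply: size_comb_le; apply: size_Lsum. Qed.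

(** The specialized polynomials have full degree d in t3, so the leading coefficients of [J1] and
    [J2] survive and the resultant commutes with evaluation at x. *)
Lemma eps_ResJ x L : (pencil s idfun (xs (zL L x))).@[@pole K] != 0 ->
  (pencil s idfun (ys (zL L x))).@[@pole K] != 0 ->
  eps x (ResJ s L) = res3 (pencil s idfun (xs (zL L x))) (pencil s idfun (ys (zL L x))).
Proof.
move=> G1 H1.
have h1 : eps x (lead_coef (J1 s L)) != 0.
  apply: (map_lead_neq0 (h := eps x) (n := d)); first exact: size_J1.
  apply: etrans (congr1 (fun p : {poly {mpoly K[2]}} => size p) (map_eps_J1 x L)) _.
  by apply: size_toT => //; apply: pencil_homog.
have h2 : eps x (lead_coef (J2 s L)) != 0.
  apply: (map_lead_neq0 (h := eps x) (n := d)); first exact: size_J2.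
  apply: etrans (congr1 (fun p : {poly {mpoly K[2]}} => size p) (map_eps_J2 x L)) _.
  by apply: size_toT => //; apply: pencil_homog.
apply: etrans (map_resultant_ring (f := eps x) h1 h2) _.
exact: (f_equal2 (fun p q : {poly {mpoly K[2]}} => resultant p q) (map_eps_J1 x L) (map_eps_J2 x L)).
Qed.

Lemma eps_sum x (R : A) : eps x R = \sum_(m <- msupp R) (\prod_i x i ^+ m i) *: R@_m.
Proof.
rewrite /eps mevalE; apply: eq_bigr => m _; rewrite -mul_mpolyC rmorph_prod mulrC; congr (_ * _).
by apply: eq_bigr => i _; rewrite rmorphXn.
Qed.

(** Applying the linear functional [lam] to the coefficients of [R] gives a polynomial in x; it
    vanishes wherever [V] does not, hence is zero. Properties at general x thus pass to each
    coefficient. *)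
Lemma coef_test (R : A) (V : {mpoly K[3]}) (lam : {mpoly K[2]} -> K) : V != 0 ->
  (forall f g, lam (f + g) = lam f + lam g) -> (forall c f, lam (c *: f) = c * lam f) ->
  (forall x, V.@[x] != 0 -> lam (eps x R) = 0) -> forall m, lam R@_m = 0.
Proof.
move=> nzV lD lZ h m; have l0 : lam 0 = 0 by rewrite -(scale0r 0) lZ mul0r.
case: (boolP (m \in msupp R)) => [mR|/memN_msupp_eq0 -> //].
pose P : {mpoly K[3]} := \sum_(m <- msupp R) lam R@_m *: 'X_[m].
have PE x : P.@[x] = lam (eps x R).
  rewrite eps_sum (big_morph lam lD l0) (raddf_sum (meval x)); apply: eq_bigr => k _ /=.
  by rewrite mevalZ mevalX lZ mulrC.
have P0 : P = 0.
  apply/eqP/negPn/negP => nzP; have [x] := mpoly_nonroot (mulf_neq0 nzP nzV).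
  rewrite mevalM mulf_eq0 negb_or PE => /andP[nl /h l00]; by rewrite l00 eqxx in nl.
have : P@_m = 0 by rewrite P0 mcoeff0.
rewrite /P (raddf_sum (mcoeff m)) (bigD1_seq m) //= mcoeffZ mcoeffX eqxx mulr1.
rewrite big1 ?addr0 // => k km; by rewrite mcoeffZ mcoeffX (negbTE km) mulr0.
Qed.

End SpecializedResultant.

Lemma msize_cofactor n (R : idomainType) (C P : {mpoly R[n]}) a b :
  C * P != 0 -> msize (C * P) = (a + b).+1 -> msize C = a.+1 -> msize P = b.+1.
Proof.
rewrite mulf_eq0 negb_or => /andP[nzC nzP]; rewrite msizeM // => h ca.
by move: h; rewrite ca addSn /= => /eqP; rewrite -addnS eqn_add2l => /eqP.
Qed.

Lemma msize_mutual_dvd n (R : idomainType) (C C' r r' : {mpoly R[n]}) :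
  C != 0 -> C = C' * r -> C' = C * r' -> msize C' = msize C.
Proof.
move=> nzC CE CE'; have nzC' : C' != 0 by apply: contraNneq nzC => C0; rewrite CE C0 mul0r.
have nzr : r != 0 by apply: contraNneq nzC => C0; rewrite CE C0 mulr0.
have nzr' : r' != 0 by apply: contraNneq nzC' => C0; rewrite CE' C0 mulr0.
apply/eqP; rewrite eqn_leq; apply/andP; split; [rewrite CE | rewrite CE']; rewrite msizeM //.
  by rewrite (mpolySpred _ nzr) addnS leq_addr.
by rewrite (mpolySpred _ nzr') addnS leq_addr.
Qed.

Section Content.
Variables (K : closedFieldType) (d : nat) (s : 'I_3 -> {mpoly K[3]}).
Hypotheses (d0 : (0 < d)%N) (hs : forall i, s i \is d.-homog).
Variables (B1 : seq (option K)) (o : option K -> nat) (W : {mpoly K[6]}).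
Hypotheses (uB1 : uniq B1)
  (hbase : forall (E : closedFieldType) (phi : {rmorphism K -> E}) z b,
     (forall i, (sE s phi i).@[pt z b] = 0) -> exists a b0,
     [/\ a \in B1, z = omap phi a, b = phi b0 & forall i, (s i).@[pt a b0] = 0])
  (hW : forall (E : closedFieldType) (phi : {rmorphism K -> E}) z6,
        (map_mpoly phi W).@[z6] != 0 -> good s B1 o phi z6).
Let n := (d ^ 2 - \sum_(a <- B1) o a)%N.

Variable L : 'M[K]_3.
Hypotheses (uL : L \in unitmx) (hL : exists x, W.@[zL L x] != 0).
Let V := conn_poly W L.
Let Co := \prod_(z <- multi B1 o) ell z.

Lemma conn_neq0 : V != 0.
Proof. by case: hL => x; rewrite -conn_polyE -/V; apply: contraNneq => ->; rewrite meval0. Qed.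

Lemma conn_good x : V.@[x] != 0 -> good s B1 o idfun (zL L x).
Proof. by rewrite conn_polyE => nz; apply: hW; rewrite map_mpoly_idfun. Qed.

Lemma conn_eps x : V.@[x] != 0 ->
  eps x (ResJ s L) = res3 (pencil s idfun (xs (zL L x))) (pencil s idfun (ys (zL L x))).
Proof. by move=> /conn_good[G1 H1 _ _ _ _ _]; apply: (eps_ResJ hs). Qed.

Lemma line_chartZ (a : option K) c f : line_chart a (c *: f) = c *: line_chart a f.
Proof.
rewrite -mul_mpolyC; apply: etrans (rmorphM (line_chart a) _ _) _.
by rewrite -mul_polyC; congr (_ * _); apply: mmapC.
Qed.

Lemma ResJ_homog m : (ResJ s L)@_m \is (d ^ 2)%N.-homog.
Proof.
apply/dhomogP => k; rewrite mcoeff_msupp => nz; apply/eqP/negPn/negP => kd; case/negP: nz; apply/eqP.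
apply: (coef_test conn_neq0 (lam := mcoeff k)) => [f g|c f|x Vx]; [exact: mcoeffD|exact: mcoeffZ|].
rewrite conn_eps //; have [G1 H1 _ _ _ _ _] := conn_good Vx.
by apply: (dhomog_nemf_coeff (res3_homog (pencil_homog hs _ _) (pencil_homog hs _ _) G1 H1)).
Qed.

Lemma ResJ_order a k m : a \in B1 -> (k < o a)%N -> (line_chart a (ResJ s L)@_m)`_k = 0.
Proof.
move=> aB ko.
apply: (coef_test conn_neq0 (lam := fun f => (line_chart a f)`_k)) => [f g|c f|x Vx].
- by rewrite (rmorphD (line_chart a)) coefD.
- by rewrite line_chartZ coefZ.
rewrite conn_eps //; have [_ _ _ _ _ hord _] := conn_good Vx.
have [q] := hord a aB; have -> : omap idfun a = a by case: (a).
by move=> -> _; rewrite coefXnM ko.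
Qed.

Lemma ResJ_dvd m : exists q, (ResJ s L)@_m = Co * q.
Proof. by apply: (form_dvd uB1 (ResJ_homog m)) => a k; apply: ResJ_order. Qed.

Lemma cross_avoid (N : {mpoly K[3]}) : N != 0 ->
  exists x, V.@[x] != 0 /\ N.@[cross (xs (zL L x)) (ys (zL L x))] != 0.
Proof.
move=> nzN; pose o2 : 'I_3 := lift ord0 (lift ord0 ord0).
have dL : \det L != 0 by rewrite -unitfE -unitmxE.
pose row2 : {mpoly K[3]} := \sum_j L o2 j *: 'X_j.
have row2E p : row2.@[p] = mulmxf L p o2.
  by rewrite /row2 (raddf_sum (meval p)); apply: eq_bigr => j _ /=; rewrite mevalZ mevalXU.
have nzrow2 : row2 != 0.
  have nz1 : mulmxf L (fun j => invmx L j o2) o2 != 0.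
    rewrite (_ : mulmxf _ _ _ = (L *m invmx L) o2 o2); last by rewrite mxE.
    by rewrite mulmxV // mxE eqxx oner_neq0.
  by apply: contraNneq nz1 => r0; rewrite -row2E r0 meval0.
have [p] := mpoly_nonroot (mulf_neq0 nzN nzrow2).
rewrite mevalM mulf_eq0 negb_or row2E => /andP[Np Lp].
(* The cross product at x = L(mu p) is mu^2 (L p)_3 det L times p. This mu makes it p itself, so
   cross products reach a point where [N] is nonzero. *)
have [mu mu2] := closed_root_exists (mulmxf L p o2 * \det L)^-1 (isT : (0 < 2)%N).
have crossp : cross (xs (zL L (mulmxf L (fun i => mu * p i)))) (ys (zL L (mulmxf L (fun i => mu * p i)))) =1 p.
  move=> i; apply: etrans (zL_cross L _ i) _.
  have -> : mulmxf L (fun i => mu * p i) (lift ord0 (lift ord0 ord0)) = mu * mulmxf L p o2.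
    by rewrite /mulmxf mulr_sumr; apply: eq_bigr => j _; rewrite mulrCA.
  transitivity (mu ^+ 2 * (mulmxf L p o2 * \det L) * p i); first by ring.
  by rewrite mu2 mulVf ?mul1r // mulf_neq0.
pose V' := conn_poly (sub_cross N) L.
have V'E x : V'.@[x] = N.@[cross (xs (zL L x)) (ys (zL L x))].
  have := sub_cross_spec idfun (zL L x) N; rewrite spec6E !map_mpoly_idfun => <-.
  exact: conn_polyE.
have nzV' : V' != 0.
  apply: contraNneq Np => V0; rewrite -(meval_eq _ crossp) -V'E V0 meval0; exact: eqxx.
have [x] := mpoly_nonroot (mulf_neq0 conn_neq0 nzV').
by rewrite mevalM mulf_eq0 negb_or V'E => /andP[h1 h2]; exists x.
Qed.

Lemma common_zero_base z : (forall x, V.@[x] != 0 -> (eps x (ResJ s L)).@[rep z] = 0) -> z \in B1.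
Proof.
move=> hz; have [N [A [nzN NE]]] := curve_image s (line_form_neq0 z).
have [x [Vx Nx]] := cross_avoid nzN.
have [G1 H1 p0 hJ hl hord rnz] := conn_good Vx.
have := hz x Vx; rewrite conn_eps // => rz.
case: (line_zero_cases d0 hs G1 H1 p0 hJ (@hbase K idfun) hord rnz rz) => [[a aB ->]|[b [c nzc hc]]].
  by case: (a) aB.
case/negP: Nx; apply/eqP; rewrite -(map_mpoly_idfun N).
apply: (curve_avoid d0 hs (line_form_homog z) NE nzc hc).
have := line_form_pt (idfun : {rmorphism K -> K}) z b.
by case: (z).
Qed.

(** [D] divides the resultant at one good point, hence is a product of forms [ell z]; for z in [B1]
    the multiplicity is at most [o z]. *)
Lemma ResJ_content D : (forall m, exists r, (ResJ s L)@_m = D * r) -> exists r, Co = D * r.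
Proof.
move=> hD; have /(_ _)/constructive_indefinite_description-hq := hD.
pose q m := proj1_sig (hq m).
have qE m : (ResJ s L)@_m = D * q m by rewrite /q; case: (hq m).
have De x : eps x (ResJ s L) = D * \sum_(m <- msupp (ResJ s L)) (\prod_i x i ^+ m i) *: q m.
  by rewrite eps_sum mulr_sumr; apply: eq_bigr => m _; rewrite qE scalerAr.
have [x Vx] := mpoly_nonroot conn_neq0.
have [G1 H1 p0 hJ hl hord rnz] := conn_good Vx.
have [c [zs [nzc szs rE cB]]] := res3_factors hs G1 H1 hord rnz.
have := De x; rewrite conn_eps // rE => /esym/(dvd_prod_ell nzc)[c' [zs1 [zs2 [nzc' DE pz]]]].
have [|u hu] := @count_le_cat _ zs1 (multi B1 o).
  move=> z; rewrite count_multi //; case: ifP => [zB|/negbT zB].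
    rewrite -(cB z zB) (_ : omap idfun z = z); last by case: (z).
    by move/seq.permP: pz => ->; rewrite count_cat leq_addr.
  (* A factor [ell z] of [D] makes the resultant vanish at [rep z] for every good x, which
     [common_zero_base] allows only for base lines. *)
  rewrite leqn0 -leqn0 leqNgt -has_count has_pred1; apply: contra zB => z1.
  apply: common_zero_base => y Vy; rewrite De DE mevalM mevalZ.
  have /eqP -> : (\prod_(z <- zs1) ell z).@[rep z] == 0 by rewrite prod_ell_eval.
  by rewrite mulr0 mul0r.
exists (c'^-1 *: \prod_(z <- u) ell z).
by rewrite DE /Co (perm_big _ hu) /= big_cat -scalerAr -scalerAl scalerA mulVf // scale1r.
Qed.

Lemma good_primpart : primpart_deg_eq s L n.
Proof.
have hC : is_content (ResJ s L) Co by split; [exact: ResJ_dvd | exact: ResJ_content].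
have nzC : Co != 0 by apply: prod_ell_neq0.
have [x Vx] := mpoly_nonroot conn_neq0.
have [FL [_ szn _]] := good_fiber_list d0 hs uB1 hbase (conn_good Vx).
have dn : (d ^ 2 = \sum_(a <- B1) o a + n)%N by rewrite /n -szn addnK addnC.
have sC : msize Co = (\sum_(a <- B1) o a).+1.
  by rewrite (dhomog_msizeE (prod_ell_homog _) nzC) size_multi.
have nzR : ResJ s L != 0.
  have rnz := good_res (conn_good Vx); move: rnz; rewrite -conn_eps //.
  by apply: contraNneq => ->; rewrite rmorph0.
split.
  have /(_ _)/constructive_indefinite_description-hq := ResJ_dvd.
  exists Co, (\sum_(m <- msupp (ResJ s L)) proj1_sig (hq m) *: 'X_[m]); split=> //.
  rewrite {1}[ResJ s L]mpolyE mulr_sumr; apply: eq_bigr => m _.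
  by case: (hq m) => q /= ->; rewrite mul_mpolyC scalerA.
move=> C P [hC1 hC2] RE.
have [r CE] := hC.2 C hC1; have [r' CE'] := hC2 Co ResJ_dvd.
(* Any two contents divide each other and so have the same degree. Every nonzero coefficient of the
   resultant has degree d^2, which leaves degree n for each coefficient of [P]. *)
have sC' : msize C = (\sum_(a <- B1) o a).+1 by rewrite -sC; apply: msize_mutual_dvd nzC CE CE'.
have sP m : m \in msupp P -> msize P@_m = n.+1.
  move=> mP; have RmE : (ResJ s L)@_m = C * P@_m by rewrite RE mcoeffCM.
  have nzCP : C * P@_m != 0.
    rewrite mulf_neq0 //; last by rewrite -mcoeff_msupp.
    by rewrite -msize_poly_eq0 sC'.
  apply: (msize_cofactor nzCP _ sC').
  by rewrite -dn -RmE; apply: dhomog_msizeE (ResJ_homog m) _; rewrite RmE.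
have : msupp P != [::] by rewrite msupp_eq0; apply: contraNneq nzR => P0; rewrite RE P0 mulr0.
rewrite /deg_t; case e: (msupp P) => [//|m0 l] _; rewrite -e.
apply/eqP; rewrite eqn_leq; apply/andP; split.
  by apply/bigmax_leqP_seq => m mP _; rewrite sP.
have m0P : m0 \in msupp P by rewrite e mem_head.
by have := leq_bigmax_seq (F := fun m => (msize P@_m).-1) m0 m0P isT; rewrite sP.
Qed.

End Content.

Lemma e001_pole (K : fieldType) : e001 K =1 @pole K.
Proof. by elim/ord3_ind. Qed.

(* If d = 0 then S is constant, so its image lies on a line. *)
Lemma dominant_degree (K : closedFieldType) d (s : 'I_3 -> {mpoly K[3]}) :
  (forall i, s i \is d.-homog) -> (forall i, (s i).@[@pole K] != 0) -> dominant s -> (0 < d)%N.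
Proof.
move=> hs s1 sdom; rewrite lt0n; apply/negP => /eqP d0; rewrite d0 in hs.
pose o1 : 'I_3 := lift ord0 ord0.
have sE i t : (s i).@[t] = (s i)@_0 by rewrite {1}(dhomog0_const (hs i)) mevalC.
pose P : {mpoly K[3]} := (s o1)@_0 *: 'X_ord0 - (s ord0)@_0 *: 'X_o1.
have P0 : P = 0.
  apply: sdom => [|t _ _]; first by exists 1%N; apply: rpredB; apply: dhomogZ; rewrite dhomogX /= mdeg1.
  by rewrite /P mevalB !mevalZ !mevalXU /evalS !sE mulrC subrr.
have := s1 o1; rewrite sE; case/negP.
have : P.@[fun i => (i == ord0)%:R] = 0 by rewrite P0 meval0.
by rewrite /P mevalB !mevalZ !mevalXU /= mulr1 mulr0 subr0 => ->.
Qed.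

(** For fixed x the condition is the nonvanishing of a polynomial in the entries of L, and scaling L
    amounts to scaling x. *)
Lemma zopen_conn (K : closedFieldType) (W : {mpoly K[6]}) :
  zopen_PGL3 (fun L => L \in unitmx /\ exists x, W.@[zL L x] != 0).
Proof.
split=> [L c nzc [uL [x nz]]|].
  split; first by rewrite unitmxZ // unitfE.
  exists (fun i => c^-1 * x i); rewrite (meval_eq _ (zL_scale c L _)).
  by rewrite (meval_eq _ (eq_zL L (x' := x) _)) // => i; rewrite mulVKf.
pose Lgen : 'M[{mpoly K[3 * 3]}]_3 := \matrix_(i, j) 'X_(mxvec_index i j).
pose f x := mmap (@mpolyC (3 * 3) K) (zL Lgen (fun i => (x i)%:MP)) W.
have fE x L : (f x).@[fun k => mxvec L 0 k] = W.@[zL L x].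
  apply: (mpoly_rmorph_ext (f := meval _ \o mmap (@mpolyC (3 * 3) K) _) (g := meval (zL L x))) => [c|i] /=.
    by rewrite mmapC !mevalC.
  rewrite mmapXU mevalXU (rmorph_zL (meval _)) (eq_zL _ (x' := x)) => [|j /=]; last exact: mevalC.
  by congr (zL _ _ _); apply/matrixP => a b; rewrite !mxE /= mevalXU mxvecE.
exists (fun g => exists x, g = f x) => L; split=> [[uL [x nz]]|[uL [g [[x ->] nz]]]].
  by split=> //; exists (f x); split; [exists x | rewrite fE].
by split=> //; exists x; rewrite -fE.
Qed.

Theorem theorem3p6 (K : closedFieldType) (hK : [pchar K] =i pred0)
  (d : nat) (s : 'I_3 -> {mpoly K[3]})
  (hs_hom : forall i, s i \is d.-homog)
  (hs_gcd : gcd_one s)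
  (hs_dom : dominant s)
  (hs_001 : forall i, (s i).@[e001 K] != 0) :
  exists n : nat, is_degMap s n /\
    (forall (F : closedFieldType) (phi : {rmorphism K -> F}) (z : 'I_6 -> F),
       is_closure_Kxy phi z ->
       exists m : nat, mult_base phi z s m /\
         (m%:Z = (d ^ 2)%N%:Z - n%:Z)) /\
    (exists Om : 'M[K]_3 -> Prop, zopen_PGL3 Om /\ (exists L, Om L) /\
       forall L, Om L -> primpart_deg_eq s L n).
Proof.
have s1 i : (s i).@[@pole K] != 0 by rewrite -(meval_eq _ (@e001_pole K)).
have d0 := dominant_degree hs_hom s1 hs_dom.
have [B1 [bl [o [W [uB1 ubl hbl nzW [hbase hW]]]]]] := generic_good hK d0 hs_hom s1 hs_gcd hs_dom.
exists (d ^ 2 - \sum_(a <- B1) o a)%N; split; [|split].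
- exact: (good_degMap d0 hs_hom uB1 nzW hbase hW).
- move=> F phi z [zind _]; apply: (good_mult_base d0 hs_hom s1 uB1 ubl hbl hbase).
  (* Algebraic independence of the coordinates of [z] is what keeps [W] from vanishing at the
     generic pair. *)
  by apply: hW; apply: contra_neq nzW; apply: zind.
- exists (fun L => L \in unitmx /\ exists x, W.@[zL L x] != 0); split; [|split].
  + exact: zopen_conn.
  + by have [L [p [uL nz]]] := conn_exists nzW hW; exists L; split=> //; exists (mulmxf L p).
  + by move=> L [uL hL]; apply: (good_primpart d0 hs_hom uB1 hbase hW uL hL).
Qed.
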